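(* Let $C_{7,j}(q)=\sum_{n\ge0}a_{7,j}(n)q^n$. Then $$C_{7,1}(q) = q \frac{E(q^{28})E^3(q^{14})E(q^4)}{E(q^2)} \{ \sigma(q^4) + q^2 \psi(q^2) \psi(q^{14}) \},$$ and $$C_{7,0}(q) = \omega(q^2) \left\{ \psi^2(q^4) \varphi^2(q^{14}) + q^6 \psi^2(q^{28}) \varphi^2(q^2) + q^2 \frac{E(q^{28})E^3(q^{14})E(q^4)}{E(q^2)} \right\} + q^2 \psi(q^4) \psi^2(q^{14}) \varphi^3(q^{14}) + 2q^4 \psi^3(q^2) \psi^3(q^{14}) + 4q^{12} \psi^2(q^{14}) \psi^3(q^{28}) \varphi(q^2).$$
   Context: For $|q|<1$, $E(q)=\prod_{n\ge1}(1-q^n)$, $\varphi(q)=\sum_{n=-\infty}^{\infty}q^{n^2}$, $\psi(q)=\sum_{n=-\infty}^{\infty}q^{2n^2-n}=\sum_{n\ge0}q^{n(n+1)/2}$. Define $\omega(q)=\psi(q^4)\varphi(q^{14})+q^3\psi(q^{28})\varphi(q^2)$ and $\sigma(q)=\varphi(q)\varphi(q^7)+4q^2\psi(q^2)\psi(q^{14})$. A partition is a $7$-core if it has no hook of length $7$. The BG-rank of a partition $(\lambda_1\ge\dots\ge\lambda_r)$ is $\sum_{j=1}^r(-1)^{j+1}\mathrm{par}(\lambda_j)$, where $\mathrm{par}(\lambda)=1$ if $\lambda$ is odd and $0$ if even. $a_{7,j}(n)$ is the number of 7-core partitions of $n$ with BG-rank $j$. *)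

(* Defs.v *)
From mathcomp Require Export all_boot all_order all_algebra.
From mathcomp Require Export all_classical all_reals all_analysis.
From mathcomp Require Export complex.

Set Implicit Arguments.
Unset Strict Implicit.
Unset Printing Implicit Defensive.

Import Order.TTheory GRing.Theory Num.Theory.
Import numFieldNormedType.Exports.

Local Open Scope ring_scope.
Local Open Scope classical_set_scope.

Section Partitions.
Local Open Scope nat_scope.

Definition is_partition_of (n : nat) (s : seq nat) : bool :=
  [&& sorted geq s, 0 \notin s & sumn s == n].

Definition conj_part (s : seq nat) (j : nat) : nat := count (fun x => j < x) s.

(* Hook length of the cell in row i and column j, both numbered from 0:
   arm + leg + 1. *)
Definition hook_length (s : seq nat) (i j : nat) : nat :=
  (nth 0 s i - j.+1) + (conj_part s j - i.+1) + 1.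

Definition is_core (t : nat) (s : seq nat) : bool :=
  [forall i : 'I_(size s), [forall j : 'I_(nth 0 s i), hook_length s i j != t]].

(* Rows are numbered from 0, so the sign (-1)^(j+1) of the j-th part becomes
   (-1)^i with i = j - 1. *)
Definition BG_rank (s : seq nat) : int :=
  (\sum_(i < size s) (-1) ^+ i * (odd (nth 0%N s i))%:Z)%R.

(* A partition of n has at most n parts, each of them at most n, so all of them
   occur, exactly once, among the n-bounded sequences over 'I_n.+1. *)
Definition num_cores (t : nat) (j : int) (n : nat) : nat :=
  #|[pred s : {bseq n of 'I_n.+1} |
      let p := [seq nat_of_ord x | x <- s] in
      [&& is_partition_of n p, is_core t p & BG_rank p == j]]|.

End Partitions.

Definition has_sum (K : numFieldType) (u : nat -> K) (l : K) : Prop :=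
  series u @ \oo --> l.

Definition bilateral_sum (K : numFieldType) (f : int -> K) : K :=
  limn (series (fun n : nat => f n%:Z)) +
  limn (series (fun n : nat => f (- n.+1%:Z))).

Definition E (K : numFieldType) (q : K) : K :=
  limn (fun N : nat => \prod_(1 <= n < N.+1) (1 - q ^+ n)).

Definition varphi (K : numFieldType) (q : K) : K :=
  bilateral_sum (fun n : int => q ^ (n ^+ 2)).

Definition psi (K : numFieldType) (q : K) : K :=
  bilateral_sum (fun n : int => q ^ (2 * n ^+ 2 - n)).

Definition omega (K : numFieldType) (q : K) : K :=
  psi (q ^+ 4) * varphi (q ^+ 14) + q ^+ 3 * psi (q ^+ 28) * varphi (q ^+ 2).

Definition sigma (K : numFieldType) (q : K) : K :=
  varphi q * varphi (q ^+ 7) + 4 * q ^+ 2 * psi (q ^+ 2) * psi (q ^+ 14).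

(* Main.v *)
(* A 7-core of n is a bead configuration on an abacus with seven runners, hence an
   integer vector v with v_r = r (mod 7), zero sum and |v|^2 = 14 n + 28; it has
   BG-rank j exactly when 4 - 2 j of its entries are odd.  With D_k the theta series
   of such vectors with k odd entries, dropping the zero-sum condition multiplies
   D_k by a theta series in one variable and makes the generating function factor as
   prod_r (A_r + w B_r), A_r and B_r being the even and odd parts of
   sum x^(i^2), i = r (mod 7).  Comparing powers of w, and using the triple product
   for the extreme coefficients (for D_6 with signs), gives eight relations from
   which D_2 and D_4 are eliminated.  They reduce to a modular equation of degree
   seven, m^2 - 7 = m (8 s^3 - 12 s^2 + 16 s - 6), for m = phi(Q)^2 / phi(Q^7)^2 and
   s = 2 Q psi(Q) psi(Q^7) / (phi(Q) phi(Q^7)), and both identities are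
   consequences of it between formal power series.  Absolutely convergent power
   series may be added, multiplied and dilated, so the identities can be evaluated
   at any |q| < 1. *)

Require Import Defs.
From HB Require Import structures.
From mathcomp Require Import zify ring lra finmap fraction.

Set Implicit Arguments.
Unset Strict Implicit.
Unset Printing Implicit Defensive.
Import Order.TTheory GRing.Theory Num.Theory.
Import numFieldNormedType.Exports.

Local Open Scope ring_scope.
Local Open Scope classical_set_scope.

(** The elimination divides freely, so it is carried out in a field, later the fraction field of the
    integral formal series. Algebra in a field determines the wanted series only up to extraneous
    factors and choices of roots, and these choices shape the proof: the field argument takes them
    as hypotheses, and integer coefficients discharge them. A factor is excluded by a nonzero
    coefficient of order 0 or 1; square and eighth roots are fixed by a constant term 1 or by
    nonnegative coefficients; cube roots are unique because f^2 + f g + g^2 is definite. In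
    classical notation, with alpha = 1 - phi(-Q)^4 / phi(Q)^4 and beta the same quantity at Q^7, s
    is the eighth root of alpha beta and m is the multiplier. The complementary eighth root, that of
    (1 - alpha) (1 - beta), turns out to be 1 - s, which is Guetzlaff's equation. Vectors are
    counted by x^(i^2), so a core of n has weight x^(14 n + 28), while the theta functions live in Q
    = x^28. Hence q = x^14 and Q = q^2. The record [fps] keeps the convolution product apart from
    the pointwise product that functions already carry. *)

Record fps (K : Type) := Fps { fcoef :> nat -> K }.

Lemma fpsP (K : Type) (f g : fps K) : (forall n, f n = g n) -> f = g.
Proof. by case: f g => f [g] /= fg; congr Fps; apply: funext. Qed.

HB.instance Definition _ (K : Type) := gen_eqMixin (fps K).
HB.instance Definition _ (K : Type) := gen_choiceMixin (fps K).

(** * The ring of formal power series *)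

Section FpsRing.
Variable K : comNzRingType.
Implicit Types f g h : fps K.

Definition fadd f g : fps K := Fps (fun n => f n + g n).
Definition fopp f : fps K := Fps (fun n => - f n).
Definition fzero : fps K := Fps (fun _ => 0).
Definition fmul f g : fps K := Fps (fun n => \sum_(i < n.+1) f i * g (n - i)%N).
Definition fconst (c : K) : fps K := Fps (fun n => if n is 0%N then c else 0).

Definition ftrunc N f : {poly K} := \poly_(i < N) f i.

Lemma coef_ftrunc N f i : (i < N)%N -> (ftrunc N f)`_i = f i.
Proof. by move=> iN; rewrite coef_poly iN. Qed.

Lemma coef_fmul N f g n : (n < N)%N -> fmul f g n = (ftrunc N f * ftrunc N g)`_n.
Proof.
move=> nN; rewrite coefM /=; apply: eq_bigr => i _.
by rewrite !coef_ftrunc //; have := ltn_ord i; lia.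
Qed.

(** Coefficient n of a product depends only on the truncations of the factors beyond order n, so the
    law is inherited from polynomials. *)
Lemma fmulA : associative fmul.
Proof.
move=> f g h; apply: fpsP => n.
transitivity ((ftrunc n.+1 f * (ftrunc n.+1 g * ftrunc n.+1 h))`_n).
  rewrite coefM /=; apply: eq_bigr => i _.
  rewrite coef_ftrunc; last by have := ltn_ord i; lia.
  by rewrite -coef_fmul //; lia.
rewrite mulrA coefM /=; apply: eq_bigr => i _.
rewrite coef_ftrunc; last by lia.
by rewrite -coef_fmul //; have := ltn_ord i; lia.
Qed.

Lemma fmulC : commutative fmul.
Proof.
move=> f g; apply: fpsP => n.
by rewrite (coef_fmul f g (ltnSn n)) (coef_fmul g f (ltnSn n)) mulrC.
Qed.

Lemma fmul1 : left_id (fconst 1) fmul.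
Proof.
move=> f; apply: fpsP => n /=; rewrite big_ord_recl /= mul1r subn0.
by rewrite big1 ?addr0 // => i _; rewrite /= mul0r.
Qed.

Lemma fmulDl : left_distributive fmul fadd.
Proof.
move=> f g h; apply: fpsP => n /=; rewrite -big_split /=.
by apply: eq_bigr => i _; rewrite mulrDl.
Qed.

Lemma faddA : associative fadd.
Proof. by move=> f g h; apply: fpsP => n /=; rewrite addrA. Qed.
Lemma faddC : commutative fadd.
Proof. by move=> f g; apply: fpsP => n /=; rewrite addrC. Qed.
Lemma fadd0 : left_id fzero fadd.
Proof. by move=> f; apply: fpsP => n /=; rewrite add0r. Qed.
Lemma faddN : left_inverse fzero fopp fadd.
Proof. by move=> f; apply: fpsP => n /=; rewrite addNr. Qed.

HB.instance Definition _ := GRing.isZmodule.Build (fps K) faddA faddC fadd0 faddN.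

Lemma fconst1_neq0 : fconst 1 != 0 :> fps K.
Proof. by apply/eqP => /(congr1 (fun f : fps K => f 0%N)) /= /eqP; rewrite oner_eq0. Qed.

HB.instance Definition _ := GRing.Zmodule_isComNzRing.Build (fps K)
  fmulA fmulC fmul1 fmulDl fconst1_neq0.

Lemma fcoef0 n : (0 : fps K) n = 0. Proof. by []. Qed.
Lemma fcoefD f g n : (f + g) n = f n + g n. Proof. by []. Qed.
Lemma fcoefN f n : (- f) n = - f n. Proof. by []. Qed.
Lemma fcoefM f g n : (f * g) n = \sum_(i < n.+1) f i * g (n - i)%N.
Proof. by []. Qed.
Lemma fcoef1 n : (1 : fps K) n = (n == 0%N)%:R. Proof. by case: n. Qed.
Lemma fcoefM0 f g : (f * g) 0%N = f 0%N * g 0%N.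
Proof. by rewrite fcoefM big_ord1. Qed.

Lemma fcoef_sum (I : Type) (r : seq I) (P : pred I) (F : I -> fps K) n :
  (\sum_(i <- r | P i) F i) n = \sum_(i <- r | P i) F i n.
Proof. by elim/big_rec2: _ => // i x y _ <-. Qed.

Definition fXn (k : nat) : fps K := Fps (fun n => (n == k)%:R).

Lemma fcoefXnM k f n : (fXn k * f) n = if (k <= n)%N then f (n - k)%N else 0.
Proof.
rewrite fcoefM /=; case: ifP => kn.
  have kn' : (k < n.+1)%N by [].
  rewrite (bigD1 (Ordinal kn')) //= eqxx mul1r big1 ?addr0 // => i.
  by rewrite -val_eqE /= => /negbTE ->; rewrite mul0r.
rewrite big1 // => i _; case: eqP => [E|]; last by rewrite mul0r.
by have := ltn_ord i; rewrite E ltnS kn.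
Qed.

Lemma fXnM j k : fXn j * fXn k = fXn (j + k).
Proof.
apply: fpsP => n; rewrite fcoefXnM /=; case: leqP => h.
  by congr (_%:R); lia.
by rewrite (_ : (n == _) = false) //; lia.
Qed.

Lemma fXnE j k : fXn j ^+ k = fXn (j * k).
Proof.
elim: k => [|k IH]; first by rewrite muln0; apply: fpsP => n; rewrite fcoef1.
by rewrite exprS IH fXnM mulnS.
Qed.

Lemma fXn0 : fXn 0 = 1. Proof. by apply: fpsP => n; rewrite fcoef1. Qed.

End FpsRing.
Arguments fXn {K}.
Arguments fconst {K}.

Section FpsMorph.
Variables K K' : comNzRingType.

Definition fmap (h : K -> K') (f : fps K) : fps K' := Fps (fun n => h (f n)).

Lemma fmapE h f n : fmap h f n = h (f n). Proof. by []. Qed.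

Lemma fmap_zmod (h : {additive K -> K'}) : zmod_morphism (fmap h).
Proof. by move=> f g; apply: fpsP => n /=; rewrite raddfB. Qed.
HB.instance Definition _ (h : {additive K -> K'}) :=
  GRing.isZmodMorphism.Build (fps K) (fps K') (fmap h) (fmap_zmod h).

Section M.
Variable h : {rmorphism K -> K'}.
Lemma fmap_mon : monoid_morphism (fmap h).
Proof.
split=> [|f g]; apply: fpsP => n; first by rewrite fmapE !fcoef1 rmorph_nat.
by rewrite fmapE !fcoefM rmorph_sum; apply: eq_bigr => i _; rewrite rmorphM.
Qed.
HB.instance Definition _ := GRing.isMonoidMorphism.Build (fps K) (fps K') (fmap h) fmap_mon.
End M.
End FpsMorph.

(** * The substitutions x -> x^d and x -> -x *)

Section FpsDil.
Variable K : comNzRingType.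
Implicit Types f g : fps K.

Definition dil (d : nat) f : fps K :=
  Fps (fun n => if (d %| n)%N then f (n %/ d)%N else 0).

Lemma dilE d f n : dil d f n = if (d %| n)%N then f (n %/ d)%N else 0.
Proof. by []. Qed.

Lemma dil_sum (d m : nat) (F : nat -> K) : (0 < d)%N ->
  \sum_(i < (d * m).+1) (if (d %| i)%N then F (i %/ d)%N else 0) = \sum_(j < m.+1) F j.
Proof.
move=> d0; rewrite -!(big_mkord xpredT (fun i => if (d %| i)%N then F (i %/ d)%N else 0)).
rewrite -!(big_mkord xpredT F).
elim: m => [|m IH]; first by rewrite muln0 !big_nat1 dvdn0 div0n.
rewrite (@big_cat_nat _ _ _ (d * m).+1) //=; last by rewrite ltnS leq_mul2l leqnSn orbT.
rewrite IH [in RHS]big_nat_recr //=; congr (_ + _).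
rewrite big_nat_recr ?leq_mul2l ?ltn_pmul2l //= dvdn_mulr // mulKn //.
rewrite big_nat_cond big1 ?add0r // => i /andP[/andP[i1 i2] _].
case: ifP => // /dvdnP[k E]; move: i1 i2; rewrite E ![(_ * d)%N]mulnC.
by rewrite !ltn_pmul2l // => a b; lia.
Qed.

Section D.
Variable d' : nat.
Let d := d'.+1.
Lemma dil_zmod : zmod_morphism (dil d).
Proof. by move=> f g; apply: fpsP => n /=; case: ifP; rewrite ?subr0. Qed.
Lemma dil_mon : monoid_morphism (dil d).
Proof.
split=> [|f g]; apply: fpsP => n.
  rewrite dilE !fcoef1; case: ifP => [/dvdnP[k ->]|dn]; first by rewrite mulnK // muln_eq0 orbF.
  by case: n dn.
rewrite dilE [RHS]fcoefM; case: ifP => [/dvdnP[m ->]|dn].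
  rewrite mulnK // mulnC fcoefM.
  rewrite -(@dil_sum d m (fun j => f j * g (m - j)%N)) //; apply: eq_bigr => i _.
  rewrite !dilE; case: ifP => di; last by rewrite mul0r.
  rewrite dvdn_subr ?dvdn_mulr //; last by rewrite -ltnS.
  case/dvdnP: di => k ->; rewrite [(k * d)%N]mulnC -mulnBr dvdn_mulr //.
  by rewrite ![(d * _ %/ _)%N]mulKn.
rewrite big1 // => i _; rewrite !dilE; case: ifP => di; last by rewrite mul0r.
case: ifP => di'; last by rewrite mulr0.
by move: (dvdn_add di di'); rewrite subnKC ?dn // -ltnS.
Qed.
HB.instance Definition _ := GRing.isZmodMorphism.Build (fps K) (fps K) (dil d) dil_zmod.
HB.instance Definition _ := GRing.isMonoidMorphism.Build (fps K) (fps K) (dil d) dil_mon.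
End D.

Lemma dil_inj d : (0 < d)%N -> injective (dil d).
Proof.
move=> d0 f g fg; apply: fpsP => n.
by have := congr1 (fun h : fps K => h (d * n)%N) fg; rewrite !dilE dvdn_mulr // mulKn.
Qed.

Lemma dil_comp d e f : (0 < d)%N -> (0 < e)%N -> dil d (dil e f) = dil (d * e) f.
Proof.
move=> d0 e0; apply: fpsP => n; rewrite !dilE.
have [/dvdnP[k ->]|nd] := ifP.
  rewrite mulnK // [(k * d)%N]mulnC dvdn_pmul2l //.
  by case: ifP => // _; rewrite divnMA mulKn.
by case: ifP => // /(dvdn_trans (dvdn_mulr e (dvdnn d))); rewrite nd.
Qed.

Lemma dilXn d k : (0 < d)%N -> dil d (fXn k) = fXn (d * k).
Proof.
move=> d0; apply: fpsP => n /=; case: ifP => [/dvdnP[j ->]|nd].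
  by rewrite mulnK // [(j * d)%N]mulnC eqn_pmul2l.
by case: eqP => // E; move: nd; rewrite E dvdn_mulr.
Qed.

Lemma dil_coef0 d f : (dil d f) 0%N = f 0%N.
Proof. by rewrite /= dvdn0 div0n. Qed.

(* the substitution [x -> -x] *)
Definition ftwist f : fps K := Fps (fun n => (-1) ^+ n * f n).
Lemma ftwistE f n : ftwist f n = (-1) ^+ n * f n. Proof. by []. Qed.
Lemma ftwist_zmod : zmod_morphism ftwist.
Proof. by move=> f g; apply: fpsP => n /=; rewrite mulrBr. Qed.
Lemma ftwist_mon : monoid_morphism ftwist.
Proof.
split=> [|f g]; apply: fpsP => n; first by rewrite ftwistE !fcoef1; case: n => [|n]; rewrite ?mulr1 ?mulr0.
rewrite ftwistE !fcoefM mulr_sumr; apply: eq_bigr => i _.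
have -> : (-1) ^+ n = (-1) ^+ i * (-1) ^+ (n - i) :> K by rewrite -exprD subnKC // -ltnS.
by rewrite mulrACA.
Qed.
HB.instance Definition _ := GRing.isZmodMorphism.Build (fps K) (fps K) ftwist ftwist_zmod.
HB.instance Definition _ := GRing.isMonoidMorphism.Build (fps K) (fps K) ftwist ftwist_mon.

End FpsDil.

(** * Formal series over a domain form a domain *)

Section FpsIdomain.
Variable K : idomainType.
Implicit Types f g : fps K.

(** Units are given by bare existence and inverses by choice: all that matters is to reach the
    integral domain structure, on which the fraction field is built. *)
Definition funit f : bool := `[< exists g, g * f = 1 >].
Definition finv f : fps K :=
  if pselect (exists g, g * f = 1) is left h then projT1 (cid h) else f.

Lemma fmulV : {in funit, left_inverse 1 finv *%R}.
Proof.
move=> f /asboolP fu; rewrite /finv; case: pselect => // h.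
exact: (projT2 (cid h)).
Qed.
Lemma funitPl f g : g * f = 1 -> funit f.
Proof. by move=> gf; apply/asboolP; exists g. Qed.
Lemma finv_out : {in [predC funit], finv =1 id}.
Proof. by move=> f /negP fu; rewrite /finv; case: pselect => // h; case: fu; apply/asboolP. Qed.

HB.instance Definition _ := GRing.ComNzRing_hasMulInverse.Build (fps K)
  fmulV funitPl finv_out.

Lemma fps_lead f : f != 0 -> exists2 n, f n != 0 & forall i, (i < n)%N -> f i = 0.
Proof.
move=> f0; have [n fn] : exists n, f n != 0.
  apply: contrapT => h; case/eqP: f0; apply: fpsP => n.
  by apply: contrapT => fn; apply: h; exists n; apply/eqP.
exists (ex_minn (ex_intro (fun n => f n != 0) n fn)); case: ex_minnP => // k fk kmin i ik.
by apply/eqP/contraT => fi; move: (kmin _ fi); rewrite leqNgt ik.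
Qed.

Lemma fcoefM_lead f g m n : (forall i, (i < m)%N -> f i = 0) ->
  (forall i, (i < n)%N -> g i = 0) -> (f * g) (m + n)%N = f m * g n.
Proof.
move=> fm gn; rewrite fcoefM.
have mn : (m < (m + n).+1)%N by rewrite ltnS leq_addr.
rewrite (bigD1 (Ordinal mn)) //= addKn big1 ?addr0 // => i.
rewrite -val_eqE /= => im; case: (ltngtP i m) => [h|h|/eqP]; last by rewrite (negbTE im).
  by rewrite fm ?mul0r.
by rewrite gn ?mulr0 //; have := ltn_ord i; lia.
Qed.

Lemma fps_integral f g : f * g = 0 -> (f == 0) || (g == 0).
Proof.
move=> fg; apply: contraT; rewrite negb_or => /andP[/fps_lead[m fm fm0] /fps_lead[n gn gn0]].
move/(congr1 (fun h : fps K => h (m + n)%N)): fg; rewrite fcoefM_lead // fcoef0.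
by move/eqP; rewrite mulf_eq0 (negbTE fm) (negbTE gn).
Qed.

HB.instance Definition _ := GRing.ComUnitRing_isIntegral.Build (fps K) fps_integral.

End FpsIdomain.

(** * Generating series of weighted sets *)

(** This makes each coefficient of the series a genuine finite sum; a sum with infinite support
    would silently take the value 0. *)
Definition locfin (I : Type) (D : set I) (e : I -> nat) : Prop :=
  forall n, finite_set [set i | D i /\ (e i <= n)%N].

(* The formal series [\sum_(i in D) w i * x ^ e i]. *)
Definition gsum (K : comNzRingType) (I : choiceType) (D : set I) (e : I -> nat)
    (w : I -> K) : fps K :=
  Fps (fun n => \sum_(i \in [set i | D i /\ e i = n]) w i).

Section Gsum.
Variable K : comNzRingType.

Lemma gsumE (I : choiceType) (D : set I) e (w : I -> K) n :
  gsum D e w n = \sum_(i \in [set i | D i /\ e i = n]) w i.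
Proof. by []. Qed.

Lemma locfin_eq (I : Type) (D : set I) e n :
  locfin D e -> finite_set [set i | D i /\ e i = n].
Proof. by move=> /(_ n); apply: sub_finite_set => i [Di <-]. Qed.

Lemma gsum_reindex (I J : choiceType) (h : I -> J) (D : set I) (D' : set J)
    e e' (w : I -> K) (w' : J -> K) :
  set_bij D D' h -> (forall i, D i -> e' (h i) = e i) ->
  (forall i, D i -> w' (h i) = w i) -> gsum D' e' w' = gsum D e w.
Proof.
move=> [hD hinj hsurj] he hw; apply: fpsP => n; rewrite !gsumE.
rewrite (reindex_fsbig h [set i | D i /\ e i = n]).
  by apply: eq_fsbigr => i /set_mem[Di _]; apply: hw.
split.
- by move=> i [Di <-]; split; [apply: hD | rewrite he].
- move=> i j /set_mem[Di _] /set_mem[Dj _]; exact: hinj (mem_set Di) (mem_set Dj).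
- move=> j [/hsurj[i Di <-] ein]; exists i => //; split=> //.
  by rewrite -ein he.
Qed.

Lemma eq_gsum (I : choiceType) (D D' : set I) e e' (w w' : I -> K) :
  (forall i, D i <-> D' i) -> (forall i, D i -> e i = e' i) ->
  (forall i, D i -> w i = w' i) -> gsum D e w = gsum D' e' w'.
Proof.
move=> DD he hw; have <- : D = D' by apply/seteqP; split=> i /DD.
apply: fpsP => n; rewrite !gsumE.
have -> : [set i | D i /\ e' i = n] = [set i | D i /\ e i = n].
  by apply/seteqP; split=> i [Di <-]; split=> //; rewrite he.
by apply: eq_fsbigr => i /set_mem[Di _]; apply: hw.
Qed.

Lemma gsum_box (I : choiceType) (D B : set I) e (w : I -> K) n :
  (forall i, B i -> D i) -> (forall i, D i -> e i = n -> B i) ->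
  gsum D e w n = \sum_(i \in B) (if e i == n then w i else 0).
Proof.
move=> BD DB; rewrite gsumE.
under eq_fsbigr => i /set_mem[Di ein] do rewrite -[w i]/(if true then w i else 0) -(introT eqP ein).
apply: fsbig_widen => [i [Di ein]|i [Bi] /=]; first exact: DB.
by case: eqP => // ein [] ; split=> //; apply: BD.
Qed.

(** Only indices of exponent at most n reach coefficient n, so the Cauchy product reduces to
    exchanging sums over the finite box [A] times [B]. *)
Lemma gsum_mul (I J : choiceType) (D : set I) (D' : set J) e e' (w : I -> K) (w' : J -> K) :
  locfin D e -> locfin D' e' ->
  gsum D e w * gsum D' e' w' =
  gsum (D `*` D') (fun p => e p.1 + e' p.2)%N (fun p => w p.1 * w' p.2).
Proof.
move=> De De'; apply: fpsP => n; rewrite fcoefM.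
pose A := [set i | D i /\ (e i <= n)%N]; pose B := [set i | D' i /\ (e' i <= n)%N].
have fA : finite_set A by exact: De.
have fB : finite_set B by exact: De'.
rewrite (@gsum_box _ _ (A `*` B)); last 2 first.
- by move=> [i j] [[? _] [? _]].
- by move=> [i j] /= [Di Dj] E; split; split=> //; rewrite -E (leq_addr, leq_addl).
rewrite -(@pair_fsbig _ _ _ _ _ _ _ (fun i j => if (e i + e' j == n)%N then w i * w' j else 0)) //.
rewrite fsbig_finite //; under [RHS]eq_bigr => i _ do rewrite fsbig_finite //.
transitivity (\sum_(a < n.+1) \sum_(i <- fset_set A) \sum_(j <- fset_set B)
   (if e i == a then w i else 0) * (if e' j == (n - a)%N then w' j else 0)).
  apply: eq_bigr => a _; rewrite (@gsum_box _ D A) ?(@gsum_box _ D' B).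
  - rewrite !fsbig_finite // big_distrl /=; apply: eq_bigr => i _.
    by rewrite big_distrr.
  - by move=> i [].
  - by move=> i Di E; split=> //; rewrite E leq_subr.
  - by move=> i [].
  - by move=> i Di E; split=> //; rewrite E -ltnS.
apply: etrans (exchange_big _ _ _ _ _ _) _; apply: eq_big_seq => i iA.
apply: etrans (exchange_big _ _ _ _ _ _) _; apply: eq_big_seq => j jB.
have {iA} [Di ein] : A i by move: iA; rewrite in_fset_set // => /set_mem.
have ein' : (e i < n.+1)%N by [].
rewrite (bigD1 (Ordinal ein')) //= eqxx big1 ?addr0; last first.
  by move=> a; rewrite -val_eqE /= eq_sym => /negbTE ->; rewrite mul0r.
rewrite (_ : (e' j == _) = (e i + e' j == n)%N); last by apply/eqP/eqP; lia.
by case: ifP; rewrite ?mulr0.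
Qed.

Lemma locfin_mul (I J : Type) (D : set I) (D' : set J) e e' :
  locfin D e -> locfin D' e' -> locfin (D `*` D') (fun p => e p.1 + e' p.2)%N.
Proof.
move=> De De' n; apply: sub_finite_set (finite_setX (De n) (De' n)).
by move=> [i j] /= [[Di Dj] le]; split; split=> //; lia.
Qed.

Lemma gsum1 (I : choiceType) (D : set I) e (i0 : I) (w : I -> K) :
  D = [set i0] -> gsum D e w = fconst (w i0) * fXn (e i0).
Proof.
move=> ->; apply: fpsP => n; rewrite gsumE mulrC fcoefXnM /=.
have [->|ne] := eqVneq n (e i0).
  rewrite leqnn subnn /= (_ : [set i | _] = [set i0]) ?fsbig_set1 //.
  by apply/seteqP; split=> i /=; [case | move=> ->].
rewrite fsbig1 => [|i [-> E]]; last by rewrite E eqxx in ne.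
case: leqP => // h; case E : (n - e i0)%N => //=.
by case/eqP: ne; apply/eqP; rewrite eqn_leq h -subn_eq0 E.
Qed.

Lemma gsumXn (I : choiceType) (D : set I) e (w : I -> K) k :
  fXn k * gsum D e w = gsum D (fun i => k + e i)%N w.
Proof.
apply: fpsP => n; rewrite fcoefXnM !gsumE.
case: leqP => kn.
  rewrite (_ : [set i | _ /\ _ = (_ - _)%N] = [set i | D i /\ (k + e i)%N = n]) //.
  by apply/seteqP; split=> i [Di h]; split=> //; lia.
by rewrite fsbig1 // => i [_ h]; lia.
Qed.

Lemma gsum_dil (I : choiceType) (D : set I) e (w : I -> K) d : (0 < d)%N ->
  dil d (gsum D e w) = gsum D (fun i => d * e i)%N w.
Proof.
move=> d0; apply: fpsP => n; rewrite dilE !gsumE.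
have [/dvdnP[k ->]|nd] := ifP.
  rewrite mulnK // (_ : [set i | _ /\ (d * _)%N = _] = [set i | D i /\ e i = k]) //.
  apply/seteqP; split=> i [Di h]; split=> //; last by rewrite h mulnC.
  by move: h; rewrite mulnC => /eqP; rewrite eqn_pmul2r // => /eqP.
by rewrite fsbig1 // => i [_ h]; rewrite -h dvdn_mulr in nd.
Qed.

Lemma gsumU (I : choiceType) (D D' : set I) e (w : I -> K) :
  locfin D e -> locfin D' e -> (forall i, D i -> D' i -> False) ->
  gsum (D `|` D') e w = gsum D e w + gsum D' e w.
Proof.
move=> De De' DD; apply: fpsP => n; rewrite fcoefD !gsumE -fsbigU0.
- congr (\sum_(i \in _) _); apply/seteqP; split=> i /=; tauto.
- exact: locfin_eq.
- exact: locfin_eq.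
- by move=> i [[Di _] [Di' _]]; apply: (DD i).
Qed.

Lemma gsum_scale (I : choiceType) (D : set I) e (w : I -> K) c : locfin D e ->
  fconst c * gsum D e w = gsum D e (fun i => c * w i).
Proof.
move=> De; apply: fpsP => n; rewrite fcoefM big_ord_recl /= subn0 [X in _ + X]big1 ?addr0; last first.
  by move=> i _; rewrite /= mul0r.
by rewrite fsbig_distrr //; exact: locfin_eq.
Qed.

End Gsum.

Lemma gsum_fmap (K K' : comNzRingType) (h : {additive K -> K'}) (I : choiceType)
    (D : set I) e (w : I -> K) : locfin D e ->
  fmap h (gsum D e w) = gsum D e (h \o w).
Proof.
move=> De; apply: fpsP => n; rewrite fmapE !gsumE.
rewrite !fsbig_finite ?raddf_sum //; exact: locfin_eq.
Qed.

Lemma finite_int_ball (N : nat) : finite_set [set i : int | (`|i| <= N)%N].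
Proof.
apply: (@sub_finite_set _ _ ((fun k : nat => k%:Z - N%:Z) @` `I_(N + N).+1)).
  by move=> i /= iN; exists (absz (i + N%:Z)) => /=; lia.
by apply: finite_image; apply: finite_II.
Qed.

Lemma locfin_int (D : set int) (e : int -> nat) c :
  (forall i, (`|i| <= e i + c)%N) -> locfin D e.
Proof.
move=> he n; apply: sub_finite_set (finite_int_ball (n + c)) => i /= [_ ein].
by have := he i; lia.
Qed.

Lemma locfin_sqr (D : set int) : locfin D (fun i => `|i| ^ 2)%N.
Proof. by apply: (@locfin_int _ _ 0) => i; nia. Qed.

Lemma locfin_sub (I : Type) (D D' : set I) e : D `<=` D' -> locfin D' e -> locfin D e.
Proof. by move=> DD De n; apply: sub_finite_set (De n) => i [/DD]. Qed.

Section GsumMore.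
Variable K : comNzRingType.

Lemma gsum_restrict (I : choiceType) (D P : set I) e (w : I -> K) :
  (forall i, D i -> ~ P i -> w i = 0) -> gsum D e w = gsum (D `&` P) e w.
Proof.
move=> h; apply: fpsP => n; rewrite !gsumE; apply/esym/fsbig_widen.
  by move=> i [[]].
by move=> i [[Di ein] NP]; apply: h => // Pi; apply: NP.
Qed.

Section Prod.
Variable I : choiceType.

Definition ffun_cons n (p : I * {ffun 'I_n -> I}) : {ffun 'I_n.+1 -> I} :=
  [ffun t => if unlift ord0 t is Some s then p.2 s else p.1].

Lemma ffun_cons0 n (p : I * {ffun 'I_n -> I}) : ffun_cons p ord0 = p.1.
Proof. by rewrite ffunE unlift_none. Qed.
Lemma ffun_consS n (p : I * {ffun 'I_n -> I}) i : ffun_cons p (lift ord0 i) = p.2 i.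
Proof. by rewrite ffunE liftK. Qed.

Lemma locfin_prod n (D : 'I_n -> set I) (e : 'I_n -> I -> nat) :
  (forall t, locfin (D t) (e t)) ->
  locfin [set p : {ffun 'I_n -> I} | forall t, D t (p t)] (fun p => \sum_t e t (p t))%N.
Proof.
elim: n D e => [|n IH] D e De.
  move=> N;
    apply: (@sub_finite_set _ _ [set [ffun t : 'I_0 => match t with Ordinal k h =>
    match notF h with end end]]) => //.
  by move=> f _; apply/ffunP => -[].
have h1 := locfin_mul (De ord0) (IH _ _ (fun t => De (lift ord0 t))).
move=> N; apply: sub_finite_set (finite_image (@ffun_cons n) (h1 N)) => f /= [fD fN].
exists (f ord0, [ffun t => f (lift ord0 t)]) => /=.
  split; first by split=> //= t; rewrite ffunE.
  by move: fN; rewrite big_ord_recl; under [in X in (_ + X <= _)%N -> _]eq_bigr do rewrite -[f _]/(f _);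
     under [in X in _ -> (_ + X <= _)%N]eq_bigr do rewrite ffunE.
apply/ffunP => t; rewrite ffunE /=; case: unliftP => [s ->|-> //].
by rewrite ffunE.
Qed.

Lemma gsum_prod n (D : 'I_n -> set I) (e : 'I_n -> I -> nat) (w : 'I_n -> I -> K) :
  (forall t, locfin (D t) (e t)) ->
  \prod_t gsum (D t) (e t) (w t) =
  gsum [set p : {ffun 'I_n -> I} | forall t, D t (p t)] (fun p => \sum_t e t (p t))%N
    (fun p => \prod_t w t (p t)).
Proof.
elim: n D e w => [|n IH] D e w De.
  rewrite big_ord0;
    pose f0 : {ffun 'I_0 -> I} := [ffun t : 'I_0 => match t with Ordinal k h =>
    match notF h with end end].
  rewrite (@gsum1 _ _ _ _ f0); last first.
    apply/seteqP; split=> [f _ /=|f /= -> []//].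
    by apply/ffunP; case.
  by rewrite !big_ord0 fXn0 mulr1.
rewrite big_ord_recl IH // gsum_mul //;
  last exact: (@locfin_prod n (fun t => D (lift ord0 t)) (fun t => e (lift ord0 t))).
symmetry; apply: (@gsum_reindex _ _ _ (@ffun_cons n)).
- split.
  + move=> [i f] [/= Di Df] t.
    by case: (unliftP ord0 t) => [s ->|->]; rewrite ?ffun_consS ?ffun_cons0.
  + move=> [i f] [j g] _ _ E; congr pair.
      by move/ffunP/(_ ord0): E; rewrite !ffun_cons0.
    by apply/ffunP => t; move/ffunP/(_ (lift ord0 t)): E; rewrite !ffun_consS.
  + move=> f Df; exists (f ord0, [ffun t => f (lift ord0 t)]).
      by split=> //= t; rewrite ffunE.
    apply/ffunP => t; rewrite ffunE /=; case: unliftP => [s ->|-> //].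
    by rewrite ffunE.
- move=> p _; rewrite big_ord_recl ffun_cons0; congr addn.
  by apply: eq_bigr => t _; rewrite ffun_consS.
- move=> p _; rewrite big_ord_recl ffun_cons0; congr *%R.
  by apply: eq_bigr => t _; rewrite ffun_consS.
Qed.
End Prod.
End GsumMore.

(** * The lattice of residue systems modulo 7 *)

Definition oddz (i : int) : bool := odd `|i|%N.

Lemma oddzD i j : oddz (i + j) = oddz i (+) oddz j.
Proof. by rewrite /oddz; lia. Qed.

Definition resys (p : {ffun 'I_7 -> int}) : Prop := forall r : 'I_7, (p r)%:~R = r :> 'Z_7.
Definition vsum (p : {ffun 'I_7 -> int}) : int := \sum_r p r.
Definition vsqr (p : {ffun 'I_7 -> int}) : nat := (\sum_r `|p r| ^ 2)%N.
Definition vodd (p : {ffun 'I_7 -> int}) : nat := (\sum_r oddz (p r))%N.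

(** Adding [M] to all entries moves their residues as well, so the entries are permuted to bring
    entry r back into the class of r. *)
Definition vshift (v : {ffun 'I_7 -> int}) (M : int) : {ffun 'I_7 -> int} :=
  [ffun r : 'I_7 => v ((r : 'Z_7) - M%:~R) + M].

Lemma vshift_reindex (T : Type) (idx : T) (op : Monoid.com_law idx) (F : 'I_7 -> T) (M : int) :
  \big[op/idx]_(r < 7) F ((r : 'Z_7) - M%:~R) = \big[op/idx]_(r < 7) F r.
Proof.
symmetry; rewrite (reindex_inj (h := fun r : 'I_7 => (r : 'Z_7) - M%:~R)) //.
by move=> r s /addIr.
Qed.

Lemma vshift_sum v M : vsum (vshift v M) = vsum v + 7 * M.
Proof.
rewrite /vsum; under eq_bigr do rewrite ffunE.
rewrite big_split /= (vshift_reindex _ (fun r => v r)) sumr_const card_ord.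
by rewrite mulr_natl.
Qed.

Lemma vsqrE p : (vsqr p)%:Z = \sum_r p r ^+ 2.
Proof.
rewrite /vsqr (big_morph Posz PoszD (erefl 0%:Z)); apply: eq_bigr => r _.
by rewrite -mulnn PoszM abszE -expr2 real_normK ?num_real.
Qed.

Lemma vshift_sqr v M : vsum v = 0 -> vsqr (vshift v M) = (vsqr v + 7 * `|M| ^ 2)%N.
Proof.
move=> v0; have H : (vsqr (vshift v M))%:Z = (vsqr v)%:Z + 7 * M ^+ 2.
  rewrite !vsqrE; under eq_bigr do rewrite ffunE sqrrD.
  rewrite !big_split /= (vshift_reindex _ (fun r => v r ^+ 2)) sumr_const card_ord.
  rewrite -mulr_suml (vshift_reindex _ (fun r => v r)) -/(vsum v) v0.
  by rewrite mul0r !addr0 mulr_natl.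
by move: H; nia.
Qed.

Lemma vshift_odd v M : vodd (vshift v M) = (if oddz M then 7 - vodd v else vodd v)%N.
Proof.
rewrite /vodd; under eq_bigr do rewrite ffunE oddzD.
rewrite (vshift_reindex _ (fun r => (oddz (v r) (+) oddz M : nat))).
case: (oddz M); last by apply: eq_bigr => r _; rewrite addbF.
rewrite !big_ord_recl !big_ord0.
by do 7!case: (oddz _).
Qed.

Lemma vshift_resys v M : resys v -> resys (vshift v M).
Proof. by move=> hv r; rewrite ffunE intrD hv subrK. Qed.

Lemma vshiftK v M : vshift (vshift v M) (- M) = v.
Proof. by apply/ffunP => r; rewrite !ffunE rmorphN /= opprK addrK addrK. Qed.

Lemma intr7_eq0 (i : int) : (i%:~R = 0 :> 'Z_7) <-> (i %% 7 = 0)%Z.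
Proof.
have key (n : nat) : (n%:R = 0 :> 'Z_7) <-> (n %% 7 = 0)%N.
  split=> [/(congr1 val)|h]; first by rewrite /= Zp_nat /=.
  by apply/val_inj; rewrite /= Zp_nat /=.
case: i => n; first by rewrite -[n%:~R]/(n%:R); rewrite key; lia.
rewrite NegzE rmorphN /=; split=> [/eqP|h].
  by rewrite oppr_eq0 => /eqP /key; lia.
by apply/eqP; rewrite oppr_eq0; apply/eqP/key; lia.
Qed.

Lemma intr7_eq (i j : int) : (i%:~R = j%:~R :> 'Z_7) <-> (i = j %[mod 7])%Z.
Proof.
split=> [h|h].
  by have /intr7_eq0 : (i - j)%:~R = 0 :> 'Z_7 by [rewrite intrB h subrr]; lia.
by apply/eqP; rewrite -subr_eq0 -intrB; apply/eqP/intr7_eq0; lia.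
Qed.

Lemma resys_sum p : resys p -> exists M, vsum p = 7 * M.
Proof.
move=> hp; have /intr7_eq0 h : (vsum p)%:~R = 0 :> 'Z_7.
  rewrite /vsum rmorph_sum /=; under eq_bigr do rewrite hp.
  by rewrite !big_ord_recl big_ord0; apply/val_inj.
by exists (vsum p %/ 7)%Z; lia.
Qed.

Lemma vodd_sum p : odd (vodd p) = oddz (vsum p).
Proof.
rewrite /vodd /vsum; elim/big_rec2: _ => // i y x _ IH.
by rewrite oddzD oddD IH oddb.
Qed.

Definition corevec (k : nat) : set {ffun 'I_7 -> int} :=
  [set v | [/\ resys v, vsum v = 0 & vodd v = k]].

(* [core_series (4 - 2 j)] is [x ^ 28] times the series of the 7-cores of BG-rank
   [j] in the variable [x ^ 14]. *)
Definition core_series (k : nat) : fps int := gsum (corevec k) vsqr (fun _ => 1).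

Lemma locfin_vsqr D : locfin D vsqr.
Proof.
apply: (@locfin_sub _ _ [set p : {ffun 'I_7 -> int} | forall t, setT (p t)]) => //.
by apply: (@locfin_prod _ 7 (fun=> setT) (fun=> fun i => `|i| ^ 2)%N) => t; apply: locfin_sqr.
Qed.

Definition sqr_series (b : bool) (g : int -> int) : fps int :=
  gsum [set M | oddz M = b] (fun M => 7 * `|M| ^ 2)%N g.

Lemma locfin_7sqr D : locfin D (fun M : int => 7 * `|M| ^ 2)%N.
Proof. by apply: (@locfin_int _ _ 0) => i; nia. Qed.

(** A residue system with sum 7 M is [vshift v M] for a unique [v] of sum zero. Its norm is that of
    [v] plus 7 M^2, and an odd [M] exchanges odd and even entries. Since 7 M has the parity of k, so
    has [M]: this gives the complement 7 - k for odd k and a factor in one variable. The weight [g]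
    of the sum is what admits signs. *)
Lemma resys_series (k : nat) (g : int -> int) : (k <= 7)%N ->
  gsum [set p | resys p /\ vodd p = k] vsqr (fun p => g (vsum p)) =
  core_series (if odd k then 7 - k else k)%N * sqr_series (odd k) (fun M => g (7 * M)).
Proof.
move=> k7; rewrite gsum_mul; [|exact: locfin_vsqr|exact: locfin_7sqr].
apply: (@gsum_reindex _ _ _ (fun vM => vshift vM.1 vM.2)) => /=.
- split=> [[v M] /= [[hv v0 vk] Mk]|[v M] [v' M'] /set_mem[[_ /= v0 _] _] /set_mem[[_ /= v0' _] _] E|p /= [hp pk]].
  + split; first exact: vshift_resys.
    rewrite vshift_odd Mk vk; case: (odd k) => //; lia.
  + have MM : M = M'.
      by move/(congr1 vsum): E; rewrite /= !vshift_sum v0 v0'; lia.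
    by move: E; rewrite MM => /(congr1 (vshift^~ (- M'))); rewrite /= !vshiftK => ->.
  + have [M pM] := resys_sum hp.
    have oM : oddz M = odd k by rewrite -pk vodd_sum pM /oddz; lia.
    exists (vshift p (- M), M); last by rewrite /= -{2}[M]opprK vshiftK.
    split=> //=; split; first exact: vshift_resys.
      by rewrite vshift_sum pM mulrN subrr.
    by rewrite vshift_odd pk /oddz abszN -/(oddz M) oM.
- by move=> [v M] /= [[_ v0 _] _]; rewrite vshift_sqr.
- by move=> [v M] /= [[_ v0 _] _]; rewrite vshift_sum v0 add0r mul1r.
Qed.

(** * Residue classes graded by parity *)

Section GradedSeries.
Definition res_series (eps : int -> int) (b : bool) (r : 'Z_7) : fps int :=
  gsum [set i : int | i%:~R = r /\ oddz i = b] (fun i => `|i| ^ 2)%N eps.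

Local Notation lift := (fmap (polyC : int -> {poly int})).
Local Notation w := (fconst 'X : fps {poly int}).

Definition graded_series (eps : int -> int) (r : 'Z_7) : fps {poly int} :=
  gsum [set i : int | i%:~R = r] (fun i => `|i| ^ 2)%N (fun i => (eps i)%:P * 'X^(oddz i)).

Lemma graded_seriesE eps r :
  graded_series eps r = lift (res_series eps false r) + w * lift (res_series eps true r).
Proof.
rewrite !gsum_fmap; try exact: locfin_sqr.
rewrite gsum_scale; last exact: locfin_sqr.
pose W (i : int) : {poly int} := (eps i)%:P * 'X^(oddz i).
transitivity (gsum [set i : int | i%:~R = r /\ oddz i = false] (fun i => `|i| ^ 2)%N W +
   gsum [set i : int | i%:~R = r /\ oddz i = true] (fun i => `|i| ^ 2)%N W); last first.
  congr (_ + _); apply: eq_gsum => // i [_ io]; rewrite /W io ?mulr1 //.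
  by rewrite mulrC.
rewrite -gsumU; [|exact: locfin_sqr|exact: locfin_sqr|by move=> i [_ h] [_]; rewrite h].
apply: eq_gsum => // i; split=> [ir|[[]|[]] //].
by case E : (oddz i); [right|left].
Qed.

(** Picking a term in each of the seven classes is picking a residue system, and each odd pick
    contributes one factor ['X]. *)
Lemma prod_graded_coef eps k :
  fmap (coefp k) (\prod_(r < 7) graded_series eps r) =
  gsum [set p | resys p /\ vodd p = k] vsqr (fun p => \prod_r eps (p r)).
Proof.
rewrite (@gsum_prod _ _ 7 (fun r => [set i : int | i%:~R = (r : 'Z_7)])
  (fun _ i => `|i| ^ 2)%N (fun _ i => (eps i)%:P * 'X^(oddz i))); last first.
  by move=> t; exact: locfin_sqr.
rewrite gsum_fmap; last exact: locfin_vsqr.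
rewrite (@gsum_restrict _ _ _ [set p | vodd p = k]) => [|p _ /= pk].
  apply: eq_gsum => // p /= [_ pk]; rewrite big_split /= -rmorph_prod /=.
  by rewrite -expr_sum coefCM coefXn -/(vodd p) pk eqxx mulr1.
rewrite big_split /= -rmorph_prod /= -expr_sum coefCM coefXn -/(vodd p).
by case: eqP => [E|_]; rewrite ?mulr0 //; case: pk.
Qed.

Lemma graded_extract (c : nat -> fps int) n k : (k < n)%N ->
  fmap (coefp k) (\sum_(j < n) lift (c j) * w ^+ j) = c k.
Proof.
move=> kn; rewrite raddf_sum /=.
have H j : fmap (coefp k) (lift (c j) * w ^+ j) = if j == k then c j else 0.
  have -> : w ^+ j = fconst 'X^j.
    elim: j => [|j IH]; first by rewrite !expr0.
    rewrite exprS IH; apply: fpsP => -[|i] /=; first by rewrite big_ord1 exprS.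
    rewrite big1 // => -[[|l] hl] _ /=; last by rewrite mul0r.
    by rewrite mulr0.
  apply: fpsP => i; rewrite fmapE mulrC fcoefM big_ord_recl big1 ?addr0 /= => [|l _]; last by rewrite mul0r.
  rewrite subn0 mulrC coefCM coefXn eq_sym.
  by case: ifP; rewrite ?mulr1 ?mulr0.
under eq_bigr do rewrite H; rewrite (bigD1 (Ordinal kn)) //= eqxx big1 ?addr0 //.
by move=> i; rewrite -val_eqE /= => /negbTE ->.
Qed.

Lemma res_seriesN eps eps' b r : (forall i, eps (- i) = eps' i) ->
  res_series eps b (- r) = res_series eps' b r.
Proof.
move=> he; apply: (@gsum_reindex _ _ _ (fun i => - i)) => [|i _|i _].
- split=> [i [ir ib]|i j _ _ /oppr_inj //|i [ir ib]].
    by rewrite /= rmorphN /= ir /oddz abszN.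
  exists (- i); last by rewrite opprK.
  by rewrite /= rmorphN /= ir opprK /oddz abszN.
- by rewrite abszN.
- by rewrite he.
Qed.

(** The classes 4, 5, 6 are written as -3, -2, -1 because the series of opposite classes agree up to
    sign. *)
Lemma prod_ord7 (T : comNzRingType) (F : 'Z_7 -> T) :
  \prod_(r < 7) F r = F 0 * F 1 * F 2 * F 3 * F (- 3) * F (- 2) * F (- 1).
Proof.
rewrite !big_ord_recl big_ord0 mulr1 !mulrA.
by do ![congr (_ * _)]; congr F; apply/val_inj.
Qed.

Definition one_wt (_ : int) : int := 1.

Section SevenCoreEquations.
Local Notation A r := (res_series one_wt false r).
Local Notation B r := (res_series one_wt true r).
(* The coefficients of [w ^ k] in [\prod_(r = 1, 2, 3) (A r + w * B r)]. *)
Definition half0 := A 1 * A 2 * A 3.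
Definition half1 := B 1 * A 2 * A 3 + A 1 * B 2 * A 3 + A 1 * A 2 * B 3.
Definition half2 := B 1 * B 2 * A 3 + B 1 * A 2 * B 3 + A 1 * B 2 * B 3.
Definition half3 := B 1 * B 2 * B 3.
Definition even0 := A 0.
Definition odd0 := B 0.

(** These are the coefficients in w of ([even0] + w [odd0]) ([half0] + w [half1] + w^2 [half2] + w^3
    [half3])^2, the square coming from opposite classes. *)
Definition graded_coefs : seq (fps int) :=
 [:: even0 * half0 ^+ 2; odd0 * half0 ^+ 2 + 2 * even0 * half0 * half1;
     even0 * (half1 ^+ 2 + 2 * half0 * half2) + 2 * odd0 * half0 * half1;
     even0 * (2 * half0 * half3 + 2 * half1 * half2) + odd0 * (half1 ^+ 2 + 2 * half0 * half2);
     even0 * (half2 ^+ 2 + 2 * half1 * half3) + odd0 * (2 * half0 * half3 + 2 * half1 * half2);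
     2 * even0 * half2 * half3 + odd0 * (half2 ^+ 2 + 2 * half1 * half3);
     even0 * half3 ^+ 2 + 2 * odd0 * half2 * half3; odd0 * half3 ^+ 2].

Lemma graded_coefsE k : (k < 8)%N ->
  nth 0 graded_coefs k =
  core_series (if odd k then 7 - k else k)%N * sqr_series (odd k) one_wt.
Proof.
move=> k8; rewrite -(@resys_series k one_wt) //.
have -> : gsum [set p | resys p /\ vodd p = k] vsqr (fun p => one_wt (vsum p)) =
    gsum [set p | resys p /\ vodd p = k] vsqr (fun p => \prod_r one_wt (p r)).
  by apply: eq_gsum => // p _; rewrite big1.
rewrite -prod_graded_coef prod_ord7 !graded_seriesE.
rewrite !(res_seriesN _ _ (fun i => erefl : one_wt (- i) = one_wt i)).
rewrite -(graded_extract (nth 0 graded_coefs) k8); congr (fmap _ _).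
rewrite !big_ord_recr big_ord0 /= add0r /half0 /half1 /half2 /half3 /even0 /odd0.
rewrite !(rmorphD, rmorphM, rmorphXn, rmorph_nat) /=.
set x0 := fmap _ (A 0); set x1 := fmap _ (A 1); set x2 := fmap _ (A 2); set x3 := fmap _ (A 3).
set y0 := fmap _ (B 0); set y1 := fmap _ (B 1); set y2 := fmap _ (B 2); set y3 := fmap _ (B 3).
ring.
Qed.
End SevenCoreEquations.

(* [chi i = 'i ^+ (i - oddz i)] *)
Definition sg4 (e : int) : int := if (e %% 4)%Z == 0 then 1 else -1.
Definition chi (i : int) : int := sg4 (i - (oddz i)%:Z).

Lemma sg4D a b : ~~ oddz a -> ~~ oddz b -> sg4 (a + b) = sg4 a * sg4 b.
Proof.
rewrite /sg4 /oddz => ha hb; do ![case: eqP => ?]; rewrite ?mulr1 ?mul1r ?mulrNN //; lia.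
Qed.

(** Each weight is a power of i with even exponent, so the product only sees the sum of the
    exponents. The weight is thus a function of [vsum] once [vodd] is fixed, as [resys_series]
    requires. *)
Lemma chi_prod (p : {ffun 'I_7 -> int}) :
  \prod_r chi (p r) = sg4 (vsum p - (vodd p)%:Z).
Proof.
rewrite /vsum /vodd (big_morph Posz PoszD (erefl 0%:Z)) -sumrB.
suff [] : \prod_r chi (p r) = sg4 (\sum_r (p r - (oddz (p r))%:Z)) /\
  ~~ oddz (\sum_r (p r - (oddz (p r))%:Z)) by [].
elim/big_rec2: _ => // i y x _ [-> ox].
have oi : ~~ oddz (p i - (oddz (p i))%:Z) by rewrite /oddz; lia.
split; first by rewrite sg4D.
by rewrite oddzD (negbTE oi) (negbTE ox).
Qed.

(** * The signed relation for six odd entries *)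

Section Signed.
Local Notation A r := (res_series chi false r).
Local Notation B r := (res_series chi true r).

Lemma chiN_even r : A (- r) = A r.
Proof.
rewrite (res_seriesN (eps' := fun i => chi (- i))) //; apply: eq_gsum => // i [_ h].
by rewrite /chi /sg4; move: h; rewrite /oddz; do ![case: eqP => ?]; lia.
Qed.

Lemma chiN_odd r : B (- r) = - B r.
Proof.
rewrite (res_seriesN (eps' := fun i => chi (- i))) // -[RHS]mul1r.
rewrite mulrN -mulNr.
have -> : - 1 = fconst (-1) :> fps int by apply: fpsP => -[|n] //=; rewrite oppr0.
rewrite gsum_scale; last exact: locfin_sqr.
apply: eq_gsum => // i [_ h]; rewrite mulN1r.
by rewrite /chi /sg4; move: h; rewrite /oddz; do ![case: eqP => ?]; lia.
Qed.

(** With these signs opposite odd classes have opposite series and B 0 vanishes, so the product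
    collapses to A 0 times the product of (A r)^2 - w^2 (B r)^2. Its coefficient of w^6 is one
    monomial, whereas the unsigned coefficient also contains a mixed term with [odd0] and
    [half2]. *)
Lemma signed_eq :
  A 0 * (B 1 * B 2 * B 3) ^+ 2 = core_series 6 * sqr_series false (fun M => sg4 M).
Proof.
have B0 : B 0 = 0.
  have := chiN_odd 0; rewrite oppr0 => h; apply: fpsP => n.
  by move/(congr1 (fun f : fps int => f n)): h; rewrite fcoefN => /esym/eqP; rewrite eqNr => /eqP.
pose d : nat -> fps int := fun j => if j == 6 then - (A 0 * (B 1 * B 2 * B 3) ^+ 2) else
  fmap (coefp j) (\prod_(r < 7) graded_series chi r).
have := @resys_series 6 (fun s => sg4 (s - 6)) isT; rewrite /= => E.
have {E} : fmap (coefp 6) (\prod_(r < 7) graded_series chi r) =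
    core_series 6 * sqr_series false (fun M => - sg4 M).
  rewrite prod_graded_coef (_ : sqr_series false (fun M => - sg4 M) =
     sqr_series false (fun M => sg4 (7 * M - 6))).
    by rewrite -E; apply: eq_gsum => // p [_ pk]; rewrite chi_prod pk.
  (* For even M, 7 M - 6 is congruent to M + 2 modulo 4, hence the change of sign. *)
  apply: eq_gsum => // M /= h; rewrite /sg4; move: h; rewrite /oddz.
  by do ![case: eqP => ?]; lia.
have -> : sqr_series false (fun M => - sg4 M) = - sqr_series false (fun M => sg4 M).
  rewrite -[RHS]mul1r mulrN -mulNr.
  have -> : - 1 = fconst (-1) :> fps int by apply: fpsP => -[|n] //=; rewrite oppr0.
  by rewrite gsum_scale; [apply: eq_gsum => // M _; rewrite mulN1r|exact: locfin_7sqr].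
rewrite mulrN => /(congr1 -%R); rewrite opprK => <-.
rewrite prod_ord7 !graded_seriesE !chiN_even !chiN_odd B0.
pose c : seq (fps int) := [:: A 0 * (A 1 * A 2 * A 3) ^+ 2; 0;
  - (A 0 * ((B 1 * A 2 * A 3) ^+ 2 + (A 1 * B 2 * A 3) ^+ 2 + (A 1 * A 2 * B 3) ^+ 2)); 0;
  A 0 * ((B 1 * B 2 * A 3) ^+ 2 + (A 1 * B 2 * B 3) ^+ 2 + (B 1 * A 2 * B 3) ^+ 2); 0;
  - (A 0 * (B 1 * B 2 * B 3) ^+ 2)].
transitivity (- nth 0 c 6); first by rewrite /= opprK.
rewrite -(@graded_extract (nth 0 c) 7 6) //; congr (- fmap _ _).
rewrite !big_ord_recr big_ord0 /= add0r /c /=.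
rewrite !(rmorphD, rmorphM, rmorphXn, rmorphN, rmorph0) /=.
set x0 := fmap _ (A 0); set x1 := fmap _ (A 1); set x2 := fmap _ (A 2); set x3 := fmap _ (A 3).
set y1 := fmap _ (B 1); set y2 := fmap _ (B 2); set y3 := fmap _ (B 3).
ring.
Qed.
End Signed.
End GradedSeries.

(** * Gaussian binomials and the finite triple product *)

Section GaussBinom.
Variables (R : comNzRingType) (Q : R).

(** Gaussian binomials are generated by a Pascal rule, so that [Q] may be any ring element and
    nothing is divided. *)
Fixpoint gbin (n k : nat) : R :=
  match n, k with
  | _, 0 => 1
  | 0, _.+1 => 0
  | n'.+1, k'.+1 => gbin n' k'.+1 + Q ^+ (n' - k') * gbin n' k'
  end.

Lemma gbin0 n : gbin n 0 = 1. Proof. by case: n. Qed.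
Lemma gbinS n k : gbin n.+1 k.+1 = gbin n k.+1 + Q ^+ (n - k) * gbin n k.
Proof. by []. Qed.
Lemma gbin_small n k : (n < k)%N -> gbin n k = 0.
Proof.
elim: n k => [|n IH] [|k] nk //; rewrite gbinS !IH ?mulr0 ?addr0 //; lia.
Qed.
(** The second Pascal rule. The defining one extends the triple product by a factor in [a], this one
    by a factor in [b]. *)
Lemma gbinS' n k : gbin n.+1 k.+1 = Q ^+ k.+1 * gbin n k.+1 + gbin n k.
Proof.
elim: n k => [|n IH] k.
  by rewrite /= sub0n expr0 mul1r mulr0 !add0r.
rewrite gbinS [X in X + _ = _]IH [in RHS](gbinS n k).
case: k => [|k]; first by rewrite !gbin0 !subn0 [Q ^+ n.+1]exprS expr1; ring.
rewrite [X in _ + _ * X = _]IH [in RHS](gbinS n k) subSS.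
have [kn|nk] := leqP k.+1 n.
  have E : Q ^+ k.+2 * Q ^+ (n - k.+1) = Q ^+ (n - k) * Q ^+ k.+1.
    by rewrite -!exprD; congr (_ ^+ _); lia.
  by rewrite [in RHS]mulrDr [in RHS]mulrA E; ring.
rewrite (@gbin_small n k.+1) // (@gbin_small n k.+2); last by lia.
by rewrite !(mulr0, add0r, addr0).
Qed.

Definition qpoch n : R := \prod_(i < n) (1 - Q ^+ i.+1).

Lemma gbin_qpoch n k : (k <= n)%N -> gbin n k * (qpoch k * qpoch (n - k)) = qpoch n.
Proof.
have qS j : qpoch j.+1 = qpoch j * (1 - Q ^+ j.+1) by rewrite /qpoch big_ord_recr.
elim: n k => [|n IH] [|k] // kn.
- by rewrite gbin0 /qpoch !big_ord0 !mulr1.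
- by rewrite gbin0 subn0 /qpoch big_ord0 !mul1r.
rewrite gbinS subSS mulrDl.
have E1 : gbin n k.+1 * (qpoch k.+1 * qpoch (n - k)) = qpoch n * (1 - Q ^+ (n - k)).
  have [kn'|nk] := leqP k.+1 n; last first.
    by rewrite gbin_small // (_ : n - k = 0)%N ?expr0 ?subrr ?mul0r ?mulr0 //; lia.
  by rewrite -(IH _ kn') (_ : n - k = (n - k.+1).+1)%N ?qS ?mulrA //; lia.
have E2 : Q ^+ (n - k) * gbin n k * (qpoch k.+1 * qpoch (n - k)) =
    qpoch n * (Q ^+ (n - k) * (1 - Q ^+ k.+1)).
  by rewrite -(IH k) // qS; ring.
rewrite E1 E2 qS (_ : Q ^+ n.+1 = Q ^+ (n - k) * Q ^+ k.+1); first by ring.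
by rewrite -exprD; congr (_ ^+ _); lia.
Qed.
End GaussBinom.

(* [tri j = j * (j + 1) / 2] *)
Definition tri (j : int) : nat := absz (j * (j + 1) %/ 2)%Z.

Lemma triE j : (tri j)%:Z * 2 = j * (j + 1).
Proof.
rewrite /tri; have h : (2 %| j * (j + 1))%Z.
  by rewrite dvdzE abszM dvdn2 oddM; lia.
have : 0 <= (j * (j + 1) %/ 2)%Z.
  rewrite divz_ge0 //; nia.
by move=> h2; rewrite gez0_abs // divzK.
Qed.

Section FiniteTriple.
Variables (R : comNzRingType) (a b : R).
Let Q := a * b.
(** The general term of Ramanujan's theta function f(a, b). *)
Definition jterm (j : int) : R := a ^+ tri j * b ^+ tri (- j).

Lemma jtermS (n i : nat) (j : int) : (i%:Z = n%:Z + j) ->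
  Q ^+ i * jterm (j - 1) = b * Q ^+ n * jterm j.
Proof.
move=> ij; rewrite /jterm /Q !exprMn.
have t1 := triE (- (j - 1)); have t2 := triE (- j); have t3 := triE (j - 1); have t4 := triE j.
rewrite [LHS](_ : _ = a ^+ (i + tri (j - 1)) * b ^+ (i + tri (- (j - 1)))); last first.
  by rewrite !exprD; ring.
rewrite [RHS](_ : _ = a ^+ (n + tri j) * b ^+ (1 + n + tri (- j))); last first.
  by rewrite !exprD expr1; ring.
congr (_ ^+ _ * _ ^+ _); nia.
Qed.

Lemma jtermS' (m i : nat) (j : int) : (m%:Z = i%:Z + j) ->
  Q ^+ i * jterm (j + 1) = a * Q ^+ m * jterm j.
Proof.
move=> ij; rewrite /jterm /Q !exprMn.
have t1 := triE (- (j + 1)); have t2 := triE (- j); have t3 := triE (j + 1); have t4 := triE j.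
rewrite [LHS](_ : _ = a ^+ (i + tri (j + 1)) * b ^+ (i + tri (- (j + 1)))); last first.
  by rewrite !exprD; ring.
rewrite [RHS](_ : _ = a ^+ (1 + m + tri j) * b ^+ (m + tri (- j))); last first.
  by rewrite !exprD expr1; ring.
congr (_ ^+ _ * _ ^+ _); nia.
Qed.

Let S m n := \sum_(i < (m + n).+1) gbin Q (m + n) i * jterm (i%:Z - n%:Z).

Lemma finite_tripleSl m n : S m.+1 n = (1 + a * Q ^+ m) * S m n.
Proof.
rewrite /S addSn mulrDl mul1r big_ord_recl gbin0.
under eq_bigr => i _ do rewrite lift0 gbinS mulrDl.
rewrite big_split /= addrA; congr (_ + _).
  rewrite [in RHS]big_ord_recl gbin0 big_ord_recr /= gbin_small // mul0r addr0.
  by congr (_ + _); apply: eq_bigr => i _; rewrite lift0.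
rewrite big_distrr /=; apply: eq_bigr => i _; have := ltn_ord i => iN.
rewrite [RHS]mulrCA -(@jtermS' m (m + n - i)); last by lia.
rewrite [LHS]mulrAC [RHS]mulrA mulrC -mulrA; congr (_ * (_ * jterm _)); lia.
Qed.

Lemma finite_tripleSr m n : S m n.+1 = (1 + b * Q ^+ n) * S m n.
Proof.
rewrite /S addnS mulrDl mul1r big_ord_recl gbin0.
under eq_bigr => i _ do rewrite lift0 gbinS' mulrDl.
rewrite big_split /= addrA addrC; congr (_ + _).
  by apply: eq_bigr => i _; congr (_ * jterm _); lia.
rewrite big_ord_recr /= gbin_small // mulr0 mul0r addr0 big_distrr /=.
rewrite [RHS]big_ord_recl gbin0 [in RHS]mulrCA -(@jtermS n 0); last by rewrite /=; lia.
rewrite expr0 !mul1r; congr (jterm _ + _); first by rewrite /=; lia.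
apply: eq_bigr => i _; rewrite lift0 [RHS]mulrCA -(@jtermS n i.+1); last by lia.
rewrite [RHS]mulrA [X in _ = X * _]mulrC; congr (_ * jterm _); lia.
Qed.

(** Cauchy's finite form of the Jacobi triple product, obtained by adjoining one factor at a time on
    either side. *)
Lemma finite_triple m n :
  (\prod_(j < m) (1 + a * Q ^+ j)) * (\prod_(j < n) (1 + b * Q ^+ j)) = S m n.
Proof.
elim: n => [|n IH]; last first.
  by rewrite finite_tripleSr -IH big_ord_recr /= mulrA mulrC.
rewrite big_ord0 mulr1; elim: m => [|m IH].
  by rewrite /S big_ord0 big_ord1 gbin0 mul1r /jterm /tri /= !mulr1.
by rewrite finite_tripleSl -IH big_ord_recr /= mulrC.
Qed.
End FiniteTriple.

(** * Formal infinite products *)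

Section Congruence.
Implicit Types e f g h : fps int.

(** Congruence modulo x^n: infinite sums and products are compared through finite ones, without any
    limit. *)
Definition feq (n : nat) f g := forall i, (i < n)%N -> f i = g i.

Lemma feq_refl n f : feq n f f. Proof. by []. Qed.
Lemma feq_sym n f g : feq n f g -> feq n g f.
Proof. by move=> h i /h. Qed.
Lemma feq_trans n f g h : feq n f g -> feq n g h -> feq n f h.
Proof. by move=> fg gh i ni; rewrite fg ?gh. Qed.
Lemma feq_mul n f f' g g' : feq n f f' -> feq n g g' -> feq n (f * g) (f' * g').
Proof.
move=> ff gg i ni; rewrite !fcoefM; apply: eq_bigr => j _; rewrite ff ?gg //.
  by have := ltn_ord j; lia.
by have := ltn_ord j; lia.
Qed.
Lemma feq_add n f f' g g' : feq n f f' -> feq n g g' -> feq n (f + g) (f' + g').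
Proof. by move=> ff gg i ni; rewrite !fcoefD ff ?gg. Qed.
Lemma feq_leq m n f g : (m <= n)%N -> feq n f g -> feq m f g.
Proof. by move=> mn fg i im; apply: fg; lia. Qed.
Lemma feq_sum n (I : Type) (r : seq I) (P : pred I) (F G : I -> fps int) :
  (forall i, P i -> feq n (F i) (G i)) ->
  feq n (\sum_(i <- r | P i) F i) (\sum_(i <- r | P i) G i).
Proof.
move=> FG; elim/big_rec2: _ => [|i x y Pi xy]; first exact: feq_refl.
by apply: feq_add => //; apply: FG.
Qed.
Lemma feq_dil n d f g : (0 < d)%N -> feq n f g -> feq n (dil d f) (dil d g).
Proof.
move=> d0 fg i ni; rewrite !dilE; case: ifP => // _; apply: fg.
by rewrite (leq_ltn_trans (leq_div i d)).
Qed.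
Lemma feqP f g : (forall n, exists2 N, (n < N)%N & feq N f g) -> f = g.
Proof. by move=> h; apply: fpsP => n; have [N nN] := h n; apply. Qed.
Lemma feq_Xn n k f : (n <= k)%N -> feq n (fXn k * f) 0.
Proof. by move=> nk i ni; rewrite fcoefXnM leqNgt (leq_trans ni nk). Qed.
Lemma feq_cancel n f g e : e 0%N = 1 -> feq n (e * f) (e * g) -> feq n f g.
Proof.
move=> e0 efg i; elim/ltn_ind: i => i IH ni.
have := efg i ni; rewrite !fcoefM !big_ord_recl /= e0 !mul1r subn0.
rewrite (eq_bigr (fun j : 'I_i => e (lift ord0 j) * g (i - lift ord0 j)%N)); first by move/addIr.
move=> j _; rewrite /bump /= add1n; have := ltn_ord j => ji; rewrite IH //; lia.
Qed.
End Congruence.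

Definition fpp (c : int) (P : pred nat) (N : nat) : fps int :=
  \prod_(1 <= i < N.+1 | P i) (1 + fconst c * fXn i).

(* [fprod c P = \prod_(i >= 1, P i) (1 + c * x ^ i)] *)
Definition fprod (c : int) (P : pred nat) : fps int := Fps (fun n => fpp c P n n).

Section InfiniteProduct.
Implicit Types (c : int) (P : pred nat).

Lemma fppS c P N : fpp c P N.+1 = fpp c P N * (if P N.+1 then 1 + fconst c * fXn N.+1 else 1).
Proof. by rewrite /fpp [LHS]big_mkcond big_nat_recr //= -big_mkcond. Qed.

Lemma fppP c P N : feq N.+1 (fpp c P N) (fprod c P).
Proof.
move=> i; rewrite ltnS => iN; rewrite /fprod /=.
rewrite -(subnKC iN); elim: (N - i)%N => [|k IH]; first by rewrite addn0.
rewrite addnS fppS -IH; case: ifP => _; last by rewrite mulr1.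
rewrite mulrDr mulr1 fcoefD [X in _ + X](_ : _ = 0) ?addr0 //.
rewrite mulrA [_ * fXn _]mulrC.
by rewrite (@feq_Xn i.+1) //; lia.
Qed.

Lemma fprod0 c P : fprod c P 0%N = 1.
Proof. by rewrite /= /fpp big_geq. Qed.

Lemma fprod_mul c P P' : (forall i, (0 < i)%N -> ~~ (P i && P' i)) ->
  fprod c P * fprod c P' = fprod c (predU P P').
Proof.
move=> dis; apply: feqP => n; exists n.+1 => //.
refine (feq_trans _ (@fppP c _ n)).
suff <- : fpp c P n * fpp c P' n = fpp c (predU P P') n.
  by apply: feq_sym; apply: feq_mul; apply: fppP.
rewrite /fpp [RHS]big_mkcond [X in X * _]big_mkcond [X in _ * X]big_mkcond -big_split /=.
apply: eq_big_nat => i /andP[i0 _]; have := dis i i0.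
by case: (P i); case: (P' i); rewrite //= ?mul1r ?mulr1.
Qed.

Lemma eq_fprod c P P' : (forall i, (0 < i)%N -> P i = P' i) -> fprod c P = fprod c P'.
Proof.
move=> PP; apply: fpsP => n; change (fpp c P n n = fpp c P' n n); congr (fcoef _ n).
rewrite /fpp [LHS]big_mkcond [RHS]big_mkcond.
by apply: eq_big_nat => i /andP[i0 _]; rewrite PP.
Qed.

Lemma fprod_sq P : fprod 1 P * fprod (-1) P = dil 2 (fprod (-1) P).
Proof.
apply: feqP => n; exists n.+1 => //.
refine (feq_trans _ (feq_dil _ (@fppP _ _ n))) => //.
suff <- : fpp 1 P n * fpp (-1) P n = dil 2 (fpp (-1) P n).
  by apply: feq_sym; apply: feq_mul; apply: fppP.
have cN : fconst (-1) = -1 :> fps int by apply: fpsP => -[|i] //=; rewrite oppr0.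
have c1 : fconst 1 = 1 :> fps int by [].
rewrite /fpp rmorph_prod -big_split /=; apply: eq_bigr => i _.
rewrite rmorphD rmorphM rmorph1 /= cN c1 rmorphN1 dilXn //.
by rewrite mul2n -addnn -fXnM; ring.
Qed.

Lemma dil_prod (T : comNzRingType) (F : nat -> T) d N : (0 < d)%N ->
  \prod_(1 <= i < (d * N).+1 | (d %| i)%N) F (i %/ d)%N = \prod_(1 <= j < N.+1) F j.
Proof.
move=> d0; elim: N => [|N IH]; first by rewrite muln0 !big_geq.
rewrite (@big_cat_nat _ _ _ (d * N).+1) //=; last by rewrite ltnS leq_mul2l leqnSn orbT.
rewrite IH [in RHS]big_nat_recr //=; congr (_ * _).
rewrite big_mkcond big_nat_recr ?leq_mul2l ?ltn_pmul2l //= dvdn_mulr // mulKn //.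
rewrite big_nat_cond big1 ?mul1r // => i /andP[/andP[i1 i2] _].
case: ifP => // /dvdnP[k E]; move: i1 i2; rewrite E ![(_ * d)%N]mulnC.
by rewrite !ltn_pmul2l // => a b; lia.
Qed.

Lemma dil_const d c : (0 < d)%N -> dil d (fconst c) = fconst c :> fps int.
Proof.
move=> d0; apply: fpsP => n; rewrite dilE; case: ifP => [/dvdnP[k ->]|].
  by rewrite mulnK //; case: k => [|k] //; case: d d0.
by case: n => //; rewrite dvdn0.
Qed.

Lemma fprod_dil c P d : (0 < d)%N ->
  dil d (fprod c P) = fprod c (fun i => (d %| i)%N && P (i %/ d)%N).
Proof.
case: d => // d' _; set d := d'.+1.
apply: feqP => n; exists n.+1 => //.
refine (feq_trans (feq_dil _ (feq_sym (@fppP c P n))) _) => //.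
have -> : dil d (fpp c P n) = fpp c (fun i => (d %| i)%N && P (i %/ d)%N) (d * n).
  rewrite /fpp rmorph_prod /= big_mkcond -(@dil_prod _ _ d) // [RHS]big_mkcondr /=.
  rewrite big_mkcond [RHS]big_mkcond; apply: eq_bigr => i _.
  have [/dvdnP[k ->]|//] := ifP; rewrite mulnK //.
  by rewrite rmorphD rmorphM rmorph1 /= dil_const // dilXn // mulnC.
refine (feq_leq _ (@fppP _ _ _)); by rewrite ltnS leq_pmull.
Qed.

Lemma prog_prod (T : comNzRingType) (F : nat -> T) k d N : (0 < k <= d)%N ->
  \prod_(1 <= i < (d * N).+1 | (i %% d == k %% d)%N) F i = \prod_(j < N) F (k + d * j)%N.
Proof.
move=> kd; elim: N => [|N IH]; first by rewrite muln0 big_ord0 big_geq.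
rewrite (@big_cat_nat _ _ _ (d * N).+1) //=; last by rewrite ltnS leq_mul2l leqnSn orbT.
rewrite IH big_ord_recr /=; congr (_ * _).
rewrite -[(d * N).+1]addn1 addnC mulnS [X in \prod_(_ <= i < X | _) _](_ : _ = (d.+1) + d * N)%N; last by lia.
rewrite big_addn addnK.
rewrite big_mkcond (bigD1_seq k) ?mem_index_iota ?iota_uniq //=.
have mm i : ((i + d * N) %% d = i %% d)%N by rewrite mulnC addnC modnMDl.
rewrite mm eqxx big1_seq ?mulr1 // => i /andP[ik]; rewrite mem_index_iota => ib.
rewrite mm; case: eqP => // h; case/eqP: ik.
have Hm j : (0 < j <= d)%N -> (j %% d = if j == d then 0 else j)%N.
  by move=> hj; case: eqP => [->|ne]; [rewrite modnn | rewrite modn_small //; lia].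
by move: h; rewrite !Hm //; do ![case: eqP => ?]; lia.
Qed.

Lemma fprod_prog c k d N : (0 < k <= d)%N ->
  feq N (\prod_(j < N) (1 + fconst c * fXn (k + d * j)%N))
        (fprod c (fun i => (i %% d == k %% d)%N)).
Proof.
move=> kd; rewrite -(prog_prod (fun i => 1 + fconst c * fXn i)) //.
refine (feq_leq _ (@fppP _ _ _)); rewrite leqW // leq_pmull //; lia.
Qed.

End InfiniteProduct.

Lemma fconstM (K : comNzRingType) (c c' : K) : fconst (c * c') = fconst c * fconst c' :> fps K.
Proof.
apply: fpsP => -[|n]; rewrite fcoefM big_ord_recl /= ?big_ord0 ?addr0 //.
by rewrite mulr0 add0r big1 // => i _; rewrite mul0r.
Qed.

Lemma fconstX (K : comNzRingType) (c : K) n : fconst c ^+ n = fconst (c ^+ n) :> fps K.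
Proof. by elim: n => [//|n IH]; rewrite !exprS IH fconstM. Qed.

(* Ramanujan's [f(c x^k, c x^l)] *)
Definition rtheta (c : int) (k l : nat) : fps int :=
  gsum setT (fun j => k * tri j + l * tri (- j))%N (fun j => c ^+ `|j|%N).

Section TripleProduct.
Variables (c : int) (k l : nat).
Hypotheses (c2 : c * c = 1) (k0 : (0 < k)%N) (l0 : (0 < l)%N).
Let d := (k + l)%N.
Let a : fps int := fconst c * fXn k.
Let b : fps int := fconst c * fXn l.
Let Q : fps int := a * b.
Let e (j : int) : nat := (k * tri j + l * tri (- j))%N.
Let E : fps int := fprod (-1) (fun i => i %% d == 0)%N.

Lemma QE : Q = fXn d.
Proof. by rewrite /Q /a /b mulrACA -fconstM c2 fXnM mul1r. Qed.

Lemma tri_sum j : (tri j + tri (- j) = `|j| * `|j|)%N.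
Proof using. by have := triE j; have := triE (- j); clear; nia. Qed.

Lemma e_ge j : (`|j| <= e j)%N.
Proof using k0 l0. by have := tri_sum j; rewrite /e; clear -k0 l0; nia. Qed.

Lemma jterm_e j : jterm a b j = fconst (c ^+ `|j|%N) * fXn (e j).
Proof.
rewrite /jterm /a /b !exprMn !fXnE !fconstX mulrACA fXnM -fconstM -exprD tri_sum.
congr (fconst _ * _); have [] : c = 1 \/ c = -1 by nia.
  by move=> ->; rewrite !expr1n.
by move=> ->; rewrite -signr_odd oddM andbb signr_odd.
Qed.

Lemma qpoch_feq M : feq M (qpoch Q M) E.
Proof.
have d0 : (0 < d <= d)%N by rewrite leqnn /d; lia.
have := @fprod_prog (-1) d d M d0; rewrite modnn.
rewrite (_ : \prod_(j < M) _ = qpoch Q M) //; apply: eq_bigr => i _.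
rewrite QE fXnE mulnS (_ : fconst (-1) = -1); last by apply: fpsP => -[|n] //=; rewrite oppr0.
by rewrite mulN1r.
Qed.

(** Far from both ends the binomial is a quotient of one [qpoch] by two others, all three congruent
    to the infinite product [E]. Multiplying by a further [E] turns this into the division-free
    identity [gbin_qpoch]; the factor is cancelled because its constant term is 1. *)
Lemma gbin_feq D N i : (D + N <= i)%N -> (D + i <= 2 * N + N)%N ->
  feq D (E * gbin Q (2 * N) (i - N)) 1.
Proof.
move=> h1 h2; set i' := (i - N)%N.
apply: (@feq_cancel _ _ _ E); first by rewrite fprod0.
rewrite mulr1; have -> : E * (E * gbin Q (2 * N) i') = gbin Q (2 * N) i' * (E * E) by ring.
refine (feq_trans (g := gbin Q (2 * N) i' * (qpoch Q i' * qpoch Q (2 * N - i'))) _ _).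
  apply: feq_mul; first exact: feq_refl.
  apply: feq_mul; apply: feq_sym.
    by refine (feq_leq _ (@qpoch_feq _)); rewrite /i'; lia.
  by refine (feq_leq _ (@qpoch_feq _)); rewrite /i'; lia.
rewrite gbin_qpoch; last by rewrite /i'; lia.
by refine (feq_leq _ (@qpoch_feq _)); lia.
Qed.

(** At distance at least D from the centre the theta term itself has order at least D; nearer to the
    centre the binomial times [E] is congruent to 1. *)
Lemma term_feq D N i : (D + D <= N)%N ->
  feq D (E * (gbin Q (N + N) i * jterm a b (i%:Z - N%:Z))) (jterm a b (i%:Z - N%:Z)).
Proof.
move=> DN; rewrite !jterm_e.
have [h|h] := leqP D `|i%:Z - N%:Z|%N.
  rewrite [X in feq _ X _](_ : _ = fXn (e (i%:Z - N%:Z)) *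
     (E * (gbin Q (N + N) i * fconst (c ^+ `|i%:Z - N%:Z|%N)))); last by ring.
  rewrite [X in feq _ _ X]mulrC.
  refine (feq_trans (g := 0) _ (feq_sym _)); apply: feq_Xn; exact: leq_trans h (e_ge _).
rewrite mulrA -[X in feq _ _ X]mul1r; apply: feq_mul; last exact: feq_refl.
have := @gbin_feq D N (i + N); rewrite addnK mul2n -addnn; apply.
  by lia.
by lia.
Qed.

Lemma sum_jterm_feq D N : (D <= N)%N ->
  feq D (\sum_(i < (N + N).+1) jterm a b (i%:Z - N%:Z)) (rtheta c k l).
Proof.
move=> DN n nD; pose r := [seq i%:Z - N%:Z | i <- iota 0 (N + N).+1].
have memr j : (j \in r) = (`|j| <= N)%N.
  apply/mapP/idP => [[i h ->]|jN]; first by move: h; rewrite mem_iota; lia.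
  by exists (absz (j + N%:Z)); rewrite ?mem_iota; lia.
rewrite /rtheta (@gsum_box _ _ _ [set` r]) //; last first.
  by move=> j _ ejn; rewrite /= memr; have := e_ge j; rewrite /e; lia.
rewrite -fsbig_seq; last by rewrite map_inj_uniq ?iota_uniq // => x y; lia.
rewrite big_map fcoef_sum -(big_mkord xpredT (fun i => (jterm a b (i%:Z - N%:Z)) n)).
rewrite /index_iota subn0; apply: eq_bigr => i _; rewrite jterm_e mulrC fcoefXnM.
rewrite -[in RHS]/(e (i%:Z - N%:Z)); case: eqP => [<-|ne]; first by rewrite leqnn subnn.
by case: leqP => // h; case E' : (n - e (i%:Z - N%:Z))%N => //; lia.
Qed.

(** The finite form with equally many factors on both sides is compared modulo x^D. As c is 1 or -1,
    the base [Q] is a pure power of x. *)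
Theorem triple_product : rtheta c k l =
  fprod c (fun i => i %% d == k %% d)%N * fprod c (fun i => i %% d == l %% d)%N * E.
Proof.
apply: feqP => n; exists n.+1 => //; set D := n.+1.
have kd : (0 < k <= d)%N by rewrite k0 leq_addr.
have ld : (0 < l <= d)%N by rewrite l0 leq_addl.
refine (feq_trans (feq_sym (@sum_jterm_feq D (D + D) (leq_addr _ _))) _).
have -> : fprod c (fun i => i %% d == k %% d)%N * fprod c (fun i => i %% d == l %% d)%N * E =
  E * (fprod c (fun i => i %% d == k %% d)%N * fprod c (fun i => i %% d == l %% d)%N) by ring.
refine (feq_trans _ (feq_mul (@feq_refl _ E) (feq_mul (feq_leq (leq_addr D D)
  (@fprod_prog c k d (D + D) kd)) (feq_leq (leq_addr D D) (@fprod_prog c l d (D + D) ld))))).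
have H x : \prod_(j < D + D) (1 + fconst c * fXn (x + d * j)%N) = \prod_(j < D + D) (1 + (fconst c * fXn x) * Q ^+ j).
  by apply: eq_bigr => j _; rewrite QE fXnE -mulrA fXnM.
rewrite !H -/a -/b finite_triple big_distrr /=; apply: feq_sum => i _.
by apply: feq_sym; apply: term_feq.
Qed.

End TripleProduct.

(** * Elimination *)

Section Elimination.
Variable F : fieldType.
Hypothesis two : 2 != 0 :> F.

(** With a = m - 1 and b = m rho - 1, [eqI] and [eqII] are the two constraints that remain after the
    linear eliminations; [eqB] is the modular equation. *)
Definition eqI (s a b : F) : F :=
  b * s ^+ 3 * (s * b + 4 * s - 4) * (a + 1) - a * (b + 1) * (a + 4 - 4 * s).
Definition eqII (s a b : F) : F :=
  (a * (b + 1)) ^+ 2 - s ^+ 4 * (b * (a + 1)) ^+ 2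
  + 2 * s * (a + 1) * (b + 1) * (s ^+ 2 * (a * b + 2 * b + 4) - (a * b + 2 * a + 4)).
Definition eqB (s m : F) : F := m ^+ 2 - 7 - m * (8 * s ^+ 3 - 12 * s ^+ 2 + 16 * s - 6).

(** Here everything is divided by the relation for k = 0: p_i is h_i / h_0, c_j is D_(7-j) / D_0,
    and h_3 / h_0 is s / u. Relations 1 and 6 give p_1 and p_2, relations 2 and 4 then give c_5 and
    c_3, and relations 5 and 3 survive as constraints. They contain u only through rho, and m rho is
    psi(Q^2)^2 / (Q^3 psi(Q^14)^2). *)
Lemma core_eqs (u s m p1 p2 c1 c3 c5 : F) :
  u != 0 -> s != 0 -> m != 0 ->
  c1 = m * s ^+ 2 / u ^+ 2 ->
  (s ^+ 2 / u) * c1 = u + 2 * p1 ->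
  c5 = p1 ^+ 2 + 2 * p2 + 2 * u * p1 ->
  (s ^+ 2 / u) * c3 = 2 * (s / u) + 2 * p1 * p2 + u * (p1 ^+ 2 + 2 * p2) ->
  c3 = p2 ^+ 2 + 2 * p1 * (s / u) + u * (2 * (s / u) + 2 * p1 * p2) ->
  (s ^+ 2 / u) * c5 = 2 * p2 * (s / u) + u * (p2 ^+ 2 + 2 * p1 * (s / u)) ->
  c1 = (s / u) ^+ 2 + 2 * u * p2 * (s / u) ->
  let rho := s ^+ 4 / u ^+ 4 in
  [/\ eqI s (m - 1) (m * rho - 1) = 0, eqII s (m - 1) (m * rho - 1) = 0,
   4 * s * rho * c5 = (s ^+ 2 / u ^+ 2) *
      (m ^+ 2 * s ^+ 3 * rho ^+ 2 + 2 * m * s ^+ 3 * rho - 3 * s ^+ 3 + 4 * (m - 1) * rho) &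
   c3 = (m - 1) ^+ 2 * rho / (4 * s ^+ 2) + (m * rho + 1) * s + s * (m * rho - 1) * (m - 1) / 2].
Proof.
move=> u0 s0 m0 E1 e1 e2 e3 e4 e5 e6 rho.
have p1E : p1 = (m * s ^+ 4 / u ^+ 3 - u) / 2.
  have -> : p1 = ((s ^+ 2 / u) * c1 - u) / 2 by rewrite e1; field.
  by rewrite E1; field; apply/andP.
have p2E : p2 = (m - 1) * s / (2 * u ^+ 2).
  have -> : p2 = (c1 - (s / u) ^+ 2) / (2 * s) by rewrite e6; field; apply/and3P.
  by rewrite E1; field; apply/and3P.
have four : 4 != 0 :> F by rewrite (_ : 4 = 2 * 2) ?mulf_neq0 //; ring.
split.
- have -> : eqI s (m - 1) (m * rho - 1) = 4 * m * s ^+ 2 / u *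
     ((s ^+ 2 / u) * c5 - (2 * p2 * (s / u) + u * (p2 ^+ 2 + 2 * p1 * (s / u)))).
    by rewrite /eqI /rho e2 p1E p2E; field; apply/andP.
  by rewrite e5 subrr mulr0.
- have -> : eqII s (m - 1) (m * rho - 1) = 4 * m ^+ 2 * s ^+ 4 / u ^+ 3 *
     ((s ^+ 2 / u) * c3 - (2 * (s / u) + 2 * p1 * p2 + u * (p1 ^+ 2 + 2 * p2))).
    by rewrite /eqII /rho e4 p1E p2E; field; apply/andP.
  by rewrite e3 subrr mulr0.
- by rewrite e2 p1E p2E /rho; field; apply/andP.
- by rewrite e4 p1E p2E /rho; field; rewrite ?four ?u0 ?s0 ?two.
Qed.

(* Up to nonzero factors, [eqB s m] is the resultant in [b] of [eqI s (m - 1) b] and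
   [eqII s (m - 1) b]. *)
Lemma eqB_of (s m b : F) :
  eqI s (m - 1) b = 0 -> eqII s (m - 1) b = 0 ->
  m != 0 -> s != 0 -> s - 1 != 0 -> s + 1 != 0 ->
  4 * s ^+ 2 * m - (m - 1) * (m + 3) != 0 -> eqB s m = 0.
Proof.
set a := m - 1 => hI hII m0 s0 s1 s1' L0.
have am : a + 1 = m by rewrite /a subrK.
pose A2 := s ^+ 4 * m; pose A1 := s ^+ 3 * (4 * s - 4) * m - a * (a + 4 - 4 * s).
pose A0 := - a * (a + 4 - 4 * s).
pose B2 := a ^+ 2 - s ^+ 4 * m ^+ 2 + 2 * s * m * (s ^+ 2 * (a + 2) - a).
pose B1 := 2 * a ^+ 2 + 2 * s * m * (s ^+ 2 * (a + 6) - (3 * a + 4)).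
pose B0 := a ^+ 2 + 2 * s * m * (4 * s ^+ 2 - (2 * a + 4)).
have hI' : A2 * b ^+ 2 + A1 * b + A0 = 0.
  by rewrite -hI /eqI /A2 /A1 /A0 -am; ring.
have hII' : B2 * b ^+ 2 + B1 * b + B0 = 0.
  by rewrite -hII /eqII /B2 /B1 /B0 -am; ring.
(* These are the minors of the coefficient matrix of the two quadratics. A common root b forces V =
   - U b and W = U b^2, so the resultant V^2 - U W vanishes. *)
pose U := A2 * B1 - A1 * B2; pose V := A2 * B0 - A0 * B2; pose W := A1 * B0 - A0 * B1.
have hV : V = - U * b.
  have : U * b + V = A2 * (B2 * b ^+ 2 + B1 * b + B0) - B2 * (A2 * b ^+ 2 + A1 * b + A0).
    by rewrite /U /V; ring.
  by rewrite hI' hII' !mulr0 subrr => /eqP; rewrite addrC addr_eq0 mulNr => /eqP.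
have hW : W = U * b ^+ 2.
  have : U * b ^+ 2 - W = A2 * b * 0 + (A2 * B1 - A1 * B2) * b ^+ 2 - W by rewrite /U; ring.
  have -> : A2 * b * 0 + (A2 * B1 - A1 * B2) * b ^+ 2 - W =
    B1 * (A2 * b ^+ 2 + A1 * b + A0) - A1 * (B2 * b ^+ 2 + B1 * b + B0).
    by rewrite /W; ring.
  by rewrite hI' hII' !mulr0 subrr => /eqP; rewrite subr_eq0 => /eqP.
have hR : V ^+ 2 - U * W = 0 by rewrite hV hW; ring.
have E : V ^+ 2 - U * W = (s * s * (s - 1) * m) ^+ 2 * (s - 1) * (s + 1) *
   (4 * s ^+ 2 * m - (m - 1) * (m + 3)) ^+ 2 * eqB s m.
  by rewrite /V /U /W /A2 /A1 /A0 /B2 /B1 /B0 /eqB /a; ring.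
move/eqP: hR; rewrite E mulf_eq0 => /orP[|/eqP //]; apply: contraTeq => _.
by rewrite !(mulf_neq0, expf_neq0).
Qed.

Section OnCurve.
Variables s m : F.
Hypothesis hB : eqB s m = 0.
Let z := 7 + m - 14 * s + 14 * s ^+ 2 - 7 * s ^+ 3.
Let y := z - s ^+ 3.
Let X := 1 - m * (1 - 2 * s).
Let w := 1 - s + s ^+ 2.

(* The long cofactors below are quotients of polynomial divisions by [eqB s m] in [m]. *)
Lemma cofactor (f g : F) : f = g * eqB s m -> f = 0.
Proof. by rewrite hB mulr0. Qed.

(** On the curve the quadratic [eqI] in b has the root y / s^3; the nonvanishing hypothesis says
    that b is not the other root. *)
Lemma curve_b (b : F) : eqI s (m - 1) b = 0 ->
  let A1 := s ^+ 3 * (4 * s - 4) * m - (m - 1) * (m + 3 - 4 * s) in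
  s * m * (b * s ^+ 3 + y) + A1 != 0 -> b * s ^+ 3 = y.
Proof.
move=> hI A1 h.
have H : s * m * y ^+ 2 + A1 * y - (m - 1) * (m + 3 - 4 * s) * s ^+ 3 = 0.
  by apply: (@cofactor _ (- 3 + 10 * s - 14 * s ^+ 2 + 11 * s ^+ 3 - 4 * s ^+ 4 - m
    + m * s)); rewrite /A1 /y /z /eqB; ring.
have : (b * s ^+ 3 - y) * (s * m * (b * s ^+ 3 + y) + A1) =
   s ^+ 3 * eqI s (m - 1) b - (s * m * y ^+ 2 + A1 * y - (m - 1) * (m + 3 - 4 * s) * s ^+ 3).
  by rewrite /eqI /A1; ring.
rewrite hI H mulr0 subrr => /eqP; rewrite mulf_eq0 (negbTE h) orbF subr_eq0.
by move/eqP.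
Qed.

Lemma curve_c5 : m * z ^+ 2 + 2 * m * s ^+ 3 * z - 3 * m * s ^+ 6 + 4 * (m - 1) * z
   = 4 * m * z * (2 - s + 2 * s ^+ 2).
Proof.
apply/eqP; rewrite -subr_eq0; apply/eqP; apply: (@cofactor _ (4 - 8 * s + 8 * s ^+ 2 - 4 * s ^+ 3 + m)).
by rewrite /z /eqB; ring.
Qed.

(** For z = m rho s^3 the factors on the left are m (1 - alpha) and z (1 - beta), so this is the
    eighth power of Guetzlaff's equation. *)
Lemma curve_alpha : (m - s * z) * (z - s ^+ 7 * m) = (1 - s) ^+ 8 * (m * z).
Proof.
apply/eqP; rewrite -subr_eq0; apply/eqP; apply: (@cofactor _ (7 * s - 28 * s ^+ 2
  + 56 * s ^+ 3 - 70 * s ^+ 4 + 56 * s ^+ 5 - 28 * s ^+ 6 + 7 * s ^+ 7)).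
by rewrite /z /eqB; ring.
Qed.

(** Since z - s^7 m is z (1 - beta), this expresses X^3 by theta quotients, which links X to the
    product D_0. *)
Lemma curve_X : X ^+ 3 * (1 - s) * z ^+ 2 = 64 * s ^+ 6 * m * (z - s ^+ 7 * m).
Proof.
apply/eqP; rewrite -subr_eq0; apply/eqP; apply: (@cofactor _ (- 7 + 35 * s - 84 * s ^+ 2
  + 126 * s ^+ 3 - 126 * s ^+ 4 + 84 * s ^+ 5 - 35 * s ^+ 6 + 7 * s ^+ 7 + 13 * m - 95 * m * s
  + 290 * m * s ^+ 2 - 508 * m * s ^+ 3 + 552 * m * s ^+ 4 - 336 * m * s ^+ 5 + 91 * m * s ^+ 6
  + 15 * m * s ^+ 7 - 2 * m * s ^+ 8 - 12 * m * s ^+ 9 - 8 * m * s ^+ 10 - 5 * m ^+ 2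
  + 53 * m ^+ 2 * s - 220 * m ^+ 2 * s ^+ 2 + 482 * m ^+ 2 * s ^+ 3 - 634 * m ^+ 2 * s ^+ 4
  + 524 * m ^+ 2 * s ^+ 5 - 248 * m ^+ 2 * s ^+ 6 + 48 * m ^+ 2 * s ^+ 7 - m ^+ 3
  + 7 * m ^+ 3 * s - 18 * m ^+ 3 * s ^+ 2 + 20 * m ^+ 3 * s ^+ 3 - 8 * m ^+ 3 * s ^+ 4)).
by rewrite /X /z /eqB; ring.
Qed.

(** The formula for D_4 with denominators cleared: the left side is D_4, the last summand the term
    with G, and the first summand the remaining four terms of the formula. *)
Lemma curve_c3 :
  ((m - 1) ^+ 2 * z + 4 * m * s ^+ 3 * (z + s ^+ 3) + 2 * m * s ^+ 3 * (z - s ^+ 3) * (m - 1))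
    * X ^+ 2 * w * z =
  16 * m * (m * z * s * (2 - 3 * s + 2 * s ^+ 2) * w + s ^+ 2 * z + m * s ^+ 3 * z + m * s ^+ 7)
    * w * 4 * m * s ^+ 5
  + 2 * m * s ^+ 3 * (z + m * s ^+ 3) * X ^+ 2 * z.
Proof.
apply/eqP; rewrite -subr_eq0; apply/eqP; apply: (@cofactor _ (- 7 + 35 * s - 91 * s ^+ 2
  + 154 * s ^+ 3 - 182 * s ^+ 4 + 154 * s ^+ 5 - 91 * s ^+ 6 + 35 * s ^+ 7 - 7 * s ^+ 8
  + 20 * m - 116 * m * s + 324 * m * s ^+ 2 - 562 * m * s ^+ 3
  + 648 * m * s ^+ 4 - 496 * m * s ^+ 5 + 224 * m * s ^+ 6 - 28 * m * s ^+ 7 - 28 * m * s ^+ 8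
  + 14 * m * s ^+ 9 - 18 * m ^+ 2 + 122 * m ^+ 2 * s - 366 * m ^+ 2 * s ^+ 2
  + 640 * m ^+ 2 * s ^+ 3 - 692 * m ^+ 2 * s ^+ 4
  + 476 * m ^+ 2 * s ^+ 5 - 325 * m ^+ 2 * s ^+ 6
  + 591 * m ^+ 2 * s ^+ 7 - 1083 * m ^+ 2 * s ^+ 8
  + 1286 * m ^+ 2 * s ^+ 9 - 976 * m ^+ 2 * s ^+ 10
  + 456 * m ^+ 2 * s ^+ 11 - 112 * m ^+ 2 * s ^+ 12 + 4 * m ^+ 3 - 36 * m ^+ 3 * s
  + 124 * m ^+ 3 * s ^+ 2 - 226 * m ^+ 3 * s ^+ 3 + 200 * m ^+ 3 * s ^+ 4
  + 64 * m ^+ 3 * s ^+ 5 - 416 * m ^+ 3 * s ^+ 6 + 606 * m ^+ 3 * s ^+ 7 - 486 * m ^+ 3 * s ^+ 8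
  + 240 * m ^+ 3 * s ^+ 9 - 56 * m ^+ 3 * s ^+ 10 + m ^+ 4 - 5 * m ^+ 4 * s
  + 9 * m ^+ 4 * s ^+ 2 - 6 * m ^+ 4 * s ^+ 3 - 6 * m ^+ 4 * s ^+ 4
  + 18 * m ^+ 4 * s ^+ 5 - 16 * m ^+ 4 * s ^+ 6 + 8 * m ^+ 4 * s ^+ 7)).
by rewrite /X /w /z /eqB; ring.
Qed.
End OnCurve.
End Elimination.

(** * The two formulas in a field, with the branches as hypotheses *)

Section DegreeSeven.
Variable F : fieldType.
Hypothesis two : 2 != 0 :> F.
Variables x e1 e2 e4 e7 e14 e28 : F.
Hypotheses (x_neq0 : x != 0) (e1_neq0 : e1 != 0) (e2_neq0 : e2 != 0) (e4_neq0 : e4 != 0)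
  (e7_neq0 : e7 != 0) (e14_neq0 : e14 != 0) (e28_neq0 : e28 != 0).
(* For a nome [Q = x ^ 4], [e_d], [f_d], [p_d] and [n_d] stand for E(Q^d), phi(Q^d),
   psi(Q^d) and phi(-Q^d). *)
Let Q := x ^+ 4.
Let f1 := e2 ^+ 5 / (e1 * e4) ^+ 2.
Let f7 := e14 ^+ 5 / (e7 * e28) ^+ 2.
Let p1 := e2 ^+ 2 / e1.
Let p2 := e4 ^+ 2 / e2.
Let p7 := e14 ^+ 2 / e7.
Let p14 := e28 ^+ 2 / e14.
Let n1 := e1 ^+ 2 / e2.
Let n2 := e2 ^+ 2 / e4.
Let n7 := e7 ^+ 2 / e14.
Let n14 := e14 ^+ 2 / e28.
Let tau := 2 * x * p2.
Let b0 := 2 * x ^+ 7 * p14.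
Let S := 2 * Q * p1 * p7.
Let Phi := f1 * f7.
Let G := e14 * e7 ^+ 3 * e2 / e1.

Variables h0 h1 h2 h3 D0 D2 D4 D6 : F.
Hypothesis h0_neq0 : h0 != 0.
Hypotheses
  (E0 : f7 * h0 ^+ 2 = f1 * D0)
  (E1 : b0 * h0 ^+ 2 + 2 * f7 * h0 * h1 = tau * D6)
  (E2 : f7 * (h1 ^+ 2 + 2 * h0 * h2) + 2 * b0 * h0 * h1 = f1 * D2)
  (E3 : f7 * (2 * h0 * h3 + 2 * h1 * h2) + b0 * (h1 ^+ 2 + 2 * h0 * h2) = tau * D4)
  (E4 : f7 * (h2 ^+ 2 + 2 * h1 * h3) + b0 * (2 * h0 * h3 + 2 * h1 * h2) = f1 * D4)
  (E5 : 2 * f7 * h2 * h3 + b0 * (h2 ^+ 2 + 2 * h1 * h3) = tau * D2)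
  (E6 : f7 * h3 ^+ 2 + 2 * b0 * h2 * h3 = f1 * D6)
  (E7 : h3 * b0 * f1 = S * h0)
  (ED6 : D6 = x ^+ 10 * (e7 ^+ 2 * e2 ^+ 3 * e14 ^+ 3 / e1 ^+ 2))
  (ED0 : D0 = x ^+ 16 * (e14 ^+ 7 / e2)).
(** The factors to be excluded, cleared of denominators: [N1], [N2] and [N3] come from the resultant
    (s = 1, s = -1 and its squared factor), [N4] from the second root of [eqI]. *)
Hypotheses
  (N1 : S - Phi != 0) (N2 : S + Phi != 0)
  (N3 : 4 * S ^+ 2 - (f1 ^+ 2 - f7 ^+ 2) * (f1 ^+ 2 + 3 * f7 ^+ 2) != 0)
  (N4 : 8 * S * f1 ^+ 2 * f7 ^+ 2 * p2 ^+ 2 * p1 ^+ 3 * p7 ^+ 3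
    + p14 ^+ 2 * (S * f1 ^+ 2 * f7 ^+ 2 * (7 * Phi ^+ 3 - 14 * S * Phi ^+ 2 + 14 * S ^+ 2 * Phi - 9 * S ^+ 3)
      + S * f1 ^+ 4 * Phi ^+ 3
      + S ^+ 3 * (4 * S - 4 * Phi) * f1 ^+ 2 * f7 ^+ 2
      - (f1 ^+ 2 - f7 ^+ 2) * (f1 ^+ 2 * Phi + 3 * f7 ^+ 2 * Phi - 4 * S * f7 ^+ 2) * Phi ^+ 3) != 0).

Let s := S / Phi.
Let m := f1 ^+ 2 / f7 ^+ 2.
Let u := b0 / f7.
Let rho := s ^+ 4 / u ^+ 4.
Let z := 7 + m - 14 * s + 14 * s ^+ 2 - 7 * s ^+ 3.
Let X := 1 - m * (1 - 2 * s).
Let w := 1 - s + s ^+ 2.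

Let nz := (x_neq0, e1_neq0, e2_neq0, e4_neq0, e7_neq0, e14_neq0, e28_neq0, two).
Ltac nzs := rewrite ?nz //.

Lemma f1_neq0 : f1 != 0. Proof. by rewrite !(mulf_neq0, expf_neq0, invr_neq0). Qed.
Lemma f7_neq0 : f7 != 0. Proof. by rewrite !(mulf_neq0, expf_neq0, invr_neq0). Qed.
Lemma Phi_neq0 : Phi != 0. Proof. by rewrite mulf_neq0 ?f1_neq0 ?f7_neq0. Qed.
Lemma s_neq0 : s != 0.
Proof. by rewrite !(mulf_neq0, expf_neq0, invr_neq0). Qed.
Lemma m_neq0 : m != 0. Proof. by rewrite !(mulf_neq0, expf_neq0, invr_neq0). Qed.
Lemma u_neq0 : u != 0. Proof. by rewrite !(mulf_neq0, expf_neq0, invr_neq0). Qed.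
Lemma D0_neq0 : D0 != 0. Proof. by rewrite ED0 !(mulf_neq0, expf_neq0, invr_neq0). Qed.

Lemma tE : s ^+ 2 / u = tau / f1.
Proof. by rewrite /s /u /S /Phi /tau /b0 /Q /f1 /f7 /p1 /p2 /p7 /p14; field; nzs. Qed.

(** Dividing [E1] to [E6] by [E0] brings them to the form of [core_eqs]. The resultant puts (s, m)
    on the curve, [N4] then selects the value z of m rho s^3, and D_2 and D_4 become functions on
    the curve. *)
Lemma curve :
  [/\ eqB s m = 0, m * rho * s ^+ 3 = z,
      D2 = D0 * (s * m / u ^+ 2) * (2 - s + 2 * s ^+ 2) &
      4 * m * s ^+ 5 * D4 = D0 * ((m - 1) ^+ 2 * z + 4 * m * s ^+ 3 * (z + s ^+ 3)
         + 2 * m * s ^+ 3 * (z - s ^+ 3) * (m - 1))].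
Proof.
have f1n := f1_neq0; have f7n := f7_neq0; have Pn := Phi_neq0; have sn := s_neq0.
have mn := m_neq0; have un := u_neq0; have Dn := D0_neq0.
have four : 4 != 0 :> F by rewrite (_ : 4 = 2 * 2) ?mulf_neq0 //; ring.
have [D0E SE] : D0 = f7 * h0 ^+ 2 / f1 /\ S = s * Phi.
  by split; [rewrite E0; field | rewrite /s; field].
have tauE : tau = s ^+ 2 / u * f1 by rewrite tE; field.
have b0E : b0 = u * f7 by rewrite /u; field.
have h3E : h3 = s / u * h0.
  have -> : h3 = S * h0 / (b0 * f1) by rewrite -E7; field; rewrite f1n b0E mulf_neq0.
  by rewrite SE b0E /Phi; field; rewrite un f1n f7n.
have c1E : D6 / D0 = m * s ^+ 2 / u ^+ 2.
  rewrite ED6 ED0 /m /s /u /S /Phi /b0 /Q /f1 /f7 /p1 /p7 /p14; field; nzs.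
have D6E : D6 = D6 / D0 * D0 by rewrite divfK.
have D2E : D2 = D2 / D0 * D0 by rewrite divfK.
have D4E : D4 = D4 / D0 * D0 by rewrite divfK.
have [] := @core_eqs F two u s m (h1 / h0) (h2 / h0) (D6 / D0) (D4 / D0) (D2 / D0) un sn mn c1E.
- have -> : s ^+ 2 / u * (D6 / D0) = tau * D6 / (f1 * D0) by rewrite tauE; field; rewrite Dn f1n un.
  by rewrite -E1 -E0 b0E; field; rewrite h0_neq0 f7n.
- have -> : D2 / D0 = f1 * D2 / (f1 * D0) by field; rewrite f1n Dn.
  by rewrite -E2 -E0 b0E; field; rewrite h0_neq0 f7n.
- have -> : s ^+ 2 / u * (D4 / D0) = tau * D4 / (f1 * D0) by rewrite tauE; field; rewrite Dn f1n un.
  by rewrite -E3 -E0 b0E h3E; field; rewrite h0_neq0 f7n un.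
- have -> : D4 / D0 = f1 * D4 / (f1 * D0) by field; rewrite f1n Dn.
  by rewrite -E4 -E0 b0E h3E; field; rewrite h0_neq0 f7n un.
- have -> : s ^+ 2 / u * (D2 / D0) = tau * D2 / (f1 * D0) by rewrite tauE; field; rewrite Dn f1n un.
  by rewrite -E5 -E0 b0E h3E; field; rewrite h0_neq0 f7n un.
- have -> : D6 / D0 = f1 * D6 / (f1 * D0) by field; rewrite f1n Dn.
  by rewrite -E6 -E0 b0E h3E; field; rewrite h0_neq0 f7n un.
rewrite -/rho => hI hII hc5 hc3.
have hB : eqB s m = 0.
  apply: (eqB_of hI hII) => //.
  - by rewrite (_ : s - 1 = (S - Phi) / Phi) ?mulf_neq0 ?invr_neq0 // /s; field.
  - by rewrite (_ : s + 1 = (S + Phi) / Phi) ?mulf_neq0 ?invr_neq0 // /s; field.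
  - rewrite (_ : _ - _ = (4 * S ^+ 2 - (f1 ^+ 2 - f7 ^+ 2) * (f1 ^+ 2 + 3 * f7 ^+ 2)) / f7 ^+ 4).
      by rewrite mulf_neq0 // invr_neq0 // expf_neq0.
    by rewrite SE /m /Phi; field.
have hz : m * rho * s ^+ 3 = z.
  suff h : (m * rho - 1) * s ^+ 3 = z - s ^+ 3.
    by move: h; rewrite mulrBl mul1r => /addIr.
  apply: (curve_b hB hI); rewrite (_ : _ + _ = (8 * S * f1 ^+ 2 * f7 ^+ 2 * p2 ^+ 2 * p1 ^+ 3 * p7 ^+ 3
    + p14 ^+ 2 * (S * f1 ^+ 2 * f7 ^+ 2 * (7 * Phi ^+ 3 - 14 * S * Phi ^+ 2 + 14 * S ^+ 2 * Phi - 9 * S ^+ 3)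
      + S * f1 ^+ 4 * Phi ^+ 3
      + S ^+ 3 * (4 * S - 4 * Phi) * f1 ^+ 2 * f7 ^+ 2
      - (f1 ^+ 2 - f7 ^+ 2) * (f1 ^+ 2 * Phi + 3 * f7 ^+ 2 * Phi - 4 * S * f7 ^+ 2) * Phi ^+ 3))
     / (p14 ^+ 2 * Phi ^+ 4 * f7 ^+ 4)).
    by rewrite mulf_neq0 // invr_neq0 // !(mulf_neq0, expf_neq0, invr_neq0).
  have -> : (m * rho - 1) * s ^+ 3 = 8 * p2 ^+ 2 * p1 ^+ 3 * p7 ^+ 3 / (p14 ^+ 2 * Phi ^+ 3) - s ^+ 3.
    rewrite mulrBl mul1r; congr (_ - _).
    rewrite /rho /m /s /u /S /Phi /b0 /Q /f1 /f7 /p1 /p2 /p7 /p14; field; nzs.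
  have p14n : p14 != 0 by rewrite !(mulf_neq0, expf_neq0, invr_neq0).
  by rewrite /s /m; field; rewrite ?f7n ?Pn ?p14n.
have rhoE : rho = z / (m * s ^+ 3) by rewrite -hz; field; rewrite mn sn.
split=> //.
- have zn : z != 0 by rewrite -hz !(mulf_neq0, expf_neq0, invr_neq0).
  have hc := curve_c5 hB; rewrite -/z in hc.
  have : 4 * s * rho * (D2 / D0) = 4 * s * rho * ((s * m / u ^+ 2) * (2 - s + 2 * s ^+ 2)).
    rewrite hc5 rhoE.
    have -> : m ^+ 2 * s ^+ 3 * (z / (m * s ^+ 3)) ^+ 2 + 2 * m * s ^+ 3 * (z / (m * s ^+ 3)) -
       3 * s ^+ 3 + 4 * (m - 1) * (z / (m * s ^+ 3)) =
       (m * z ^+ 2 + 2 * m * s ^+ 3 * z - 3 * m * s ^+ 6 + 4 * (m - 1) * z) / (m * s ^+ 3).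
      by field; rewrite mn sn.
    by rewrite hc; field; rewrite mn sn un.
  have k0 : 4 * s * rho != 0 by rewrite !(mulf_neq0, expf_neq0, invr_neq0).
  by move/(mulfI k0) => h; rewrite [LHS]D2E h; ring.
- by rewrite D4E hc3 rhoE; field; rewrite mn sn two four.
Qed.

(* [A, B] stand for phi(Q^2), psi(Q^4), and [A', B'] for phi(Q^14), psi(Q^28). *)
Variables A B A' B' : F.
Hypotheses (HA : A ^+ 2 + 4 * Q * B ^+ 2 = f1 ^+ 2) (HN : A ^+ 2 - 4 * Q * B ^+ 2 = n1 ^+ 2)
  (HA' : A' ^+ 2 + 4 * Q ^+ 7 * B' ^+ 2 = f7 ^+ 2)
  (HN' : A' ^+ 2 - 4 * Q ^+ 7 * B' ^+ 2 = n7 ^+ 2)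
  (AB : A * B = p2 ^+ 2) (AB' : A' * B' = p14 ^+ 2).
Let sigma := A * A' + 4 * Q ^+ 4 * B * B'.
Let omega := B * A' + Q ^+ 3 * B' * A.
(** [K1], [K2] and [K3] permit extracting an eighth, a square and a cube root; in an arbitrary field
    the roots would be ambiguous. *)
Hypotheses
  (K1 : (Phi - S) ^+ 8 = (n2 * n14) ^+ 8 -> Phi - S = n2 * n14)
  (K2 : (sigma * Phi) ^+ 2 = (Phi ^+ 2 - Phi * S + S ^+ 2) ^+ 2 ->
        sigma * Phi = Phi ^+ 2 - Phi * S + S ^+ 2)
  (K3 : (64 * D0 * f1 ^+ 4) ^+ 3 = ((f7 ^+ 2 * Phi - f1 ^+ 2 * (Phi - 2 * S)) ^+ 2 * Phi) ^+ 3 ->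
        64 * D0 * f1 ^+ 4 = (f7 ^+ 2 * Phi - f1 ^+ 2 * (Phi - 2 * S)) ^+ 2 * Phi)
  (sigma_neq0 : sigma != 0).

(** From phi(-Q)^4 = phi(Q)^4 (1 - alpha), its analogue at Q^7 and [curve_alpha] the eighth powers
    agree, because phi(-Q^2)^2 = phi(Q) phi(-Q). *)
Lemma complementary : 1 - s = n2 * n14 / Phi.
Proof.
have [hB hz _ _] := curve; have Pn := Phi_neq0.
have zn : z != 0 by rewrite -hz !(mulf_neq0, expf_neq0, invr_neq0, s_neq0, m_neq0, u_neq0).
have mn := m_neq0; have un := u_neq0; have sn := s_neq0.
have := curve_alpha hB; rewrite -/z -hz => ha.
have {}ha : (1 - s ^+ 8 / u ^+ 4) * (1 - u ^+ 4) = (1 - s) ^+ 8.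
  apply: (mulIf (mulf_neq0 mn zn)); rewrite -hz -ha /rho; field; rewrite ?un ?sn //.
have hn1 : n1 ^+ 4 = f1 ^+ 4 * (1 - s ^+ 8 / u ^+ 4).
  have -> : n1 ^+ 4 = (A ^+ 2 + 4 * Q * B ^+ 2) ^+ 2 - 16 * Q * (A * B) ^+ 2.
    by rewrite (exprM n1 2 2) -HN; ring.
  by rewrite HA AB /s /u /S /Phi /b0 /Q /f1 /f7 /p1 /p2 /p7 /p14; field; nzs.
have hn7 : n7 ^+ 4 = f7 ^+ 4 * (1 - u ^+ 4).
  have -> : n7 ^+ 4 = (A' ^+ 2 + 4 * Q ^+ 7 * B' ^+ 2) ^+ 2 - 16 * Q ^+ 7 * (A' * B') ^+ 2.
    by rewrite (exprM n7 2 2) -HN'; ring.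
  by rewrite HA' AB' /u /b0 /Q /f7 /p14; field; nzs.
have : Phi - S = n2 * n14.
  apply: K1.
  have -> : (n2 * n14) ^+ 8 = Phi ^+ 4 * (n1 ^+ 4 * n7 ^+ 4).
    by rewrite /n2 /n14 /n1 /n7 /Phi /f1 /f7; field; nzs.
  rewrite hn1 hn7 (_ : Phi ^+ 4 * _ = Phi ^+ 8 * ((1 - s ^+ 8 / u ^+ 4) * (1 - u ^+ 4))); last by rewrite /Phi; ring.
  by rewrite ha /s; field.
by move=> <-; rewrite /s; field.
Qed.

(** The square of [sigma] contains A and B only through A^2, B^2 and A B, and likewise for the
    primed pair; these are theta functions of Q and Q^7. So the square is computed and the root is
    taken by [K2]. *)
Lemma sigmaE : sigma = Phi * w.
Proof.
have Pn := Phi_neq0.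
suff h : sigma * Phi = Phi ^+ 2 - Phi * S + S ^+ 2.
  by apply: (mulIf Pn); rewrite h /w /s; field.
apply: K2; apply: (mulfI (mulf_neq0 two two)).
have -> : 2 * 2 * (sigma * Phi) ^+ 2 = Phi ^+ 2 * (((A ^+ 2 + 4 * Q * B ^+ 2) + (A ^+ 2 - 4 * Q * B ^+ 2)) *
    ((A' ^+ 2 + 4 * Q ^+ 7 * B' ^+ 2) + (A' ^+ 2 - 4 * Q ^+ 7 * B' ^+ 2)) +
    ((A ^+ 2 + 4 * Q * B ^+ 2) - (A ^+ 2 - 4 * Q * B ^+ 2)) *
    ((A' ^+ 2 + 4 * Q ^+ 7 * B' ^+ 2) - (A' ^+ 2 - 4 * Q ^+ 7 * B' ^+ 2)) + 32 * Q ^+ 4 * (A * B) * (A' * B')).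
  by rewrite /sigma; ring.
rewrite HA HA' HN HN' AB AB'.
have g1 : n1 ^+ 2 * n7 ^+ 2 = Phi ^+ 2 * (1 - s) ^+ 4.
  by rewrite complementary /n2 /n14 /n1 /n7 /Phi /f1 /f7; field; nzs.
have g2 : 16 * Q ^+ 4 * p2 ^+ 2 * p14 ^+ 2 = Phi ^+ 2 * s ^+ 4.
  by rewrite /s /S /Phi /Q /f1 /f7 /p1 /p2 /p7 /p14; field; nzs.
have -> : (f1 ^+ 2 + n1 ^+ 2) * (f7 ^+ 2 + n7 ^+ 2) + (f1 ^+ 2 - n1 ^+ 2) * (f7 ^+ 2 - n7 ^+ 2) +
    32 * Q ^+ 4 * p2 ^+ 2 * p14 ^+ 2 = 2 * Phi ^+ 2 + 2 * (n1 ^+ 2 * n7 ^+ 2) + 2 * (16 * Q ^+ 4 * p2 ^+ 2 * p14 ^+ 2).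
  by rewrite /Phi; ring.
by rewrite g1 g2 /s; field.
Qed.

Lemma w_neq0 : w != 0.
Proof. by apply: contraNneq sigma_neq0 => w0; rewrite sigmaE w0 mulr0. Qed.

(** [curve_X] and [complementary] give X^3 as a quotient of Euler products. Hence the cubes of both
    sides agree, and [K3] takes the root. *)
Lemma D0E : 64 * D0 * m ^+ 2 = X ^+ 2 * Phi ^+ 3.
Proof.
have [hB hz _ _] := curve; have Pn := Phi_neq0; have fn := f7_neq0.
have zn : z != 0 by rewrite -hz !(mulf_neq0, expf_neq0, invr_neq0, s_neq0, m_neq0, u_neq0).
have mn := m_neq0; have un := u_neq0; have sn := s_neq0.
suff h : 64 * D0 * f1 ^+ 4 = (f7 ^+ 2 * Phi - f1 ^+ 2 * (Phi - 2 * S)) ^+ 2 * Phi.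
  have -> : 64 * D0 * m ^+ 2 = 64 * D0 * f1 ^+ 4 / f7 ^+ 4 by rewrite /m; field.
  by rewrite h /X /m /s; field; rewrite fn Pn.
have s1n : 1 - s != 0 by rewrite complementary !(mulf_neq0, expf_neq0, invr_neq0).
apply: K3; apply: (mulIf (mulf_neq0 (expf_neq0 2 s1n) (expf_neq0 2 zn))).
have hX : X ^+ 3 * (1 - s) * z = 64 * s ^+ 6 * m * (1 - u ^+ 4).
  apply: (mulIf zn); rewrite (_ : X ^+ 3 * (1 - s) * z * z = X ^+ 3 * (1 - s) * z ^+ 2); last by ring.
  rewrite (curve_X hB) -/z -hz /rho; field; rewrite ?un //.
have hn7 : f7 ^+ 4 * (1 - u ^+ 4) = n7 ^+ 4.
  have -> : n7 ^+ 4 = (A' ^+ 2 + 4 * Q ^+ 7 * B' ^+ 2) ^+ 2 - 16 * Q ^+ 7 * (A' * B') ^+ 2.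
    by rewrite (exprM n7 2 2) -HN'; ring.
  by rewrite HA' AB' /u /b0 /Q /f7 /p14; field; nzs.
have -> : ((f7 ^+ 2 * Phi - f1 ^+ 2 * (Phi - 2 * S)) ^+ 2 * Phi) ^+ 3 * ((1 - s) ^+ 2 * z ^+ 2) =
    (X ^+ 3 * (1 - s) * z) ^+ 2 * f7 ^+ 12 * Phi ^+ 9.
  by rewrite /X /m {2}/s; field; rewrite fn Pn.
rewrite hX (_ : (64 * s ^+ 6 * m * (1 - u ^+ 4)) ^+ 2 * f7 ^+ 12 * Phi ^+ 9 =
  4096 * s ^+ 12 * m ^+ 2 * (f7 ^+ 4 * (1 - u ^+ 4)) ^+ 2 * f7 ^+ 4 * Phi ^+ 9); last by ring.
rewrite hn7 complementary -hz ED0 /rho /m /n7 /n2 /n14 /s /u /S /Phi /b0 /Q /f1 /f7 /p1 /p7 /p14.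
field; nzs.
Qed.

Lemma D2_formula : D2 = x ^+ 6 * (G * (sigma + Q * p1 * p7)).
Proof.
have [_ _ -> _] := curve; have Pn := Phi_neq0.
have -> : sigma + Q * p1 * p7 = Phi * (2 - s + 2 * s ^+ 2) / 2.
  have -> : Q * p1 * p7 = Phi * s / 2 by rewrite /s /S; field; rewrite two Pn.
  by rewrite sigmaE /w; field.
have -> : D0 * (s * m / u ^+ 2) = x ^+ 6 * G * Phi / 2.
  rewrite ED0 /G /m /s /u /S /Phi /b0 /Q /f1 /f7 /p1 /p7 /p14; field; nzs.
by field.
Qed.

(** The duplication formulas only give the square of [omega]; this relation handles a single factor,
    as [sigma] is already known. *)
Lemma omega_sigma : omega * sigma = p2 ^+ 2 * f7 ^+ 2 + Q ^+ 3 * p14 ^+ 2 * f1 ^+ 2.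
Proof. by rewrite -HA -HA' -AB -AB' /omega /sigma; ring. Qed.

(** Each of the five terms is a rational function on the curve times Phi^3, or times D_0 for the
    term with G. [D0E] converts one scale into the other, and [curve_c3] is the remaining
    identity. *)
Lemma D4_formula : D4 = Q * (omega * (p2 ^+ 2 * f7 ^+ 2 + Q ^+ 3 * p14 ^+ 2 * f1 ^+ 2 + Q * G)
   + Q * p2 * p7 ^+ 2 * f7 ^+ 3 + 2 * Q ^+ 2 * p1 ^+ 3 * p7 ^+ 3
   + 4 * Q ^+ 6 * p7 ^+ 2 * p14 ^+ 3 * f1).
Proof.
have [hB hz _ h4] := curve; have Pn := Phi_neq0; have wn := w_neq0.
have mn := m_neq0; have un := u_neq0; have sn := s_neq0; have Dn := D0_neq0.
have four : 4 != 0 :> F by rewrite (_ : 4 = 2 * 2) ?mulf_neq0 //; ring.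
have zn : z != 0 by rewrite -hz !(mulf_neq0, expf_neq0, invr_neq0, s_neq0, m_neq0, u_neq0).
have hX := D0E; have hc := curve_c3 hB; rewrite -/z -/X -/w in hc.
have eight : 8 != 0 :> F by rewrite (_ : 8 = 4 * 2) ?mulf_neq0 //; ring.
have h64 : 64 != 0 :> F by rewrite (_ : 64 = 4 ^+ 3) ?expf_neq0 //; ring.
have Xn : X != 0.
  apply: contraTneq isT => X0; have : 64 * D0 * m ^+ 2 != 0.
    by apply: mulf_neq0; [apply: mulf_neq0 | apply: expf_neq0].
  by rewrite hX X0 expr0n /= mul0r eqxx.
have rhoE : rho = z / (m * s ^+ 3) by rewrite -hz; field; rewrite mn sn.
have om2 : 8 * Q * omega ^+ 2 = Phi ^+ 2 * (2 * s * (2 - 3 * s + 2 * s ^+ 2)).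
  apply: (mulfI two).
  have -> : 2 * (8 * Q * omega ^+ 2) =
    ((A ^+ 2 + 4 * Q * B ^+ 2) - (A ^+ 2 - 4 * Q * B ^+ 2)) *
    ((A' ^+ 2 + 4 * Q ^+ 7 * B' ^+ 2) + (A' ^+ 2 - 4 * Q ^+ 7 * B' ^+ 2)) +
    ((A ^+ 2 + 4 * Q * B ^+ 2) + (A ^+ 2 - 4 * Q * B ^+ 2)) *
    ((A' ^+ 2 + 4 * Q ^+ 7 * B' ^+ 2) - (A' ^+ 2 - 4 * Q ^+ 7 * B' ^+ 2)) + 32 * Q ^+ 4 * (A * B) * (A' * B').
    by rewrite /omega; ring.
  rewrite HA HA' HN HN' AB AB'.
  have g1 : n1 ^+ 2 * n7 ^+ 2 = Phi ^+ 2 * (1 - s) ^+ 4.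
    by rewrite complementary /n2 /n14 /n1 /n7 /Phi /f1 /f7; field; nzs.
  have g2 : 16 * Q ^+ 4 * p2 ^+ 2 * p14 ^+ 2 = Phi ^+ 2 * s ^+ 4.
    by rewrite /s /S /Phi /Q /f1 /f7 /p1 /p2 /p7 /p14; field; nzs.
  have -> : (f1 ^+ 2 - n1 ^+ 2) * (f7 ^+ 2 + n7 ^+ 2) + (f1 ^+ 2 + n1 ^+ 2) * (f7 ^+ 2 - n7 ^+ 2) +
      32 * Q ^+ 4 * p2 ^+ 2 * p14 ^+ 2 = 2 * Phi ^+ 2 - 2 * (n1 ^+ 2 * n7 ^+ 2)
        + 2 * (16 * Q ^+ 4 * p2 ^+ 2 * p14 ^+ 2).
    by rewrite /Phi; ring.
  by rewrite g1 g2; ring.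
have t1 : Q * (omega * (p2 ^+ 2 * f7 ^+ 2 + Q ^+ 3 * p14 ^+ 2 * f1 ^+ 2)) =
    Phi ^+ 3 * s * (2 - 3 * s + 2 * s ^+ 2) * w / 4.
  rewrite -omega_sigma (_ : Q * (omega * (omega * sigma)) = 8 * Q * omega ^+ 2 * sigma / 8).
    by rewrite om2 sigmaE; field; rewrite four eight.
  by field; rewrite eight.
have t2 : Q * (omega * (Q * G)) = D0 * (m * s * (rho + 1)) / (2 * w).
  have -> : omega = (p2 ^+ 2 * f7 ^+ 2 + Q ^+ 3 * p14 ^+ 2 * f1 ^+ 2) / sigma.
    by rewrite -omega_sigma; field.
  rewrite sigmaE.
  have -> : Q * ((p2 ^+ 2 * f7 ^+ 2 + Q ^+ 3 * p14 ^+ 2 * f1 ^+ 2) / (Phi * w) * (Q * G)) =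
    (2 * Q * (p2 ^+ 2 * f7 ^+ 2 + Q ^+ 3 * p14 ^+ 2 * f1 ^+ 2) * (Q * G) / Phi) / (2 * w).
    by field; rewrite two Pn wn.
  congr (_ / _).
  rewrite ED0 /G /rho /m /s /u /S /Phi /b0 /Q /f1 /f7 /p1 /p2 /p7 /p14; field; nzs.
have t3 : Q * (Q * p2 * p7 ^+ 2 * f7 ^+ 3) = Phi ^+ 3 * s ^+ 2 / (4 * m).
  rewrite /m /s /S /Phi /Q /f1 /f7 /p1 /p2 /p7; field; rewrite ?nz ?four ?eight ?f7_neq0 ?f1_neq0 ?Pn //.
have t4 : Q * (2 * Q ^+ 2 * p1 ^+ 3 * p7 ^+ 3) = Phi ^+ 3 * s ^+ 3 / 4.
  rewrite /s /S /Phi; field; rewrite ?nz ?four ?eight ?f7_neq0 ?f1_neq0 ?Pn //.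
have t5 : Q * (4 * Q ^+ 6 * p7 ^+ 2 * p14 ^+ 3 * f1) = Phi ^+ 3 * s ^+ 7 / (4 * z).
  rewrite -hz /rho /m /s /u /S /Phi /b0 /Q /f1 /f7 /p1 /p7 /p14; field;
    rewrite ?nz ?four ?eight ?f7_neq0 ?f1_neq0 ?Pn //.
rewrite [RHS](_ : _ = Q * (omega * (p2 ^+ 2 * f7 ^+ 2 + Q ^+ 3 * p14 ^+ 2 * f1 ^+ 2))
  + Q * (omega * (Q * G)) + Q * (Q * p2 * p7 ^+ 2 * f7 ^+ 3) + Q * (2 * Q ^+ 2 * p1 ^+ 3 * p7 ^+ 3)
  + Q * (4 * Q ^+ 6 * p7 ^+ 2 * p14 ^+ 3 * f1)); last by ring.
rewrite t1 t2 t3 t4 t5.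
have k0 : 4 * m * s ^+ 5 != 0 by rewrite !(mulf_neq0, expf_neq0, invr_neq0).
apply: (mulfI k0); rewrite h4.
have Xw : X ^+ 2 * w * z != 0 by rewrite !(mulf_neq0, expf_neq0, invr_neq0).
apply: (mulIf Xw).
transitivity (D0 * (((m - 1) ^+ 2 * z + 4 * m * s ^+ 3 * (z + s ^+ 3) +
     2 * m * s ^+ 3 * (z - s ^+ 3) * (m - 1)) * X ^+ 2 * w * z)); first by ring.
rewrite hc.
have PhiE : Phi ^+ 3 = 64 * D0 * m ^+ 2 / X ^+ 2 by rewrite hX; field.
rewrite PhiE rhoE; field; rewrite ?two ?four ?mn ?sn ?wn ?zn ?Xn //.
Qed.

Theorem degree_seven :
  D2 = x ^+ 6 * (G * (sigma + Q * p1 * p7)) /\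
  D4 = Q * (omega * (p2 ^+ 2 * f7 ^+ 2 + Q ^+ 3 * p14 ^+ 2 * f1 ^+ 2 + Q * G)
   + Q * p2 * p7 ^+ 2 * f7 ^+ 3 + 2 * Q ^+ 2 * p1 ^+ 3 * p7 ^+ 3
   + 4 * Q ^+ 6 * p7 ^+ 2 * p14 ^+ 3 * f1).
Proof. by split; [exact: D2_formula | exact: D4_formula]. Qed.
End DegreeSeven.

(** * Theta series and their Euler products *)

Definition fphi : fps int := gsum setT (fun i : int => `|i| ^ 2)%N (fun _ => 1).
Definition fphiN : fps int := gsum setT (fun i : int => `|i| ^ 2)%N (fun i => (-1) ^+ `|i|%N).
Definition fpsi : fps int := gsum setT (fun i : int => absz (2 * i ^+ 2 - i)%R) (fun _ => 1).
Definition feul : fps int := fprod (-1) predT.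

Section FormalIdentities.
Local Notation E k := (dil k feul).

Lemma fprod_mult c d : (0 < d)%N -> fprod c (fun i => i %% d == 0)%N = dil d (fprod c predT).
Proof. by move=> d0; rewrite fprod_dil //; apply: eq_fprod => i _; rewrite andbT. Qed.

Lemma dil1 f : dil 1 f = f :> fps int.
Proof. by apply: fpsP => n; rewrite dilE dvd1n divn1. Qed.

Definition fodd (c : int) := fprod c odd.

Lemma foddN : fodd (-1) * E 2 = E 1.
Proof.
rewrite -fprod_mult // fprod_mul => [|i _]; last by lia.
by rewrite dil1; apply: eq_fprod => i _ /=; lia.
Qed.

Lemma fodd1 : fodd 1 * (E 1 * E 4) = E 2 ^+ 2.
Proof.
have h1 := foddN; have h2 : fodd 1 * fodd (-1) = dil 2 (fodd (-1)) := fprod_sq odd.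
have h3 : dil 2 (fodd (-1)) * E 4 = E 2.
  by have := congr1 (dil 2) h1; rewrite rmorphM /= !dil_comp.
by rewrite expr2 -[X in _ = X * _]h3 -h2 -h1; ring.
Qed.

Lemma fphi_prod : fphi = fodd 1 ^+ 2 * E 2.
Proof.
have -> : fphi = rtheta 1 1 1.
  apply: eq_gsum => // i _; last by rewrite expr1n.
  by have := triE i; have := triE (- i); nia.
rewrite triple_product // -fprod_mult // expr2.
by congr (_ * _ * _); apply: eq_fprod => i _; lia.
Qed.

Lemma fphiN_prod : fphiN = fodd (-1) ^+ 2 * E 2.
Proof.
have -> : fphiN = rtheta (-1) 1 1.
  apply: eq_gsum => // i _.
  by have := triE i; have := triE (- i); nia.
rewrite triple_product // -fprod_mult // expr2.
by congr (_ * _ * _); apply: eq_fprod => i _; lia.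
Qed.

Lemma fpsi_prod : fpsi = fodd 1 * E 4.
Proof.
have -> : fpsi = rtheta 1 1 3.
  apply: eq_gsum => // i _; last by rewrite expr1n.
  by have := triE i; have := triE (- i); nia.
rewrite triple_product // -fprod_mult // fprod_mul => [|i _]; last by lia.
by congr (_ * _); apply: eq_fprod => i _ /=; lia.
Qed.

Lemma fphi_eul : fphi * (E 1 * E 4) ^+ 2 = E 2 ^+ 5.
Proof. by rewrite fphi_prod mulrAC -exprMn fodd1; ring. Qed.
Lemma fphiN_eul : fphiN * E 2 = E 1 ^+ 2.
Proof. by rewrite fphiN_prod -foddN; ring. Qed.
Lemma fpsi_eul : fpsi * E 1 = E 2 ^+ 2.
Proof. by rewrite fpsi_prod -fodd1; ring. Qed.

Lemma sqr_series_even g g' : (forall M, g (2 * M) = g' M) ->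
  sqr_series false g = dil 28 (gsum setT (fun i : int => `|i| ^ 2)%N g').
Proof.
move=> gg; rewrite gsum_dil //; apply: (@gsum_reindex _ _ _ (fun j => 2 * j)).
- split=> [j _|i j _ _ ? |i]; rewrite /= /oddz; try lia.
  by move=> h; exists (i %/ 2)%Z => //; lia.
- by move=> i _; lia.
- by move=> i _; rewrite gg.
Qed.

(* An odd integer is [4 j - 1] or [1 - 4 j], and [(4 j - 1) ^ 2 = 8 (2 j ^ 2 - j) + 1]. *)
Lemma odd_sqr_series (k : nat) : (0 < k)%N ->
  gsum [set M | oddz M = true] (fun M => k * `|M| ^ 2)%N (fun _ => 1) =
  2 * fXn k * dil (8 * k) fpsi.
Proof.
move=> k0; rewrite /fpsi gsum_dil; last by lia.
rewrite -mulrA gsumXn.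
have lf D : locfin D (fun M : int => k * `|M| ^ 2)%N.
  by apply: (@locfin_int _ _ 0) => i; nia.
have -> : [set M | oddz M = true] = [set M : int | (M %% 4 = 3)%Z] `|` [set M : int | (M %% 4 = 1)%Z].
  by apply/seteqP; split=> i /=; rewrite /oddz; lia.
rewrite gsumU //; last by move=> i /=; lia.
rewrite mulr_natl mulr2n; congr (_ + _).
- apply: (@gsum_reindex _ _ _ (fun j => 4 * j - 1)) => [|i _|//].
    split=> [j _|i j _ _ ? |i]; rewrite /=; try lia.
    by move=> h; exists ((i + 1) %/ 4)%Z => //; lia.
  by nia.
- apply: (@gsum_reindex _ _ _ (fun j => 1 - 4 * j)) => [|i _|//].
    split=> [j _|i j _ _ ? |i]; rewrite /=; try lia.
    by move=> h; exists ((1 - i) %/ 4)%Z => //; lia.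
  by nia.
Qed.

Lemma res_series_odd0 : odd0 = 2 * fXn 49 * dil 28 (dil 14 fpsi).
Proof.
rewrite dil_comp // -(@odd_sqr_series 49) //.
apply: (@gsum_reindex _ _ _ (fun j => 7 * j)) => [|i _|//]; last by lia.
split=> [j jo|i j _ _ ? |i]; rewrite /=; try lia.
  by split; [apply/intr7_eq0; lia | move: jo; rewrite /= /oddz; lia].
by move=> [/intr7_eq0 i7 io]; exists (i %/ 7)%Z; move: io; rewrite /= /oddz; lia.
Qed.

Lemma res_series_even0 eps eps' : (forall i, eps (14 * i) = eps' i) ->
  res_series eps false 0 = dil 28 (dil 7 (gsum setT (fun i : int => `|i| ^ 2)%N eps')).
Proof.
move=> he; rewrite dil_comp // gsum_dil //.
apply: (@gsum_reindex _ _ _ (fun j => 14 * j)) => [|i _|i _]; last by rewrite he.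
  split=> [j _|i j _ _ ? |i]; rewrite /=; try lia.
    by split; [apply/intr7_eq0; lia | rewrite /= /oddz; lia].
  by move=> [/intr7_eq0 i7 io]; exists (i %/ 14)%Z => //; move: io; rewrite /oddz; lia.
by nia.
Qed.

(** The odd integers of the class are p + 14 m, with square p^2 + 28 (7 m^2 + p m), and 7 m^2 + p m
    = (7 + p) [tri m] + (7 - p) [tri (- m)]. *)
Lemma res_series_odd eps c c0 (p : nat) : (p < 7)%N -> odd p ->
  (forall m : int, eps (p%:Z + 14 * m) = c0 * c ^+ `|m|%N) ->
  res_series eps true p%:R = fconst c0 * (fXn (p ^ 2)%N * dil 28 (rtheta c (7 + p) (7 - p))).
Proof.
move=> p7 po he; rewrite gsum_dil // gsumXn gsum_scale; last first.
  apply: (@locfin_int _ _ 0) => i.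
  have h : (`|i| <= (7 + p) * tri i + (7 - p) * tri (- i))%N by apply: e_ge; lia.
  by rewrite addn0 (leq_trans h) // (leq_trans _ (leq_addl _ _)) // leq_pmull.
apply: (@gsum_reindex _ _ _ (fun m => p%:Z + 14 * m)) => [|i _|i _].
- split=> [j _|i j _ _ ? |i]; rewrite /=; try lia.
    split; last by rewrite /oddz; lia.
    by rewrite -[p%:R]/(p%:Z%:~R : 'Z_7); apply/intr7_eq; lia.
  rewrite -[p%:R]/(p%:Z%:~R : 'Z_7) => -[/intr7_eq i7 io].
  by exists ((i - p%:Z) %/ 14)%Z => //; move: io; rewrite /oddz; lia.
- have e1 := triE i; have e2 := triE (- i).
  apply/eqP; rewrite -eqz_nat; apply/eqP; rewrite -!mulnn !(PoszD, PoszM) -subzn; last by lia.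
  rewrite !abszE -expr2 real_normK ?num_real //.
  rewrite [RHS](_ : _ = p%:Z * p%:Z + 14 * ((7 + p%:Z) * ((tri i)%:Z * 2)
    + (7 - p%:Z) * ((tri (- i))%:Z * 2))); last by ring.
  rewrite e1 e2.
  ring.
- exact: he.
Qed.

Section ThetaProducts.
Let R c := rtheta c (7 + 1) (7 - 1) * rtheta c (7 + 3) (7 - 3) * rtheta c (7 + 5) (7 - 5).
Let N c := fprod c (fun i => ~~ odd i && (i %% 14 != 0))%N.

(** The triple products contribute the residues 8, 6, then 10, 4, then 12, 2: exactly the nonzero
    even classes modulo 14. *)
Lemma rtheta7 c : c * c = 1 -> R c = N c * E 14 ^+ 3.
Proof.
move=> c2.
have T k l : (0 < k)%N -> (0 < l)%N -> (k + l = 14)%N -> rtheta c k l =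
    fprod c (fun i => i %% 14 == k)%N * fprod c (fun i => i %% 14 == l)%N * E 14.
  move=> k0 l0 kl; rewrite triple_product // kl fprod_mult //.
  by rewrite !modn_small //; lia.
rewrite /R !T //.
have -> : N c = fprod c (fun i => i %% 14 == 8)%N * fprod c (fun i => i %% 14 == 6)%N *
   (fprod c (fun i => i %% 14 == 10)%N * fprod c (fun i => i %% 14 == 4)%N) *
   (fprod c (fun i => i %% 14 == 12)%N * fprod c (fun i => i %% 14 == 2)%N).
  rewrite !fprod_mul; try by move=> i _ /=; lia.
  by apply: eq_fprod => i _ /=; lia.
set e := dil 14 _; ring.
Qed.

Lemma N_even c : N c * dil 14 (fprod c predT) = dil 2 (fprod c predT).
Proof.
rewrite -!fprod_mult // fprod_mul => [|i _]; last by lia.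
by apply: eq_fprod => i _ /=; lia.
Qed.

Lemma rtheta7N : R (-1) = E 2 * E 14 ^+ 2.
Proof. by rewrite rtheta7 // -[E 2]N_even -/feul; ring. Qed.

Lemma rtheta7P : R 1 * (E 28 * E 2) = E 4 * E 14 ^+ 4.
Proof.
have sq : fprod 1 predT * feul = E 2 := fprod_sq predT.
have h14 : dil 14 (fprod 1 predT) * E 14 = E 28.
  by have := congr1 (dil 14) sq; rewrite rmorphM /= !dil_comp.
have h2 : dil 2 (fprod 1 predT) * E 2 = E 4.
  by have := congr1 (dil 2) sq; rewrite rmorphM /= !dil_comp.
by rewrite rtheta7 // -h14 -h2 -N_even; ring.
Qed.

(** Up to sign the classes 1, 2, 3 have the odd representatives 1, 5, 3 below 7, and 35 = 1 + 25 +
    9. *)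
Lemma half3E : half3 = fXn 35 * dil 28 (R 1).
Proof.
have -> : half3 = res_series one_wt true 1%:R * res_series one_wt true (- 5%:R) * res_series one_wt true 3%:R.
  rewrite /half3; congr (_ * res_series _ _ _ * _); exact/val_inj.
rewrite (res_seriesN _ _ (fun i => erefl : one_wt (- i) = one_wt i)).
rewrite !(@res_series_odd one_wt 1 1) //; try by move=> m; rewrite expr1n.
rewrite /R !rmorphM /= -[fconst 1]/(1 : fps int).
have -> : fXn 35 = fXn (1 ^ 2) * fXn (5 ^ 2) * fXn (3 ^ 2) :> fps int by rewrite !fXnM.
ring.
Qed.

Lemma signed_product :
  (res_series chi true 1 * res_series chi true 2 * res_series chi true 3) ^+ 2 =
  fXn 70 * dil 28 (E 2 * E 14 ^+ 2) ^+ 2.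
Proof.
have cN : fconst (-1) = -1 :> fps int by apply: fpsP => -[|n] //=; rewrite oppr0.
have -> : res_series chi true 2 = - res_series chi true 5%:R.
  by rewrite -chiN_odd; congr (res_series _ _ _); exact/val_inj.
rewrite -[1 : 'Z_7]/(1%:R) -[3 : 'Z_7]/(3%:R).
have H (p : nat) (c0 : int) (m : int) : odd p -> chi p = c0 -> chi (p%:Z + 14 * m) = c0 * (-1) ^+ `|m|%N.
  move=> po <-; rewrite -signr_odd /chi /sg4 /oddz.
  by case E' : (odd `|m|%N); do ![case: eqP => ?]; rewrite ?mulr1 ?mul1r ?expr1 ?mulrNN //; lia.
rewrite (@res_series_odd chi (-1) 1) //; last by move=> m; exact: H.
rewrite (@res_series_odd chi (-1) (-1)) //; last by move=> m; exact: H.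
rewrite (@res_series_odd chi (-1) 1) //; last by move=> m; exact: H.
rewrite -rtheta7N /R !rmorphM /= cN -[fconst 1]/(1 : fps int).
have -> : fXn 70 = (fXn (1 ^ 2) * fXn (5 ^ 2) * fXn (3 ^ 2)) ^+ 2 :> fps int.
  by rewrite !fXnM fXnE.
ring.
Qed.
End ThetaProducts.

(** * Formal identities *)

Section Branches.
Implicit Types f g : fps int.

Lemma fsq_inj f g : f 0%N = 1 -> g 0%N = 1 -> f ^+ 2 = g ^+ 2 -> f = g.
Proof.
move=> f0 g0 /eqP; rewrite eqf_sqr => /orP[/eqP //|/eqP E'].
by have := congr1 (fun h : fps int => h 0%N) E'; rewrite fcoefN f0 g0.
Qed.

Lemma fcoefX0 f n : (f ^+ n) 0%N = (f 0%N) ^+ n.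
Proof. by elim: n => [|n IH]; rewrite ?expr0 // !exprS fcoefM0 IH. Qed.

Lemma fpow8_inj f g : f 0%N = 1 -> g 0%N = 1 -> f ^+ 8 = g ^+ 8 -> f = g.
Proof.
move=> f0 g0 h.
by do 3![apply: fsq_inj; rewrite ?fcoefX0 ?f0 ?g0 ?expr1n //]; rewrite -!exprM.
Qed.

Lemma fcoef_nat (k n : nat) : (k%:R : fps int) n = if n is 0%N then k%:R else 0.
Proof.
elim: k => [|k IH]; first by case: n.
rewrite -natr1 fcoefD IH fcoef1; clear IH.
by case: n => [|n] /=; rewrite ?natr1 ?addr0.
Qed.

(** At twice the smaller of the two orders the coefficient is a positive definite form in the
    integer leading coefficients. *)
Lemma fps_sum_sq f g : f ^+ 2 + 3 * g ^+ 2 = 0 -> g = 0.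
Proof.
move=> h; apply/eqP; apply: contraT => g0.
have f0 : f != 0.
  apply: contraNneq g0 => f0; move: h; rewrite f0 expr0n add0r => /eqP.
  rewrite mulf_eq0 expf_eq0 /= => /orP[/eqP E3|//].
  by have : (3 : fps int) 0%N = 0 by [rewrite E3]; rewrite fcoef_nat.
have [m fm fm0] := fps_lead f0; have [n gn gn0] := fps_lead g0.
pose k := minn m n.
have hf i : (i < k)%N -> f i = 0 by move=> ik; apply: fm0; lia.
have hg i : (i < k)%N -> g i = 0 by move=> ik; apply: gn0; lia.
have := congr1 (fun h : fps int => h (k + k)%N) h.
have -> : 3 * g ^+ 2 = g * g + g * g + g * g by ring.
rewrite expr2 !fcoefD !fcoefM_lead // fcoef0.
have [kn|kn] : k = m \/ k = n by lia.
  by rewrite kn; move/eqP: fm; nia.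
by rewrite kn; move/eqP: gn; nia.
Qed.

Lemma fcube_inj f g : f ^+ 3 = g ^+ 3 -> f = g.
Proof.
move=> h; have : (f - g) * (f ^+ 2 + f * g + g ^+ 2) = 0.
  by rewrite (_ : _ * _ = f ^+ 3 - g ^+ 3); [rewrite h subrr | ring].
move/eqP; rewrite mulf_eq0 subr_eq0 => /orP[/eqP //|/eqP h2].
have g0 : g = 0.
  apply: (@fps_sum_sq (2 * f + g)).
  by rewrite (_ : _ + _ = 4 * (f ^+ 2 + f * g + g ^+ 2)); [rewrite h2 mulr0 | ring].
by move: h; rewrite g0 expr0n /= => /eqP; rewrite expf_eq0 /= => /eqP.
Qed.

Definition fnonneg f := forall n, 0 <= f n.

Lemma fnonnegM f g : fnonneg f -> fnonneg g -> fnonneg (f * g).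
Proof. by move=> f0 g0 n; rewrite fcoefM sumr_ge0 // => i _; rewrite mulr_ge0. Qed.
Lemma fnonneg_gsum (I : choiceType) (D : set I) e : fnonneg (gsum D e (fun _ => 1)).
Proof. by move=> n; rewrite gsumE; apply: fsumr_ge0. Qed.
Lemma fnonneg_dil d f : fnonneg f -> fnonneg (dil d f).
Proof. by move=> f0 n; rewrite dilE; case: ifP. Qed.
Lemma fnonneg_Xn k : fnonneg (fXn k).
Proof. by move=> n /=. Qed.

Lemma fnonneg_sq_inj f g : fnonneg f -> fnonneg g -> f ^+ 2 = g ^+ 2 -> f = g.
Proof.
move=> f0 g0 /eqP; rewrite eqf_sqr => /orP[/eqP //|/eqP fg].
apply: fpsP => n; have h : f n = - g n by rewrite fg.
by have := f0 n; have := g0 n; rewrite h; lia.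
Qed.

Lemma fcoefM1 f g : (f * g) 1%N = f 0%N * g 1%N + f 1%N * g 0%N.
Proof. by rewrite fcoefM big_ord_recl big_ord1. Qed.
Lemma fcoefX1 f n : (f ^+ n.+1) 1%N = n.+1%:R * f 0%N ^+ n * f 1%N.
Proof.
elim: n => [|n IH]; first by rewrite expr1 expr0 !mul1r.
rewrite exprS fcoefM1 IH fcoefX0 -[n.+2%:R]natr1 [f 0%N ^+ n.+1]exprS.
set a := n.+1%:R; set b := f 0%N ^+ n; ring.
Qed.
End Branches.

(** The map (i, j) -> (i + j, i - j) doubles the norm and reaches exactly the pairs of equal parity.
    After x -> x^2, even pairs give the square of phi and odd pairs that of psi. *)
Lemma fphi_dissect : fphi ^+ 2 = dil 2 fphi ^+ 2 + 4 * fXn 1 * dil 4 fpsi ^+ 2.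
Proof.
apply: (@dil_inj _ 2) => //; rewrite rmorphD rmorphM !rmorphXn /= !dil_comp //.
have Ev : gsum [set i | oddz i = false] (fun i => `|i| ^ 2)%N (fun _ => 1) = dil 4 fphi.
  rewrite gsum_dil //; apply: (@gsum_reindex _ _ _ (fun j => 2 * j)) => // [|i _]; last by nia.
  split=> [j _|i j _ _ ? |i]; rewrite /= /oddz; try lia.
  by move=> h; exists (i %/ 2)%Z => //; lia.
have Od : gsum [set i | oddz i = true] (fun i => `|i| ^ 2)%N (fun _ => 1) = 2 * fXn 1 * dil 8 fpsi.
  by rewrite -(@odd_sqr_series 1) //; apply: eq_gsum => // i _; rewrite mul1n.
have -> : dil 2 (4 * fXn 1) * dil (2 * 4) fpsi ^+ 2 = (2 * fXn 1 * dil 8 fpsi) ^+ 2.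
  have X2 : dil 2 (fXn 1) = fXn 1 * fXn 1 :> fps int by rewrite dilXn // fXnM.
  rewrite rmorphM /= rmorph_nat X2.
  by rewrite -[(2 * 4)%N]/8%N; ring.
rewrite -[(2 * 2)%N]/4%N -Ev -Od !expr2 /fphi !gsum_mul; try exact: locfin_sqr.
have lf2 : locfin setT (fun i : int => 2 * `|i| ^ 2)%N.
  by apply: (@locfin_int _ _ 0) => i; nia.
rewrite gsum_dil // gsum_mul // -gsumU; last 3 first.
- by apply: (locfin_mul (locfin_sqr _) (locfin_sqr _)).
- by apply: (locfin_mul (locfin_sqr _) (locfin_sqr _)).
- by move=> [i j] /= [h1 _] [h2 _]; rewrite h1 in h2.
symmetry; apply: (@gsum_reindex _ _ _ (fun p : int * int => (p.1 + p.2, p.1 - p.2))) => //.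
- split=> [[i j] _|[i j] [i' j'] _ _ [h1 h2]|[i j]].
  + by case E' : (oddz (i + j)); [right|left]; split=> //=; move: E'; rewrite /oddz; lia.
  + by congr pair; lia.
  + move=> [] [/= h1 h2]; exists ((i + j) %/ 2, (i - j) %/ 2)%Z => //=;
      by move: h1 h2; rewrite /oddz => h1 h2; congr pair; lia.
- move=> [i j] _ /=; apply/eqP; rewrite -eqz_nat -!mulnn !(PoszM, PoszD) !abszE.
  rewrite -!expr2 !real_normK ?num_real //; apply/eqP; ring.
Qed.

Lemma ftwist_dil_even (f : fps int) d : ~~ odd d -> ftwist (dil d f) = dil d f.
Proof.
move=> dn; apply: fpsP => n; rewrite ftwistE dilE; case: ifP => [/dvdnP[k ->]|]; last by rewrite mulr0.
by rewrite -signr_odd oddM (negbTE dn) andbF mul1r.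
Qed.

Lemma fphiN_twist : fphiN = ftwist fphi.
Proof.
apply: fpsP => n; rewrite ftwistE !gsumE fsbig_distrr; last by apply: locfin_eq; exact: locfin_sqr.
apply: eq_fsbigr => i /set_mem[_ /= <-].
by rewrite mulr1 -signr_odd -[in RHS]signr_odd oddX.
Qed.

Lemma fphiN_dissect : fphiN ^+ 2 = dil 2 fphi ^+ 2 - 4 * fXn 1 * dil 4 fpsi ^+ 2.
Proof.
have X1 : ftwist (fXn 1) = - fXn 1 :> fps int.
  by apply: fpsP => n; rewrite ftwistE fcoefN /=; case: eqP => [->|_]; rewrite ?mulr0 ?oppr0.
rewrite fphiN_twist -rmorphXn fphi_dissect !expr2 rmorphD !rmorphM /= !ftwist_dil_even //.
by rewrite rmorph_nat X1; ring.
Qed.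

Lemma fphi_fpsi : fphi * dil 2 fpsi = fpsi ^+ 2.
Proof.
have e0 k : (0 < k)%N -> E k != 0.
  move=> k0; apply/eqP => h; have := congr1 (fun h : fps int => h 0%N) h.
  by rewrite dil_coef0 fprod0.
apply: (mulIf (_ : (E 1 * E 4) ^+ 2 * E 2 != 0)).
  by rewrite !(mulf_neq0, expf_neq0, e0).
have hp2 : dil 2 fpsi * E 2 = E 4 ^+ 2.
  by have := congr1 (dil 2) fpsi_eul; rewrite rmorphM rmorphXn /= !dil_comp.
transitivity ((fphi * (E 1 * E 4) ^+ 2) * (dil 2 fpsi * E 2)); first by ring.
rewrite fphi_eul hp2.
transitivity ((fpsi * E 1) ^+ 2 * E 4 ^+ 2 * E 2); last by ring.
by rewrite fpsi_eul; ring.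
Qed.

Lemma feul1 : feul 1%N = -1.
Proof. by rewrite /= /fpp big_nat1 fcoefD fcoefM1 fcoef1. Qed.
Lemma fphi0 : fphi 0%N = 1.
Proof.
by have := congr1 (fun h : fps int => h 0%N) fphi_eul; rewrite fcoefM0 !fcoefX0 fcoefM0 !dil_coef0 fprod0 mulr1.
Qed.
Lemma fphiN0 : fphiN 0%N = 1.
Proof. by rewrite fphiN_twist ftwistE fphi0. Qed.
Lemma fpsi0 : fpsi 0%N = 1.
Proof.
by have := congr1 (fun h : fps int => h 0%N) fpsi_eul; rewrite fcoefM0 !fcoefX0 !dil_coef0 fprod0 mulr1.
Qed.
Lemma fphi1 : fphi 1%N = 2.
Proof.
have := congr1 (fun h : fps int => h 1%N) fphi_eul.
rewrite fcoefM1 !fcoefX1 !fcoefX0 fcoefM1 fcoefM0 !dil_coef0 fprod0 fphi0 !dilE feul1 /=; lia.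
Qed.
Lemma fpsi1 : fpsi 1%N = 1.
Proof.
have := congr1 (fun h : fps int => h 1%N) fpsi_eul.
rewrite fcoefM1 !fcoefX1 !dil_coef0 fpsi0 fprod0 !dilE feul1 /=; lia.
Qed.

(** * Specialisation to the fraction field *)

Section FractionField.
Local Notation FF := {fraction (fps int)}.

(** As a series this is E(q^2) / E(q), which keeps the quotient of the theorem inside the integral
    formal series. *)
Definition fdist : fps int := fprod 1 predT.

Lemma fdist_eul : fdist * feul = E 2.
Proof. exact: fprod_sq. Qed.

Definition fracdil (f : fps int) : FF := FracField.tofrac (dil 28 f).
Lemma fracdil_zmod : zmod_morphism fracdil.
Proof. by move=> f g; rewrite /fracdil !rmorphB. Qed.
Lemma fracdil_mon : monoid_morphism fracdil.
Proof. by split=> [|f g]; rewrite /fracdil ?rmorph1 // !rmorphM. Qed.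
HB.instance Definition _ := GRing.isZmodMorphism.Build (fps int) FF fracdil fracdil_zmod.
HB.instance Definition _ := GRing.isMonoidMorphism.Build (fps int) FF fracdil fracdil_mon.

Lemma fracdil_inj : injective fracdil.
Proof.
move=> f g /eqP; rewrite /fracdil tofrac_eq => /eqP; exact: dil_inj.
Qed.

Lemma fracdil_eq0 f : (fracdil f == 0) = (f == 0).
Proof. by rewrite -(rmorph0 fracdil) (inj_eq fracdil_inj). Qed.

Lemma fps_neq0 (f : fps int) n : f n != 0 -> f != 0.
Proof. by apply: contraNneq => ->. Qed.

Lemma dil_eul_neq0 k : E k != 0.
Proof. by apply: (@fps_neq0 _ 0); rewrite dil_coef0 fprod0. Qed.

Local Notation j := fracdil.
Local Notation e k := (j (E k)).
Local Notation iota := (@FracField.tofrac (fps int)).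
Local Notation X := (fXn 1 : fps int).

Lemma sqr_series_false : sqr_series false one_wt = dil 28 fphi.
Proof. exact: sqr_series_even. Qed.

Lemma sqr_series_true : sqr_series true one_wt = 2 * fXn 7 * dil 28 (dil 2 fpsi).
Proof. by rewrite dil_comp // -(@odd_sqr_series 7). Qed.

Lemma res_series_even00 : even0 = dil 28 (dil 7 fphi).
Proof. exact: res_series_even0. Qed.

(** Read off from the relation for k = 7: an odd shift turns seven odd entries into none, and its
    left side is the single product [odd0] times [half3] squared. *)
Lemma core_series0_eul : core_series 0 * dil 28 (E 2) = fXn 112 * dil 28 (E 14 ^+ 7).
Proof.
have := @graded_coefsE 7 isT; rewrite /= sqr_series_true res_series_odd0 half3E.
set R := rtheta 1 (7 + 1) (7 - 1) * _ * _ => h.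
have hR : R * (E 28 * E 2) = E 4 * E 14 ^+ 4 := rtheta7P.
have h14 : dil 14 fpsi * E 14 = E 28 ^+ 2.
  by have := congr1 (dil 14) fpsi_eul; rewrite rmorphM rmorphXn /= !dil_comp.
have h2 : dil 2 fpsi * E 2 = E 4 ^+ 2.
  by have := congr1 (dil 2) fpsi_eul; rewrite rmorphM rmorphXn /= !dil_comp.
have X49 : fXn 49 * fXn 35 ^+ 2 = fXn 7 * fXn 112 :> fps int by rewrite fXnE !fXnM.
have nz : 2 * fXn 7 * dil 28 (E 4 ^+ 2 * E 28 ^+ 2 * E 2 ^+ 2 * E 14) != 0 :> fps int.
  have X7 : fXn 7 != 0 :> fps int by apply: (@fps_neq0 _ 7).
  have n2 : 2 != 0 :> fps int by apply: (@fps_neq0 _ 0); rewrite fcoef_nat.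
  apply: mulf_neq0; first exact: mulf_neq0.
  by apply: (@fps_neq0 _ 0); rewrite dil_coef0 !fcoefM0 !dil_coef0 !fprod0.
apply: (mulIf nz).
transitivity (core_series 0 * (2 * fXn 7 * dil 28 (dil 2 fpsi * E 2)) * dil 28 (E 28 ^+ 2 * E 2 ^+ 3 * E 14)).
  by rewrite h2 !rmorphM /=; ring.
rewrite rmorphM /=.
transitivity (2 * fXn 49 * dil 28 (dil 14 fpsi) * (fXn 35 * dil 28 R) ^+ 2 * dil 28
  (E 2) * dil 28 (E 28 ^+ 2 * E 2 ^+ 3 * E 14)).
  by rewrite h; ring.
transitivity (2 * (fXn 49 * fXn 35 ^+ 2) * dil 28 ((dil 14 fpsi * E 14) * (R * (E 28 * E 2)) ^+ 2 * E 2 ^+ 2)).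
  by rewrite !(rmorphM, rmorphXn) /=; ring.
by rewrite X49 h14 hR !(rmorphM, rmorphXn) /=; ring.
Qed.

Lemma core_series6_eul : core_series 6 * dil 28 (E 1 ^+ 2) =
  fXn 70 * dil 28 (E 7 ^+ 2 * E 2 ^+ 3 * E 14 ^+ 3).
Proof.
have sgM M : sg4 (2 * M) = (-1) ^+ `|M|%N.
  by rewrite -signr_odd /sg4; case E' : (odd `|M|%N); case: eqP => ?; rewrite ?expr1 //; lia.
have chM M : chi (14 * M) = (-1) ^+ `|M|%N.
  rewrite -signr_odd /chi /sg4 /oddz; case E' : (odd `|M|%N); case: eqP => ?; rewrite ?expr1 //; lia.
have := signed_eq; rewrite signed_product (sqr_series_even sgM) (res_series_even0 chM) -/fphiN => h.
have h7 : dil 7 fphiN * E 14 = E 7 ^+ 2.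
  by have := congr1 (dil 7) fphiN_eul; rewrite rmorphM rmorphXn /= !dil_comp.
rewrite -fphiN_eul rmorphM /= mulrA -h.
transitivity (fXn 70 * dil 28 ((dil 7 fphiN * E 14) * (E 2 ^+ 3 * E 14 ^+ 3))).
  by rewrite !(rmorphM, rmorphXn) /=; ring.
by rewrite h7 !(rmorphM, rmorphXn) /=; ring.
Qed.

Section Instance.
(** A fourth root of the nome x^28 is needed because the odd parts [sqr_series true] and [odd0]
    start with x^7 and x^49. *)
Let x : FF := FracField.tofrac (fXn 7).

Lemma x_neq0 : x != 0.
Proof. by rewrite tofrac_eq0; apply: (@fps_neq0 _ 7). Qed.
Lemma e_neq0 k : e k != 0. Proof. by rewrite fracdil_eq0 dil_eul_neq0. Qed.
Lemma two_neq0 : 2 != 0 :> FF.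
Proof.
have -> : 2 = j 2 by rewrite rmorph_nat.
by rewrite fracdil_eq0; apply: (@fps_neq0 _ 0); rewrite fcoef_nat.
Qed.
Lemma xE k : x ^+ k = FracField.tofrac (fXn (7 * k)).
Proof. by rewrite -fXnE rmorphXn. Qed.
Lemma xjE k : x ^+ (4 * k) = j (fXn k).
Proof. by rewrite xE /fracdil dilXn // mulnA. Qed.

Lemma f1E : e 2 ^+ 5 / (e 1 * e 4) ^+ 2 = j fphi.
Proof.
apply: (mulIf (expf_neq0 2 (mulf_neq0 (e_neq0 1) (e_neq0 4)))).
rewrite divfK ?expf_neq0 ?mulf_neq0 ?e_neq0 //.
by rewrite -rmorphXn -fphi_eul !(rmorphM, rmorphXn).
Qed.
Lemma f7E : e 14 ^+ 5 / (e 7 * e 28) ^+ 2 = j (dil 7 fphi).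
Proof.
apply: (mulIf (expf_neq0 2 (mulf_neq0 (e_neq0 7) (e_neq0 28)))).
rewrite divfK ?expf_neq0 ?mulf_neq0 ?e_neq0 //.
have h : dil 7 fphi * (E 7 * E 28) ^+ 2 = E 14 ^+ 5.
  by have := congr1 (dil 7) fphi_eul; rewrite rmorphM !rmorphXn rmorphM /= !dil_comp.
by rewrite -rmorphXn -h !(rmorphM, rmorphXn).
Qed.
Lemma psiE d : (0 < d)%N -> e (2 * d) ^+ 2 / e d = j (dil d fpsi).
Proof.
case: d => // d _; apply: (mulIf (e_neq0 d.+1)); rewrite divfK ?e_neq0 //.
have := congr1 (dil d.+1) fpsi_eul; rewrite rmorphM rmorphXn /= !dil_comp // muln1 mulnC => h.
by rewrite -rmorphXn -h rmorphM.
Qed.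
Lemma phiNE d : (0 < d)%N -> e d ^+ 2 / e (2 * d) = j (dil d fphiN).
Proof.
case: d => // d _; apply: (mulIf (e_neq0 (2 * d.+1))); rewrite divfK ?e_neq0 //.
have := congr1 (dil d.+1) fphiN_eul; rewrite rmorphM rmorphXn /= !dil_comp // muln1 mulnC => h.
by rewrite -rmorphXn -h rmorphM.
Qed.
End Instance.

Lemma core_series0_neq0 : core_series 0 != 0.
Proof.
apply: contraTneq isT => h.
have : (fXn 112 * dil 28 (E 14 ^+ 7)) 112%N = 0 :> int by rewrite -core_series0_eul h mul0r.
by rewrite fcoefXnM leqnn subnn dil_coef0 fcoefX0 dil_coef0 fprod0 expr1n.
Qed.

Lemma half0_neq0 : half0 != 0.
Proof.
have := @graded_coefsE 0 isT; rewrite /= sqr_series_false => E0.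
apply: contraNneq core_series0_neq0 => h; move: E0; rewrite h expr0n mulr0 => /esym/eqP.
rewrite mulf_eq0 => /orP[//|/eqP/(congr1 (fun f : fps int => f 0%N))].
by rewrite dil_coef0 fphi0.
Qed.

(** The relations for k = 0 and k = 7 share D_0, so their quotient gives the square of [half3] over
    [half0]. Nonnegative coefficients on both sides decide the sign. *)
Lemma half3_sign : half3 * (2 * fXn 49 * dil 28 (dil 14 fpsi)) * dil 28 fphi =
  2 * fXn 28 * dil 28 fpsi * dil 28 (dil 7 fpsi) * half0.
Proof.
have nn2 : fnonneg 2 by move=> n; rewrite fcoef_nat; case: n.
have nphi : fnonneg fphi by apply: fnonneg_gsum.
have npsi : fnonneg fpsi by apply: fnonneg_gsum.
have nres b r : fnonneg (res_series one_wt b r) by apply: fnonneg_gsum.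
apply: fnonneg_sq_inj.
- by rewrite /half3; repeat first [apply: fnonnegM | apply: fnonneg_dil | apply: fnonneg_Xn | done].
- by rewrite /half0; repeat first [apply: fnonnegM | apply: fnonneg_dil | apply: fnonneg_Xn | done].
have := @graded_coefsE 0 isT; have := @graded_coefsE 7 isT; rewrite /= sqr_series_false sqr_series_true.
rewrite res_series_odd0 res_series_even00 => h7 h0'.
have p1 : dil 28 fpsi ^+ 2 = dil 28 fphi * dil 28 (dil 2 fpsi).
  by rewrite -rmorphM fphi_fpsi rmorphXn.
have p7 : dil 28 (dil 7 fpsi) ^+ 2 = dil 28 (dil 7 fphi) * dil 28 (dil 14 fpsi).
  have := congr1 (dil 7) fphi_fpsi; rewrite rmorphM rmorphXn /= dil_comp // => h.
  by rewrite -rmorphXn -h rmorphM.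
have X56 : fXn 49 * fXn 7 = fXn 28 ^+ 2 :> fps int by rewrite fXnE fXnM.
transitivity ((2 * fXn 49 * dil 28 (dil 14 fpsi) * half3 ^+ 2) * (2 * fXn 49 * dil 28
  (dil 14 fpsi)) * dil 28 fphi ^+ 2).
  by ring.
rewrite h7 /=.
transitivity ((core_series 0 * dil 28 fphi) * (4 * (fXn 49 * fXn 7) * dil 28
  (dil 2 fpsi) * dil 28 (dil 14 fpsi) * dil 28 fphi)).
  by rewrite subnn; ring.
rewrite -h0' X56.
transitivity (4 * fXn 28 ^+ 2 * (dil 28 fphi * dil 28 (dil 2 fpsi)) * (dil 28
  (dil 7 fphi) * dil 28 (dil 14 fpsi)) * half0 ^+ 2).
  by ring.
by rewrite -p1 -p7; ring.
Qed.

Lemma S_coef0 : (2 * X * fpsi * dil 7 fpsi) 0%N = 0.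
Proof. by rewrite !fcoefM0 /= mulr0 !mul0r. Qed.
Lemma S_coef1 : (2 * X * fpsi * dil 7 fpsi) 1%N = 2.
Proof. by rewrite !(fcoefM1, fcoefM0) !fcoef_nat dil_coef0 fpsi0 fpsi1 !dilE. Qed.

(** The first term is of order at least 2, while the difference of squares starts with 4 x and its
    cofactor with 4; so the coefficient of order 1 is -16. *)
Lemma branch_L :
  4 * (2 * X * fpsi * dil 7 fpsi) ^+ 2
        - (fphi ^+ 2 - dil 7 fphi ^+ 2) * (fphi ^+ 2 + 3 * dil 7 fphi ^+ 2) != 0.
Proof.
apply: (@fps_neq0 _ 1); set S := 2 * X * _ * _.
have S0 : S 0%N = 0 := S_coef0.
have S1 : S 1%N = 2 := S_coef1.
have f1' : dil 7 fphi 1%N = 0 by [].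
clearbody S.
rewrite !(fcoef_nat, fcoefX0, fcoefX1, fcoefD, fcoefN, fcoefM0, fcoefM1, dil_coef0).
by rewrite S0 S1 f1' fphi0 fphi1.
Qed.

(** The expression of hypothesis [N4] over an arbitrary ring, so that it can be carried along a
    morphism from series to the field. *)
Definition branch_poly (R : comNzRingType) (S f f' q1 q2 q7 q14 : R) : R :=
  8 * S * f ^+ 2 * f' ^+ 2 * q2 ^+ 2 * q1 ^+ 3 * q7 ^+ 3
    + q14 ^+ 2 * (S * f ^+ 2 * f' ^+ 2 * (7 * (f * f') ^+ 3 - 14 * S * (f * f') ^+ 2
      + 14 * S ^+ 2 * (f * f') - 9 * S ^+ 3)
      + S * f ^+ 4 * (f * f') ^+ 3
      + S ^+ 3 * (4 * S - 4 * (f * f')) * f ^+ 2 * f' ^+ 2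
      - (f ^+ 2 - f' ^+ 2) * (f ^+ 2 * (f * f') + 3 * f' ^+ 2 * (f * f') - 4 * S * f' ^+ 2) * (f * f') ^+ 3).

Lemma rmorph_branch_poly (R R' : comNzRingType) (h : {rmorphism R -> R'}) S f f' q1 q2 q7 q14 :
  h (branch_poly S f f' q1 q2 q7 q14) =
  branch_poly (h S) (h f) (h f') (h q1) (h q2) (h q7) (h q14).
Proof. by rewrite /branch_poly !(rmorph_nat, rmorphB, rmorphD, rmorphXn, rmorphM). Qed.

(** Both [S] and [f - f'] start with 2 x, so the coefficient of order 1 is 2 (8 + 7 + 1) - 2 * 8 =
    16. *)
Lemma branch_b : branch_poly (2 * X * fpsi * dil 7 fpsi) fphi (dil 7 fphi)
  fpsi (dil 2 fpsi) (dil 7 fpsi) (dil 14 fpsi) != 0.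
Proof.
apply: (@fps_neq0 _ 1).
have := S_coef0; have := S_coef1; move: (2 * X * fpsi * dil 7 fpsi) => S S1 S0.
have := fpsi0; have : (dil 2 fpsi) 0%N = 1 by rewrite dil_coef0 fpsi0.
have : (dil 7 fpsi) 0%N = 1 by rewrite dil_coef0 fpsi0.
have : (dil 14 fpsi) 0%N = 1 by rewrite dil_coef0 fpsi0.
have : (dil 7 fphi) 0%N = 1 by rewrite dil_coef0 fphi0.
have : (dil 7 fphi) 1%N = 0 by [].
have := fphi0; have := fphi1.
move: fphi fpsi (dil 7 fphi) (dil 14 fpsi) (dil 7 fpsi) (dil 2 fpsi).
move=> f q1 f' q14 q7 q2 f1 f0 f1' f0' q140 q70 q20 q10.
(* All the terms vanish at order 1 except these three. *)
have -> : branch_poly S f f' q1 q2 q7 q14 =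
  S * (8 * f ^+ 2 * f' ^+ 2 * q2 ^+ 2 * q1 ^+ 3 * q7 ^+ 3
    + 7 * (q14 ^+ 2 * f ^+ 5 * f' ^+ 5) + q14 ^+ 2 * f ^+ 7 * f' ^+ 3)
  - (f - f') * ((f + f') * (f ^+ 2 + 3 * f' ^+ 2) * (f * f') ^+ 4 * q14 ^+ 2)
  + S * S * (q14 ^+ 2 * ((- 14 * f ^+ 4 * f' ^+ 4 + 14 * S * f ^+ 3 * f' ^+ 3
       - 9 * S ^+ 2 * f ^+ 2 * f' ^+ 2) + S * (4 * S - 4 * (f * f')) * f ^+ 2 * f' ^+ 2))
  + S * (f - f') * (4 * (f + f') * f' ^+ 2 * (f * f') ^+ 3 * q14 ^+ 2).
  by rewrite /branch_poly; ring.
rewrite !(fcoefD, fcoefN) !(fcoefM1 S) !(fcoefM1 (_ - _)) !(fcoefM1 (S * _)) !(fcoefM0 S) !(fcoefM1 S).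
rewrite !(fcoefD, fcoefN) S0 S1 f0 f1 f0' f1' !(mul0r, add0r, addr0, mulr0, subrr).
rewrite !(fcoef_nat, fcoefX0, fcoefD, fcoefM0) f0 f0' q140 q70 q20 q10.
by [].
Qed.

Ltac by_frac h :=
  let k := fresh in
  move: h; generalize half0 half1 half2 half3 => ? ? ? ? h;
  have k := congr1 iota h; move: k; rewrite !(rmorphD, rmorphM, rmorphXn, rmorph_nat) /= => k;
  rewrite [RHS]mulrC /fracdil; exact k.

Definition fsigma : fps int := dil 2 fphi * dil 14 fphi + 4 * X ^+ 4 * dil 4 fpsi * dil 28 fpsi.
Definition fomega : fps int := dil 4 fpsi * dil 14 fphi + X ^+ 3 * dil 28 fpsi * dil 2 fphi.
Definition fG : fps int := E 14 * E 7 ^+ 3 * fdist.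
(** [core1_rhs] and [core0_rhs] are the right-hand sides of the theorem in the variable q^2, the
    former without its factor q. *)
Definition core1_rhs : fps int := fG * (fsigma + X * fpsi * dil 7 fpsi).
Definition core0_rhs : fps int :=
  fomega * (dil 2 fpsi ^+ 2 * dil 7 fphi ^+ 2 + X ^+ 3 * dil 14 fpsi ^+ 2 * fphi ^+ 2 + X * fG)
  + X * dil 2 fpsi * dil 7 fpsi ^+ 2 * dil 7 fphi ^+ 3
  + 2 * X ^+ 2 * fpsi ^+ 3 * dil 7 fpsi ^+ 3
  + 4 * X ^+ 6 * dil 7 fpsi ^+ 2 * dil 14 fpsi ^+ 3 * fphi.

Lemma fsigma0 : fsigma 0%N = 1.
Proof.
have X4 : X ^+ 4 = fXn 4 by rewrite fXnE.
by rewrite /fsigma X4 fcoefD !fcoefM0 !dil_coef0 fphi0 mulr1 /= mulr0 !mul0r addr0.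
Qed.

Theorem core_series_formulas :
  core_series 2 = fXn 42 * dil 28 core1_rhs /\ core_series 4 = fXn 28 * dil 28 core0_rhs.
Proof.
pose x : FF := iota (fXn 7).
have p1E : e 2 ^+ 2 / e 1 = j fpsi by rewrite -[fpsi]dil1; exact: (@psiE 1).
have p2E : e 4 ^+ 2 / e 2 = j (dil 2 fpsi) := @psiE 2 isT.
have p7E : e 14 ^+ 2 / e 7 = j (dil 7 fpsi) := @psiE 7 isT.
have p14E : e 28 ^+ 2 / e 14 = j (dil 14 fpsi) := @psiE 14 isT.
have n1E : e 1 ^+ 2 / e 2 = j fphiN by rewrite -[fphiN]dil1; exact: (@phiNE 1).
have n2E : e 2 ^+ 2 / e 4 = j (dil 2 fphiN) := @phiNE 2 isT.
have n7E : e 7 ^+ 2 / e 14 = j (dil 7 fphiN) := @phiNE 7 isT.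
have n14E : e 14 ^+ 2 / e 28 = j (dil 14 fphiN) := @phiNE 14 isT.
have f1E := f1E; have f7E := f7E.
have QE : x ^+ 4 = j X by rewrite -(xjE 1).
have tauE : iota (fXn 7) = x by [].
have x7 : iota (fXn 49) = x ^+ 7 by rewrite xE.
have Q4 : iota (fXn 28) = x ^+ 4 by rewrite xE.
have GE : e 14 * e 7 ^+ 3 * e 2 / e 1 = j fG.
  apply: (mulIf (e_neq0 1)); rewrite divfK ?e_neq0 //.
  by rewrite -[E 2]fdist_eul dil1 /fG !(rmorphM, rmorphXn); ring.
pose A := j (dil 2 fphi); pose B := j (dil 4 fpsi).
pose A' := j (dil 14 fphi); pose B' := j (dil 28 fpsi).
have [D2E D4E] : iota (core_series 2) = x ^+ 6 * (e 14 * e 7 ^+ 3 * e 2 / e 1 *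
     (A * A' + 4 * (x ^+ 4) ^+ 4 * B * B' + x ^+ 4 * (e 2 ^+ 2 / e 1) * (e 14 ^+ 2 / e 7))) /\
  iota (core_series 4) = x ^+ 4 * ((B * A' + (x ^+ 4) ^+ 3 * B' * A) *
     ((e 4 ^+ 2 / e 2) ^+ 2 * (e 14 ^+ 5 / (e 7 * e 28) ^+ 2) ^+ 2 +
      (x ^+ 4) ^+ 3 * (e 28 ^+ 2 / e 14) ^+ 2 * (e 2 ^+ 5 / (e 1 * e 4) ^+ 2) ^+ 2 +
      x ^+ 4 * (e 14 * e 7 ^+ 3 * e 2 / e 1))
    + x ^+ 4 * (e 4 ^+ 2 / e 2) * (e 14 ^+ 2 / e 7) ^+ 2 * (e 14 ^+ 5 / (e 7 * e 28) ^+ 2) ^+ 3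
    + 2 * (x ^+ 4) ^+ 2 * (e 2 ^+ 2 / e 1) ^+ 3 * (e 14 ^+ 2 / e 7) ^+ 3
    + 4 * (x ^+ 4) ^+ 6 * (e 14 ^+ 2 / e 7) ^+ 2 * (e 28 ^+ 2 / e 14) ^+ 3 * (e 2 ^+ 5 / (e 1 * e 4) ^+ 2)).
  refine (@degree_seven FF two_neq0 x (e 1) (e 2) (e 4) (e 7) (e 14) (e 28)
    x_neq0 (e_neq0 1) (e_neq0 2) (e_neq0 4) (e_neq0 7) (e_neq0 14) (e_neq0 28)
    (iota half0) (iota half1) (iota half2) (iota half3)
    (iota (core_series 0)) (iota (core_series 2)) (iota (core_series 4)) (iota (core_series 6))
    _ _ _ _ _ _ _ _ _ _ _ _ _ _ _ A B A' B' _ _ _ _ _ _ _ _ _ _);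
  rewrite ?f1E ?f7E ?p1E ?p2E ?p7E ?p14E ?n1E ?n2E ?n7E ?n14E.
  - by rewrite tofrac_eq0 half0_neq0.
  - have := @graded_coefsE 0 isT; rewrite /= sqr_series_false res_series_even00 => h; by_frac h.
  - have := @graded_coefsE 1 isT; rewrite /= sqr_series_true res_series_even00 res_series_odd0 => h.
    by rewrite -tauE -x7; by_frac h.
  - have := @graded_coefsE 2 isT; rewrite /= sqr_series_false res_series_even00 res_series_odd0 => h.
    by rewrite -x7; by_frac h.
  - have := @graded_coefsE 3 isT; rewrite /= sqr_series_true res_series_even00 res_series_odd0 => h.
    by rewrite -tauE -x7; by_frac h.
  - have := @graded_coefsE 4 isT; rewrite /= sqr_series_false res_series_even00 res_series_odd0 => h.
    by rewrite -x7; by_frac h.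
  - have := @graded_coefsE 5 isT; rewrite /= sqr_series_true res_series_even00 res_series_odd0 => h.
    by rewrite -tauE -x7; by_frac h.
  - have := @graded_coefsE 6 isT; rewrite /= sqr_series_false res_series_even00 res_series_odd0 => h.
    by rewrite -x7; by_frac h.
  - have h := half3_sign; rewrite -x7 -Q4 [RHS]mulrC; by_frac h.
  - have h : iota (core_series 6) * e 1 ^+ 2 = x ^+ 10 * (e 7 ^+ 2 * e 2 ^+ 3 * e 14 ^+ 3).
      have := congr1 iota core_series6_eul; rewrite !(rmorphM, rmorphXn) /= -(xE 10) => ->.
      by rewrite /fracdil; ring.
    by apply: (mulIf (expf_neq0 2 (e_neq0 1))); rewrite h -[RHS]mulrA divfK // expf_neq0 // e_neq0.
  - have h : iota (core_series 0) * e 2 = x ^+ 16 * e 14 ^+ 7.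
      have := congr1 iota core_series0_eul; rewrite !(rmorphM, rmorphXn) /= -(xE 16) => ->.
      by rewrite /fracdil; ring.
    by apply: (mulIf (e_neq0 2)); rewrite h -[RHS]mulrA divfK // e_neq0.
  - rewrite QE (_ : _ - _ = j (2 * X * fpsi * dil 7 fpsi - fphi * dil 7 fphi)).
      rewrite fracdil_eq0; apply: (@fps_neq0 _ 0).
      by rewrite fcoefD ?fcoefN S_coef0 fcoefM0 dil_coef0 fphi0.
    by rewrite !(rmorphB, rmorphM, rmorph_nat).
  - rewrite QE (_ : _ + _ = j (2 * X * fpsi * dil 7 fpsi + fphi * dil 7 fphi)).
      rewrite fracdil_eq0; apply: (@fps_neq0 _ 0).
      by rewrite fcoefD ?fcoefN S_coef0 fcoefM0 dil_coef0 fphi0.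
    by rewrite !(rmorphD, rmorphM, rmorph_nat).
  - rewrite QE (_ : _ - _ = j (4 * (2 * X * fpsi * dil 7 fpsi) ^+ 2
        - (fphi ^+ 2 - dil 7 fphi ^+ 2) * (fphi ^+ 2 + 3 * dil 7 fphi ^+ 2))).
      by rewrite fracdil_eq0 branch_L.
    by rewrite !(rmorph_nat, rmorphB, rmorphD, rmorphXn, rmorphM).
  - rewrite -[X in X != 0]/(branch_poly (2 * x ^+ 4 * j fpsi * j (dil 7 fpsi)) (j fphi)
      (j (dil 7 fphi)) (j fpsi) (j (dil 2 fpsi)) (j (dil 7 fpsi)) (j (dil 14 fpsi))).
    have -> : 2 * x ^+ 4 * j fpsi * j (dil 7 fpsi) = j (2 * X * fpsi * dil 7 fpsi).
      by rewrite QE !(rmorph_nat, rmorphM).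
    by rewrite -rmorph_branch_poly fracdil_eq0 branch_b.
  - rewrite QE /A /B; have := congr1 j fphi_dissect.
    by rewrite !(rmorphD, rmorphXn, rmorphM, rmorph_nat) => ->.
  - rewrite QE /A /B; have := congr1 j fphiN_dissect.
    by rewrite !(rmorph_nat, rmorphB, rmorphXn, rmorphM) /= => <-.
  - have h : dil 14 fphi ^+ 2 + 4 * X ^+ 7 * dil 28 fpsi ^+ 2 = dil 7 fphi ^+ 2.
      have := congr1 (dil 7) fphi_dissect; rewrite !expr2 rmorphD !rmorphM /= !dil_comp // dilXn // rmorph_nat => ->.
      by rewrite fXnE.
    have := congr1 j h; rewrite !(rmorph_nat, rmorphD, rmorphXn, rmorphM) /= => <-.
    by rewrite QE.
  - have h : dil 14 fphi ^+ 2 - 4 * X ^+ 7 * dil 28 fpsi ^+ 2 = dil 7 fphiN ^+ 2.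
      have := congr1 (dil 7) fphiN_dissect; rewrite !expr2 rmorphB !rmorphM /= !dil_comp // dilXn // rmorph_nat => ->.
      by rewrite fXnE.
    have := congr1 j h; rewrite !(rmorph_nat, rmorphB, rmorphXn, rmorphM) /= => <-.
    by rewrite QE.
  - have := congr1 (dil 2) fphi_fpsi; rewrite rmorphM rmorphXn /= dil_comp // => /(congr1 j).
    by rewrite rmorphM rmorphXn.
  - have := congr1 (dil 14) fphi_fpsi; rewrite rmorphM rmorphXn /= dil_comp // => /(congr1 j).
    by rewrite rmorphM rmorphXn.
  - rewrite QE (_ : _ - _ = j (fphi * dil 7 fphi - 2 * X * fpsi * dil 7 fpsi)); last first.
      by rewrite !(rmorph_nat, rmorphB, rmorphM).
    rewrite -rmorphM -!rmorphXn => /fracdil_inj h; congr fracdil; apply: fpow8_inj h.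
      by rewrite fcoefD fcoefN S_coef0 fcoefM0 dil_coef0 fphi0.
    by rewrite fcoefM0 !dil_coef0 fphiN0.
  - rewrite QE; set S := 2 * X * fpsi * dil 7 fpsi; set Phi := fphi * dil 7 fphi.
    rewrite (_ : _ * _ = j (fsigma * Phi)); last first.
      by rewrite /fsigma !(rmorph_nat, rmorphD, rmorphXn, rmorphM).
    rewrite (_ : _ - _ + _ = j (Phi ^+ 2 - Phi * S + S ^+ 2)); last first.
      by rewrite /Phi /S !(rmorph_nat, rmorphB, rmorphD, rmorphXn, rmorphM).
    have S0 : S 0%N = 0 := S_coef0.
    have P0 : Phi 0%N = 1 by rewrite fcoefM0 dil_coef0 fphi0.
    rewrite -!rmorphXn => /fracdil_inj h; congr fracdil; apply: fsq_inj h.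
      by rewrite fcoefM0 P0 fsigma0.
    by rewrite !(P0, S0, fcoefD, fcoefN, fcoefM0).
  (* [core_series 0] is not given as a series in x^28, so this root is compared in the variable x
     itself. *)
  - have dj (f : fps int) : j f = iota (dil 28 f) by [].
    rewrite QE; set S := 2 * X * fpsi * dil 7 fpsi; set Phi := fphi * dil 7 fphi.
    rewrite (_ : 64 * _ * _ = iota (64 * core_series 0 * dil 28 fphi ^+ 4)); last first.
      by rewrite !(rmorph_nat, rmorphXn, rmorphM).
    rewrite (_ : _ ^+ 2 * _ = iota (dil 28 ((dil 7 fphi ^+ 2 * Phi - fphi ^+ 2 * (Phi
      - 2 * S)) ^+ 2 * Phi))); last first.
      by rewrite -dj /Phi /S !(rmorph_nat, rmorphB, rmorphD, rmorphXn, rmorphM).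
    rewrite -!(rmorphXn iota) => /eqP; rewrite tofrac_eq => /eqP h; by rewrite (fcube_inj h).
  - rewrite QE (_ : _ + _ = j fsigma); last by rewrite /fsigma !(rmorph_nat, rmorphD, rmorphXn, rmorphM).
    rewrite fracdil_eq0; apply: (@fps_neq0 _ 0).
    by rewrite fsigma0.
have inj (f g : fps int) : iota f = iota g -> f = g.
  by move/eqP; rewrite tofrac_eq => /eqP.
have x6 : x ^+ 6 = iota (fXn 42) by rewrite xE.
split; apply: inj.
  rewrite D2E x6 QE GE p1E p7E [RHS]rmorphM; congr (_ * _).
  by rewrite -/(j core1_rhs) /core1_rhs /fsigma !(rmorph_nat, rmorphD, rmorphXn, rmorphM).
rewrite D4E GE f1E f7E p1E p2E p7E p14E [RHS]rmorphM; congr (_ * _); first by rewrite -Q4.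
rewrite QE.
by rewrite -/(j core0_rhs) /core0_rhs /fomega !(rmorph_nat, rmorphD, rmorphXn, rmorphM).
Qed.
End FractionField.
End FormalIdentities.

(** * Beta sets of 7-cores *)

Section BetaSets.
Local Open Scope nat_scope.

Lemma conj_partP (p : seq nat) a j : sorted geq p ->
  (j < nth 0 p a) = (a < conj_part p j).
Proof.
rewrite /conj_part; elim: p a => [|x p IH] a; first by rewrite nth_nil.
rewrite /= (path_sortedE (rev_trans leq_trans)) => /andP[/allP px ps].
case: (ltnP j x) => jx; case: a => [|a] //=.
- by rewrite IH // add1n ltnS.
- have -> : count (fun y => j < y) p = 0.
    apply/eqP; rewrite -leqn0 leqNgt -has_count; apply/hasPn => y yp.
    by have := px y yp; rewrite /= -leqNgt; lia.
  by rewrite addn0 leqNgt ltnS jx.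
- have -> : count (fun y => j < y) p = 0.
    apply/eqP; rewrite -leqn0 leqNgt -has_count; apply/hasPn => y yp.
    by have := px y yp; rewrite /= -leqNgt; lia.
  apply/negbTE; rewrite -leqNgt.
  have [ap|ap] := ltnP a (size p); last by rewrite nth_default.
  by have := px _ (mem_nth 0 ap) => /=; lia.
Qed.

Lemma sorted_nth_geq (p : seq nat) a b : sorted geq p -> a <= b -> nth 0 p b <= nth 0 p a.
Proof.
move=> ps ab; rewrite leqNgt; apply/negP => h.
have := conj_partP a (nth 0 p a) ps; rewrite ltnn => h1.
by have := conj_partP b (nth 0 p a) ps; rewrite h; lia.
Qed.

(** The beta-set of the partition padded with zeros to N parts, in decreasing order. *)
Definition beads (N : nat) (p : seq nat) : seq nat :=
  mkseq (fun i => nth 0 p i + (N - i.+1)) N.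

Lemma size_beads N p : size (beads N p) = N. Proof. exact: size_mkseq. Qed.
Lemma nth_beads N p i : i < N -> nth 0 (beads N p) i = nth 0 p i + (N - i.+1).
Proof. exact: nth_mkseq. Qed.
Lemma mem_beads N p x :
  reflect (exists2 i, i < N & x = nth 0 p i + (N - i.+1)) (x \in beads N p).
Proof.
apply: (iffP mapP) => [[i h ->]|[i iN ->]]; first by exists i; move: h; rewrite ?mem_iota.
by exists i; rewrite ?mem_iota.
Qed.

Lemma beads_sorted N p : sorted geq p -> sorted gtn (beads N p).
Proof.
move=> ps; apply/(sortedP 0) => i; rewrite size_beads => iN.
rewrite !nth_beads //; last by lia.
have := @sorted_nth_geq p i i.+1 ps (leqnSn i); rewrite /=; lia.
Qed.

(** The hook lengths in a row with bead x are the differences x - y over the gaps y below x. For a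
    gap y with k beads above it, the matching column is j = y - (N - k): it has height k, and its
    hook in that row is x - y. *)
Lemma is_coreP (t N : nat) (p : seq nat) : 0 < t -> sorted geq p -> size p <= N ->
  is_core t p <-> (forall x, x \in beads N p -> t <= x -> x - t \in beads N p).
Proof.
move=> t0 ps pN; split=> [/forallP hc x /mem_beads[i iN ->] tx|cl].
- apply: contraT => hy; set y := _ - t in hy.
  have bs : sorted geq (beads N p).
    by apply: sub_sorted (beads_sorted N ps) => a b /ltnW.
  pose k := conj_part (beads N p) y.
  have kP a : (y < nth 0 (beads N p) a) = (a < k) by rewrite conj_partP.
  have kN : k <= N by rewrite -[X in _ <= X](size_beads N p) count_size.
  have ik : i < k by rewrite -kP nth_beads //; rewrite /y; lia.
  have kp a : a < k -> y < nth 0 p a + (N - a.+1) by move=> ak; rewrite -nth_beads ?kP //; lia.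
  have pk : k < N -> nth 0 p k + (N - k.+1) < y.
    move=> kN'; rewrite ltn_neqAle -(nth_beads _ kN') leqNgt kP ltnn andbT.
    by apply: contraNneq hy => <-; rewrite mem_nth // size_beads.
  have yN : N - k <= y.
    by have [->|kN'] := eqVneq k N; [lia | have := pk; lia].
  pose j := y - (N - k).
  have ji : j < nth 0 p i.
    have := kp k.-1; have := @sorted_nth_geq p i k.-1 ps; rewrite /j; lia.
  have cj : conj_part p j = k.
    have h1 : k.-1 < conj_part p j by rewrite -conj_partP //; have := kp k.-1; rewrite /j; lia.
    have h2 : ~~ (k < conj_part p j).
      rewrite -conj_partP // -leqNgt; have [kN'|kN'] := ltnP k N.
        by have := pk kN'; rewrite /j; lia.
      by rewrite nth_default //; lia.
    by lia.
  have ip : i < size p by rewrite ltnNge; apply/negP => h; rewrite nth_default in ji.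
  have := hc (Ordinal ip) => /forallP /(_ (Ordinal ji)) /=.
  by rewrite /hook_length cj /= => /eqP []; move: ik ji yN; rewrite /j /y; lia.
- apply/forallP => -[i ip]; apply/forallP => -[j ji] /=; apply/negP => /eqP.
  rewrite /= in ji; rewrite /hook_length => hk.
  have ik : i < conj_part p j by rewrite -conj_partP.
  have kN : conj_part p j <= N by rewrite (leq_trans (count_size _ _)).
  have iN : i < N by lia.
  have bi : nth 0 p i + (N - i.+1) \in beads N p by apply/mem_beads; exists i.
  have tx : t <= nth 0 p i + (N - i.+1) by lia.
  have /mem_beads[a aN E] := cl _ bi tx.
  have := conj_partP a j ps; lia.
Qed.

Lemma closed_initial (s : seq nat) : uniq s -> (forall k, k.+1 \in s -> k \in s) ->
  forall k, (k \in s) = (k < size s).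
Proof.
move=> us cl k.
have down a b : a + b \in s -> a \in s.
  by elim: b => [|b IH]; rewrite ?addn0 // addnS => /cl.
apply/idP/idP => [ks|].
  rewrite -(size_iota 0 k.+1); apply: uniq_leq_size; first exact: iota_uniq.
  by move=> i; rewrite mem_iota => /andP[_ ik]; apply: (down _ (k - i)); rewrite subnKC //; lia.
apply: contraTT => ks; rewrite -leqNgt -(size_iota 0 k); apply: uniq_leq_size => // i si.
rewrite mem_iota /= add0n ltnNge; apply: contra ks => ki.
by apply: (down _ (i - k)); rewrite subnKC.
Qed.

Definition rescount (N : nat) (p : seq nat) (r : nat) : nat :=
  count (fun x => x %% 7 == r) (beads N p).

Lemma gtn_sorted_uniq (s : seq nat) : sorted gtn s -> uniq s.
Proof. by apply: sorted_uniq => [y x z /= xy yz|x /=]; [lia|rewrite ltnn]. Qed.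

(** On each runner the beads of a core are pushed down without gaps, so their number determines
    their positions. *)
Lemma core_mem_beads N p : sorted geq p ->
  (forall x, x \in beads N p -> 7 <= x -> x - 7 \in beads N p) ->
  forall x, (x \in beads N p) = (x %/ 7 < rescount N p (x %% 7)).
Proof.
move=> ps cl x; set r := x %% 7.
have r7 : r < 7 by rewrite ltn_mod.
pose s := [seq y %/ 7 | y <- beads N p & y %% 7 == r].
have ms k : (k \in s) = (7 * k + r \in beads N p).
  apply/mapP/idP => [[y hy ->]|h].
    by move: hy; rewrite mem_filter => /andP[/eqP yr yb]; rewrite -yr mulnC -divn_eq.
  exists (7 * k + r); last by lia.
  by rewrite mem_filter h andbT; lia.
have us : uniq s.
  rewrite map_inj_in_uniq ?filter_uniq ?gtn_sorted_uniq ?beads_sorted //.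
  move=> a b; rewrite !mem_filter => /andP[/eqP ar _] /andP[/eqP br _]; lia.
have := closed_initial us; rewrite size_map size_filter => ci.
rewrite -ci; last by move=> k; rewrite !ms => h; have := cl _ h; rewrite mulnS -addnA addKn; apply; lia.
by rewrite ms mulnC -divn_eq.
Qed.

Lemma sum_residues (T : nmodType) (F : nat -> T) (c : nat -> nat) C : (forall r, r < 7 -> c r <= C) ->
  (\sum_(0 <= x < (7 * C)%N | (x %/ 7 < c (x %% 7))%N) F x = \sum_(r < 7) \sum_(k < c r) F (r + 7 * k)%N)%R.
Proof.
move=> cC.
transitivity (\sum_(0 <= k < C) \sum_(r < 7 | (k < c r)%N) F (r + 7 * k)%N)%R.
  elim: C {cC} => [|C IH]; first by rewrite !big_geq.
  rewrite (@big_cat_nat _ _ _ (7 * C)) //=; last by rewrite leq_mul2l leqnSn orbT.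
  rewrite IH big_nat_recr //=; congr (_ + _)%R.
  rewrite -{1}[7 * C]add0n mulnS big_addn addnK big_mkord.
  apply: eq_bigl => r.
  have -> : (r + 7 * C) %/ 7 = C by rewrite mulnC addnC divnMDl // divn_small ?addn0.
  by rewrite mulnC addnC modnMDl modn_small.
rewrite big_mkord (exchange_big_dep xpredT) //=; apply: eq_bigr => r _.
rewrite (big_ord_widen _ (fun k => F (r + 7 * k)) (cC _ (ltn_ord r))).
by apply: eq_bigl.
Qed.

(** A sum over the rows is regrouped by runners. The functions 1, 2 x and (-1)^x of a bead x will
    yield the number of beads, the size and the BG-rank. *)
Lemma sum_beads (T : nmodType) (F : nat -> T) N p :
  sorted geq p -> (forall x, x \in beads N p -> 7 <= x -> x - 7 \in beads N p) ->
  (\sum_(i < N) F (nth 0 p i + (N - i.+1))%N = \sum_(r < 7) \sum_(k < rescount N p r) F (r + 7 * k)%N)%R.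
Proof.
move=> ps cl; have hb := core_mem_beads ps cl.
pose C := N; have cC r : (r < 7)%N -> rescount N p r <= C.
  by move=> _; rewrite -[C](size_beads N p) count_size.
rewrite -(sum_residues _ cC) -(big_mkord xpredT (fun i => F (nth 0 p i + (N - i.+1)))).
transitivity (\sum_(x <- beads N p) F x)%R.
  by rewrite /beads /mkseq big_map /index_iota subn0.
rewrite -[RHS]big_filter; apply: perm_big; apply: uniq_perm.
- exact: gtn_sorted_uniq (beads_sorted _ ps).
- by rewrite filter_uniq ?iota_uniq.
move=> x; rewrite mem_filter -hb mem_index_iota /=; case xb : (x \in beads N p) => //=.
have := hb x; rewrite xb => /esym h.
have := cC (x %% 7); rewrite ltn_mod => /(_ isT); lia.
Qed.

End BetaSets.

Lemma size_part (p : seq nat) : 0%N \notin p -> (size p <= sumn p)%N.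
Proof.
by elim: p => //= x q IH; rewrite inE negb_or => /andP[x0 /IH]; lia.
Qed.

(** * The vector of a core *)

Section CoreVector.
Variables (n : nat) (p : seq nat).
(* [7 %| N] gives every runner [M] beads in the empty partition, and [N] is even to keep
   the signs of the BG-rank. *)
Let N := (14 * n.+1)%N.
Let M := (2 * n.+1)%N.
Hypotheses (ps : sorted geq p) (sN : (size p <= N)%N).
Hypothesis cl : forall x, x \in beads N p -> (7 <= x)%N -> (x - 7)%N \in beads N p.
Let c := rescount N p.

Lemma sum_part (T : nmodType) (F : nat -> T) : F 0%N = 0%R ->
  (\sum_(i < N) F (nth 0%N p i) = \sum_(x <- p) F x)%R.
Proof.
move=> F0.
rewrite -(big_mkord xpredT (fun i => F (nth 0%N p i))) (@big_cat_nat _ _ _ (size p)) //=.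
rewrite [X in (_ + X)%R](_ : _ = 0%R) ?addr0; last first.
  rewrite big_nat_cond big1 // => i /andP[/andP[h _] _].
  by rewrite nth_default.
by rewrite [RHS](big_nth 0%N).
Qed.

Lemma rescount_sum : (\sum_(r < 7) c r = N)%N.
Proof.
have := @sum_beads _ (fun _ => 1%N) N p ps cl; rewrite sum1_card card_ord => ->.
by apply: eq_bigr => r _; rewrite sum1_card card_ord.
Qed.

Local Open Scope ring_scope.

Lemma rescount_size : (2 * sumn p)%:Z = \sum_(r < 7) (2 * (r : nat)%:Z * ((c r)%:Z - M%:Z)
  + 7 * ((c r)%:Z - M%:Z) ^+ 2).
Proof.
have gauss (m : nat) : \sum_(k < m) (2 * (k : nat)%:Z) = m%:Z * (m%:Z - 1).
  elim: m => [|m IH]; first by rewrite big_ord0 mul0r.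
  by rewrite big_ord_recr /= IH intS; ring.
have := @sum_beads _ (fun x => 2 * x%:Z) N p ps cl.
have -> : \sum_(i < N) 2 * (nth 0%N p i + (N - i.+1))%N%:Z = (2 * sumn p)%:Z + N%:Z * (N%:Z - 1).
  under eq_bigr => i _ do rewrite PoszD mulrDr.
  rewrite big_split /= (@sum_part _ (fun x => 2 * x%:Z)) ?mulr0 // -mulr_sumr.
  rewrite -(big_morph Posz PoszD (erefl 0%:Z)) -sumnE PoszM; congr (_ + _).
  rewrite (reindex_inj rev_ord_inj) /= -gauss; apply: eq_bigr => i _; congr (_ * Posz _).
  by have := ltn_ord i; lia.
have -> : \sum_(r < 7) \sum_(k < rescount N p r) 2 * (r + 7 * k)%N%:Z =
   \sum_(r < 7) (2 * (r : nat)%:Z * (c r)%:Z + 7 * ((c r)%:Z * ((c r)%:Z - 1))).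
  apply: eq_bigr => r _; rewrite -gauss mulr_sumr.
  under eq_bigr => k _ do rewrite PoszD PoszM mulrDr mulrCA.
  rewrite big_split /= sumr_const card_ord; congr (_ + _).
  by rewrite -[_ *+ rescount N p r]mulr_natr (natz (rescount N p r)).
have := rescount_sum => /(congr1 Posz); rewrite (big_morph Posz PoszD (erefl 0%:Z)) /= /N /M.
rewrite !big_ord_recl !big_ord0 /=.
move: (c _) (c _) (c _) (c _) (c _) (c _) (c _) => c0 c1 c2 c3 c4 c5 c6.
rewrite !PoszM !intS /bump /= => /eqP; rewrite -subr_eq0 => /eqP hs /eqP; rewrite -subr_eq0 => /eqP hn.
apply/eqP; rewrite -subr_eq0; apply/eqP.
(* Up to constants, 7 c (c - 1) and 7 (c - M)^2 differ by (14 M - 7) c; the multiplier of the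
   relation that the c sum to N is therefore 14 M - 7 = 28 (n + 1) - 7. *)
rewrite -[RHS](addr0 0) -[X in _ = X + _]hn -[X in _ = _ + X](mulr0 (28 * (1 + n%:Z) - 7)) -hs.
rewrite ?PoszM ?intS; ring.
Qed.

(** The offset 3 is the mean of 0, ..., 6 and makes the sum vanish; the squares of r - 3 sum to the
    constant 28 of the norm. [cvec] relabels the entries so that entry r lies in the class of r. *)
Definition gvec (r : 'I_7) : int := 7 * ((c r)%:Z - M%:Z) + (r : nat)%:Z - 3.
Definition cvec : {ffun 'I_7 -> int} := [ffun r : 'I_7 => gvec ((r : 'Z_7) - (- 3)%:~R)].

Lemma cvec_big (T : Type) (idx : T) (op : Monoid.com_law idx) (F : int -> T) :
  \big[op/idx]_(r < 7) F (cvec r) = \big[op/idx]_(r < 7) F (gvec r).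
Proof.
under eq_bigr do rewrite ffunE.
exact: (vshift_reindex _ (fun r => F (gvec r))).
Qed.

Lemma cvec_resys : resys cvec.
Proof.
move=> r; rewrite ffunE /gvec; set r' : 'Z_7 := _ - _.
have r'E : (r' : nat)%:Z%:~R = r' by rewrite -[_%:~R]/(_%:R) natr_Zp.
rewrite rmorphB rmorphD /= rmorphM /= (_ : 7%:~R = 0 :> 'Z_7) ?mul0r ?add0r; last exact/val_inj.
by rewrite r'E /r' rmorphN /= opprK addrK.
Qed.

Lemma rescount_sumz : \sum_(r < 7) ((c r)%:Z - M%:Z) = 0.
Proof.
rewrite sumrB -(big_morph Posz PoszD (erefl 0%:Z)) rescount_sum sumr_const card_ord.
by rewrite /N /M -mulr_natl !PoszM; ring.
Qed.

Lemma cvec_sum : vsum cvec = 0.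
Proof.
rewrite /vsum (cvec_big _ id) /gvec.
transitivity (7 * (\sum_(r < 7) ((c r)%:Z - M%:Z)) + \sum_(r < 7) ((r : nat)%:Z - 3)).
  by rewrite mulr_sumr -big_split /=; apply: eq_bigr => r _; rewrite addrA.
by rewrite rescount_sumz mulr0 !big_ord_recl big_ord0.
Qed.

Lemma cvec_sqr : vsqr cvec = (14 * sumn p + 28)%N.
Proof.
have h : (vsqr cvec)%:Z = 7 * (2 * sumn p)%:Z + 28.
  rewrite vsqrE (cvec_big _ (fun x => x ^+ 2)) rescount_size.
  transitivity (7 * (\sum_(r < 7) (2 * (r : nat)%:Z * ((c r)%:Z - M%:Z) + 7 * ((c r)%:Z - M%:Z) ^+ 2))
     - 42 * (\sum_(r < 7) ((c r)%:Z - M%:Z)) + \sum_(r < 7) ((r : nat)%:Z - 3) ^+ 2).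
    rewrite !mulr_sumr -sumrB -big_split /=; apply: eq_bigr => r _.
    by rewrite /gvec; ring.
  rewrite rescount_sumz mulr0 subr0; congr (_ + _).
  by rewrite !big_ord_recl big_ord0.
by move: h; lia.
Qed.

(** As N is even, twice the contribution of row i is (-1)^i plus (-1)^x for its bead x, and the
    first signs cancel over all rows. On runner r the signs of the beads alternate, leaving (-1)^r
    if [c r] is odd and 0 otherwise. That equals 1 or 0, as r is even or odd, minus the parity of
    the entry; four of the r are even. *)
Lemma cvec_odd : 2 * BG_rank p = 4 - (vodd cvec)%:Z.
Proof.
have -> : BG_rank p = \sum_(i < N) (-1) ^+ i * (odd (nth 0%N p i))%:Z.
  rewrite /BG_rank (big_ord_widen _ (fun i => (-1) ^+ i * (odd (nth 0%N p i))%:Z) sN).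
  rewrite big_mkcond /=; apply: eq_bigr => i _; case: ltnP => // h.
  by rewrite nth_default // mulr0.
have alt (m : nat) : \sum_(i < m) (-1) ^+ i = (odd m)%:Z :> int.
  elim: m => [|m IH]; first by rewrite big_ord0.
  by rewrite big_ord_recr /= IH -signr_odd; case: (odd m).
have -> : 2 * \sum_(i < N) (-1) ^+ i * (odd (nth 0%N p i))%:Z =
  \sum_(i < N) (-1) ^+ i + \sum_(i < N) (-1) ^+ (nth 0%N p i + (N - i.+1)).
  rewrite mulr_sumr -big_split /=; apply: eq_bigr => i _.
  rewrite -signr_odd -[in X in _ = _ + X]signr_odd.
  have -> : odd (nth 0%N p i + (N - i.+1)) = ~~ (odd (nth 0%N p i) (+) odd i).
    by have := ltn_ord i; rewrite /N; lia.
  by case: (odd i); case: (odd _).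
rewrite alt (_ : odd N = false) ?add0r; last by rewrite /N; lia.
rewrite (@sum_beads _ (fun x => (-1) ^+ x) N p ps cl).
have -> : (vodd cvec)%:Z = \sum_(r < 7) (oddz (gvec r) : nat)%:Z.
  rewrite /vodd (big_morph Posz PoszD (erefl 0%:Z)).
  exact: (cvec_big _ (fun x => (oddz x : nat)%:Z)).
transitivity (\sum_(r < 7) ((~~ odd r : nat)%:Z - (oddz (gvec r) : nat)%:Z)); last first.
  by rewrite sumrB; congr (_ - _); rewrite !big_ord_recl big_ord0.
apply: eq_bigr => r _.
have -> : \sum_(k < rescount N p r) (-1) ^+ (r + 7 * k) = (-1) ^+ r * (odd (rescount N p r))%:Z :> int.
  rewrite -alt mulr_sumr; apply: eq_bigr => k _; rewrite exprD; congr (_ * _).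
  by rewrite -signr_odd oddM /= signr_odd.
rewrite -signr_odd /gvec -/(c r) /oddz /M.
have -> : odd (absz (7 * ((c r)%:Z - (2 * n.+1)%N%:Z) + (r : nat)%:Z - 3)%R) = ~~ (odd (c r) (+) odd r) by lia.
by case: (odd r); case: (odd _).
Qed.
End CoreVector.

(** * Recovering the core from its vector *)

Section BeadsInverse.
Local Open Scope nat_scope.

Lemma nth_filter_pos (l : seq nat) i : sorted geq l ->
  nth 0 [seq x <- l | 0 < x] i = nth 0 l i.
Proof.
elim: l i => //= x l IH i; rewrite (path_sortedE (rev_trans leq_trans)) => /andP[/allP lx ls].
case: (posnP x) => [x0|x0]; last by case: i => //= i; rewrite IH.
have l0 y : y \in l -> y = 0 by move/lx; rewrite /= x0 leqn0 => /eqP.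
rewrite x0 (_ : seq.filter _ l = [::]).
  case: i => //= i; rewrite ?nth_nil; have [il|il] := ltnP i (size l); last by rewrite nth_default.
  by rewrite (l0 _ (mem_nth 0 il)).
by apply/eqP; rewrite -(negbK (_ == _)) -has_filter; apply/hasPn => y /l0 ->.
Qed.

Lemma gtn_sorted_nth (b : seq nat) i : sorted gtn b -> i < size b -> size b - i.+1 <= nth 0 b i.
Proof.
elim: b i => //= x b IH i.
rewrite (path_sortedE (fun a b c h1 h2 => ltn_trans h2 h1)) => /andP[/allP bx bs].
case: i => [|i] ib; last by rewrite subSS IH.
case: b IH bx bs ib => // y b IH bx bs _.
have := IH 0 bs isT; have := bx y; rewrite inE eqxx /= => /(_ isT); lia.
Qed.

Lemma beads_surj (b : seq nat) : sorted gtn b ->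
  exists p, [/\ sorted geq p, 0 \notin p, size p <= size b & beads (size b) p = b].
Proof.
move=> bs; pose l := mkseq (fun i => nth 0 b i - (size b - i.+1)) (size b).
have ls : sorted geq l.
  apply/(sortedP 0) => i; rewrite size_mkseq => ib; rewrite !nth_mkseq //; last by lia.
  have := gtn_sorted_nth bs (ltnW ib); have := gtn_sorted_nth bs ib.
  move/(sortedP 0)/(_ _ ib): bs; rewrite /=; lia.
exists [seq x <- l | 0 < x]; split.
- by apply: sorted_filter ls; exact: rev_trans leq_trans.
- by rewrite mem_filter.
- by rewrite (leq_trans (size_subseq (filter_subseq _ _))) // size_mkseq.
apply: (@eq_from_nth _ 0); first by rewrite size_beads.
move=> i; rewrite size_beads => ib; rewrite nth_beads // nth_filter_pos // nth_mkseq //.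
by rewrite subnK // gtn_sorted_nth.
Qed.

Lemma beads_inj N p p' : 0 \notin p -> 0 \notin p' -> size p <= N -> size p' <= N ->
  beads N p = beads N p' -> p = p'.
Proof.
move=> p0 p0' pN pN' E.
have hn i : i < N -> nth 0 p i = nth 0 p' i.
  by move=> iN; move: (congr1 (nth 0 ^~ i) E); rewrite /= !nth_beads // => /addIn.
have size_le (s t : seq nat) : 0 \notin t -> size t <= N -> 
    (forall i, i < N -> nth 0 s i = nth 0 t i) -> size t <= size s.
  move=> t0 tN h; rewrite leqNgt; apply/negP => st.
  by case/negP: t0; rewrite -(nth_default 0 (leqnn (size s))) h ?mem_nth //; exact: leq_trans st tN.
have pp' : size p = size p'.
  by apply/eqP; rewrite eqn_leq !size_le // => i iN; rewrite hn.
by apply: (@eq_from_nth _ 0) => // i ip; apply: hn; exact: leq_trans ip pN.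
Qed.
End BeadsInverse.

Section CoreBijection.
Local Open Scope ring_scope.
Variable n : nat.
Local Notation N := (14 * n.+1)%N.
Local Notation M := (2 * n.+1)%N.

Lemma cvec_inj (p p' : seq nat) : sorted geq p -> sorted geq p' ->
  0%N \notin p -> 0%N \notin p' -> (size p <= N)%N -> (size p' <= N)%N ->
  is_core 7 p -> is_core 7 p' -> cvec n p = cvec n p' -> p = p'.
Proof.
move=> ps ps' p0 p0' pN pN' /(is_coreP _ ps pN) cl /(is_coreP _ ps' pN') cl' E.
apply: (@beads_inj N) => //.
apply: (irr_sorted_eq (leT := gtn)); rewrite ?beads_sorted //.
- by move=> x y z /= xy yz; apply: ltn_trans xy.
- by move=> x; rewrite /= ltnn.
move=> x; rewrite !core_mem_beads //; try by move=> *; [apply: cl|apply: cl'].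
2-3: by move=> y yb y7; auto.
congr (_ < _)%N.
have x7 : (x %% 7 < 7)%N by rewrite ltn_mod.
pose r : 'I_7 := Ordinal x7.
have : gvec n p r = gvec n p' r.
  have := congr1 (fun f : {ffun 'I_7 -> int} => f ((r : 'Z_7) + (- 3)%:~R)) E.
  by rewrite /cvec !ffunE addrK.
by rewrite /gvec /=; lia.
Qed.

Lemma cvec_surj v : resys v -> vsum v = 0 -> (vsqr v <= 14 * n + 28)%N ->
  exists p, [/\ sorted geq p, 0%N \notin p, (size p <= N)%N, is_core 7 p & cvec n p = v].
Proof.
move=> hv v0 vn.
pose g (r : 'I_7) := v ((r : 'Z_7) + (- 3)%:~R).
have gE r : exists d : int, g r = 7 * d + (r : nat)%:Z - 3.
  have /intr7_eq h : (g r)%:~R = ((r : nat)%:Z - 3)%:~R :> 'Z_7.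
    by rewrite /g hv rmorphB /= rmorphN -[_%:~R]/(_%:R) natr_Zp.
  by exists ((g r - (r : nat)%:Z + 3) %/ 7)%Z; lia.
have sq r : (`|g r| ^ 2 <= 14 * n + 28)%N.
  by apply: leq_trans vn; rewrite /vsqr (bigD1 ((r : 'Z_7) + (- 3)%:~R)) //= leq_addr.
have {gE} [c cE] : exists c : nat -> nat, forall r : 'I_7, g r = 7 * ((c r)%:Z - M%:Z) + (r : nat)%:Z - 3.
  have h r : exists c : nat, g r = 7 * (c%:Z - M%:Z) + (r : nat)%:Z - 3.
    have [d gd] := gE r; exists (absz (d + M%:Z)); have := sq r; have := ltn_ord r.
    rewrite gd => r7 hs.
    (* If d < - M, the entry has absolute value at least 14 n + 18, and its square exceeds the bound
       on the norm. So the N beads suffice for every vector of this norm. *)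
    have : 0 <= d + M%:Z by rewrite -mulnn in hs; nia.
    by lia.
  have [c hc] := choice h.
  by exists (fun k => c (inord k)) => r; rewrite hc inord_val.
have cN : (\sum_(r < 7) c r = N)%N.
  have gs : \sum_(r < 7) g r = 0.
    rewrite -[RHS]v0 /vsum -(vshift_reindex _ (fun r => v r) 3); apply: eq_bigr => r _.
    by rewrite /g rmorphN.
  move: gs; under eq_bigr do rewrite cE.
  rewrite !big_ord_recl !big_ord0 /= /bump /=.
  move: (c _) (c _) (c _) (c _) (c _) (c _) (c _) => *; lia.
have cle r : (r < 7)%N -> (c r <= N)%N.
  by move=> r7; rewrite -cN (bigD1 (Ordinal r7)) //= leq_addr.
pose b := [seq x <- rev (iota 0 (7 * N)) | (x %/ 7 < c (x %% 7))%N].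
have bs : sorted gtn b.
  apply: sorted_filter; first by move=> x y z /= xy yz; apply: ltn_trans xy.
  by rewrite rev_sorted; apply: iota_ltn_sorted.
have bN : size b = N.
  rewrite -cN size_filter count_rev -sum1_count.
  have := @sum_residues _ (fun _ => 1%N) c _ cle; rewrite /index_iota subn0 => ->.
  by apply: eq_bigr => r _; rewrite sum1_card card_ord.
have mb x : (x \in b) = (x %/ 7 < c (x %% 7))%N.
  rewrite mem_filter mem_rev mem_iota /=; case h : (_ < _)%N => //=.
  by have := cle (x %% 7)%N; rewrite ltn_mod => /(_ isT); lia.
have [p [ps p0 pN]] := beads_surj bs; rewrite bN in pN * => pb.
have cl x : x \in beads N p -> (7 <= x)%N -> (x - 7)%N \in beads N p.
  rewrite pb !mb => h x7; have -> : ((x - 7) %% 7 = x %% 7)%N by rewrite -{2}(subnK x7) modnDr.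
  by apply: leq_trans h; lia.
exists p; split=> //; first exact/(is_coreP _ ps pN).
apply/ffunP => r; rewrite ffunE.
set r' : 'I_7 := _ - _; have -> : v r = g r' by rewrite /g /r' subrK.
rewrite cE /gvec (_ : rescount N p r' = c r') //.
have h k : (k < rescount N p r')%N = (k < c r')%N.
  have := core_mem_beads ps cl (k * 7 + r'); rewrite pb mb modnMDl divnMDl //.
  by rewrite modn_small // divn_small // addn0.
by apply/eqP; rewrite eqn_leq leqNgt h ltnn leqNgt -h ltnn.
Qed.

Lemma core_series_coef (j : int) (k : nat) : k%:Z = 4 - 2 * j ->
  core_series k (14 * n + 28)%N = (num_cores 7 j n)%:R :> int.
Proof.
move=> kj; rewrite gsumE /num_cores; set P := [pred s | _].
pose h (s : {bseq n of 'I_n.+1}) := cvec n [seq nat_of_ord x | x <- s].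
have PE s : P s -> let p := [seq nat_of_ord x | x <- s] in
    [/\ sorted geq p, 0%N \notin p, sumn p = n & (size p <= N)%N] /\ is_core 7 p /\ BG_rank p = j.
  move=> /and3P[/and3P[ps p0 /eqP pn] pc /eqP pj] /=; split=> //; split=> //.
  by rewrite (leq_trans (size_part p0)) // pn; lia.
rewrite (reindex_fsbig h [set s | P s]); last first.
  split.
  - move=> s /PE [[ps p0 pn pN] [pc pj]].
    have cl := (is_coreP (isT : 0 < 7)%N ps pN).1 pc.
    split; first split.
    + exact: cvec_resys.
    + exact: cvec_sum.
    + by have := cvec_odd ps pN cl; rewrite pj -/(h s); lia.
    + by rewrite cvec_sqr // pn.
  - move=> s t /set_mem /PE [[ps p0 pn pN] [pc pj]] /set_mem /PE [[ps' p0' pn' pN'] [pc' pj']] E.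
    apply/val_inj; apply: (inj_map (@ord_inj n.+1)).
    exact: cvec_inj E.
  - move=> v /= [[hv v0 vk] vn].
    have vn' : (vsqr v <= 14 * n + 28)%N by rewrite vn.
    have [p [ps p0 pN pc pv]] := cvec_surj hv v0 vn'.
    have cl := (is_coreP (isT : 0 < 7)%N ps pN).1 pc.
    have pn : sumn p = n by have := cvec_sqr ps pN cl; rewrite pv vn; lia.
    have psz : (size p <= n)%N by rewrite -pn size_part.
    have sz : (size [seq inord x : 'I_n.+1 | x <- p] <= n)%N by rewrite size_map.
    have pE : [seq nat_of_ord x | x <- Bseq sz] = p.
      rewrite /= -map_comp -[RHS]map_id; apply/eq_in_map => x xp /=; rewrite inordK //.
      rewrite ltnS -pn; elim: (p) xp => //= y q IH; rewrite inE => /orP[/eqP ->|/IH]; lia.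
    exists (Bseq sz); last by rewrite /h pE.
    rewrite /= pE /is_partition_of ps p0 pn eqxx pc /=.
    by apply/eqP; have := cvec_odd ps pN cl; rewrite pv vk; lia.
have -> : [set s | P s] = [set s | s \in enum P] by apply/seteqP; split=> s; rewrite /= mem_enum.
by rewrite -fsbig_seq ?enum_uniq // big_enum sumr_const.
Qed.
End CoreBijection.

Local Open Scope ring_scope.

(** Modulo 7 each square is that of the least absolute residue, and these sum to 2 (1 + 4 + 9) = 28,
    which is also a lower bound. The norm has the parity of the sum, so the excess is divisible by
    14. *)
Lemma vsqr_core v : resys v -> vsum v = 0%R -> exists n, vsqr v = (14 * n + 28)%N.
Proof.
move=> hv v0.
have h (r : 'I_7) : exists c, (`|v r| ^ 2 = minn r (7 - r) ^ 2 + 7 * c)%N.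
  have /intr7_eq hr : (v r)%:~R = ((r : nat)%:Z)%:~R :> 'Z_7.
    by rewrite hv -[_%:~R]/(_%:R) natr_Zp.
  exists ((`|v r| ^ 2 - minn r (7 - r) ^ 2) %/ 7)%N.
  have r7 := ltn_ord r.
  have vr : (minn r (7 - r) <= `|v r|)%N by lia.
  have hm : (7 %| `|v r| - minn r (7 - r))%N \/ (7 %| `|v r| + minn r (7 - r))%N by lia.
  move: (absz (v r)) (minn _ _) vr hm => a m ma hm.
  have h7 : (7 %| a ^ 2 - m ^ 2)%N.
    by rewrite subn_sqr; case: hm => h; [apply: dvdn_mulr | apply: dvdn_mull]; lia.
  rewrite [(7 * _)%N]mulnC divnK // subnKC //.
  by rewrite leq_exp2r.
have [c hc] := choice h.
have vE : vsqr v = (28 + 7 * \sum_r c r)%N.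
  rewrite /vsqr; under eq_bigr do rewrite hc.
  by rewrite big_split /= -big_distrr /= !big_ord_recl big_ord0.
have : odd (vsqr v) = false.
  transitivity (oddz (vsum v)); last by rewrite v0.
  rewrite /vsqr /vsum; elim/big_rec2: _ => // i y x _ IH.
  by rewrite oddzD oddD IH oddX.
by exists ((\sum_r c r) %/ 2)%N; lia.
Qed.

Lemma core_series_cores (j : int) (k : nat) : (k%:Z = 4 - 2 * j)%R ->
  core_series k = (fXn 28 * dil 14 (Fps (fun n => (num_cores 7 j n)%:R)))%R.
Proof.
move=> kj; apply: fpsP => m; rewrite fcoefXnM.
have [[n ->]|hm] := pselect (exists n, m = (14 * n + 28)%N).
  by rewrite (core_series_coef _ kj) leq_addl addnK dilE dvdn_mulr // mulKn.
rewrite gsumE fsbig1 => [|v [[hv v0 _] vm]]; last first.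
  by case: hm; have [n vn] := vsqr_core hv v0; exists n; rewrite -vm.
case: leqP => // m28; rewrite dilE; case: ifP => // /dvdnP[n hn].
by case: hm; exists n; lia.
Qed.

(** * Absolutely convergent power series *)

Local Open Scope complex_scope.

Lemma seriesE (V : zmodType) (a : nat -> V) N : series a N = \sum_(n < N) a n.
Proof. by rewrite /series /= big_mkord. Qed.

Lemma cvgM_near (K : numFieldType) (u v w : nat -> K) (l l' : K) : u @ \oo --> l -> v @ \oo --> l' ->
  (forall e : K, 0 < e -> exists N, forall n, (N <= n)%N -> `|u n * v n - w n| < e) ->
  w @ \oo --> l * l'.
Proof.
move=> hu hv h.
have hp : u \* v @ \oo --> l * l' by apply: cvgM; [exact: hu|exact: hv].
have h0 : u \* v \- w @ \oo --> (0 : K).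
  apply/cvgrPdist_lt => e /h[N hN]; exists N => // n /= /hN.
  by rewrite sub0r normrN.
rewrite (_ : w = u \* v \- (u \* v \- w)); last by apply/funext => n; rewrite /= subKr.
by rewrite -[l * l']subr0; apply: cvgB; [exact: hp|exact: h0].
Qed.

Lemma has_sum_lim (K : numFieldType) (a : nat -> K) (l : K) : has_sum a l -> limn (series a) = l.
Proof. by move=> ha; apply: cvg_lim; [exact: norm_hausdorff|exact: ha]. Qed.

Lemma limn_unique (K : numFieldType) (u : nat -> K) (l : K) :
  (forall e : K, 0 < e -> exists N, forall n, (N <= n)%N -> `|l - u n| < e) -> limn u = l.
Proof.
move=> h; apply: cvg_lim; first exact: norm_hausdorff.
by apply/cvgrPdist_lt => e /h[N hN]; exists N => // n /= /hN.
Qed.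

Lemma normc_real (R : rcfType) (t : R) : `|t%:C| = `|t|%:C.
Proof. by rewrite normc_def /= expr0n /= addr0 sqrtr_sqr. Qed.

Section AbsSummable.
Variable R : realType.
Local Notation K := R[i].
Implicit Types (a b : nat -> K) (l M : K).

(** The empty sum gives 0 <= M in the partial order of the complex numbers, so [M] is automatically
    real. *)
Definition norm_sum_le a M : Prop := forall N, \sum_(n < N) `|a n| <= M.
Definition abs_summable a : Prop := exists M, norm_sum_le a M.

Lemma has_sum_unique a l l' : has_sum a l -> has_sum a l' -> l = l'.
Proof. exact: (@cvg_unique K^o (@norm_hausdorff _ K^o)). Qed.

Lemma has_sumP a l : has_sum a l <->
  forall e : R, 0 < e -> exists N, forall n, (N <= n)%N -> `|l - series a n| < e%:C.
Proof.
split=> [h e e0|h].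
  have /cvgrPdist_lt /(_ e%:C) := h; rewrite ltcR => /(_ e0) [N _ hN].
  by exists N => n Nn; apply: hN.
apply/(@cvgrPdist_lt K K^o) => e e0.
have eE : (complex.Re e)%:C = e by apply: RRe_real; rewrite realE (ltW e0).
have [|N hN] := h (complex.Re e); first by rewrite -ltcR eE.
by exists N => // n /= /hN; rewrite eE.
Qed.

(** Real and imaginary parts are dominated by the absolute values, so each converges by completeness
    of the reals. *)
Lemma abs_summable_has_sum a : abs_summable a -> exists l, has_sum a l.
Proof.
move=> [M hM].
have cv (u : nat -> R) : (forall n, `|u n|%:C <= `|a n|) -> cvgn (series u).
  move=> ua; apply: normed_cvg; apply: nondecreasing_is_cvgn.
    by apply/nondecreasing_series => n _ _ /=.
  exists (complex.Re M) => _ [n _ <-]; rewrite -lecR.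
  have Mr : M \is Num.real by rewrite realE (le_trans _ (hM 0%N)) // big_ord0.
  rewrite (RRe_real Mr); apply: le_trans (hM n).
  rewrite /= /normed_series_of seriesE rmorph_sum.
  by apply: ler_sum => i _; apply: ua.
have cRe := cv _ (fun n => normc_ge_Re (a n)).
have cIm : cvgn (series (fun n => complex.Im (a n))).
  apply: cv => n; case: (a n) => x y; by rewrite /=; simpc; rewrite /= -sqrtr_sqr ler_wsqrtr // lerDr sqr_ge0.
have [x hx] := (cvg_ex _).1 cRe; have [y hy] := (cvg_ex _).1 cIm.
exists (x +i* y)%C; apply/has_sumP => e e0.
have e2 : 0 < e / 2 by rewrite divr_gt0.
have /cvgrPdist_lt /(_ _ e2) [N1 _ h1] := hx.
have /cvgrPdist_lt /(_ _ e2) [N2 _ h2] := hy.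
exists (maxn N1 N2) => n; rewrite geq_max => /andP[/h1 {}h1 /h2 {}h2].
have sE : series a n = (series (fun n => complex.Re (a n)) n)%:C + 'i%C * (series (fun n => complex.Im (a n)) n)%:C.
  rewrite !seriesE !rmorph_sum mulr_sumr -big_split /=.
  by apply: eq_bigr => i _; rewrite -complexE.
rewrite sE [(x +i* y)%C]complexE /= opprD addrACA -mulrBr -!rmorphB /=.
apply: le_lt_trans (ler_normD _ _) _; rewrite normrM.
have -> : `|'i%C| = 1 :> K by rewrite normc_def /= expr0n expr1n add0r sqrtr1.
rewrite mul1r !normc_real -rmorphD ltcR [e]splitr; exact: ltrD.
Qed.

Lemma norm_sum_leD a b M M' :
  norm_sum_le a M -> norm_sum_le b M' -> norm_sum_le (fun n => a n + b n) (M + M').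
Proof.
move=> hM hM' N; apply: le_trans (lerD (hM N) (hM' N)).
by rewrite -big_split; apply: ler_sum => i _; apply: ler_normD.
Qed.

Lemma has_sumD a b l l' : has_sum a l -> has_sum b l' -> has_sum (fun n => a n + b n) (l + l').
Proof.
move=> ha hb; rewrite /has_sum (_ : series _ = series a \+ series b); last first.
  by apply/funext => n; rewrite /= !seriesE big_split.
by apply: cvgD; [exact: ha|exact: hb].
Qed.

(** This removes zeros interspersed in a series: a partial sum of [b] is a later partial sum of
    [a]. *)
Lemma has_sum_sub a b l : has_sum a l ->
  (forall n, exists2 m, (n <= m)%N & series b n = series a m) -> has_sum b l.
Proof.
move=> /has_sumP ha hs; apply/has_sumP => e /ha[N hN]; exists N => n Nn.
by have [m nm ->] := hs n; apply: hN; apply: leq_trans nm.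
Qed.

Lemma sum_single (V : nmodType) (a : nat -> V) k N : (forall n, n <> k -> a n = 0) ->
  \sum_(n < N) a n = if (k < N)%N then a k else 0.
Proof.
move=> h; case: ltnP => kN.
  rewrite (bigD1 (Ordinal kN)) //= big1 ?addr0 // => i.
  by rewrite -val_eqE /= => /eqP /h.
by rewrite big1 // => i _; apply: h; have := ltn_ord i; lia.
Qed.

Lemma has_sum_single a k : (forall n, n <> k -> a n = 0) -> has_sum a (a k).
Proof.
move=> h; apply/has_sumP => e e0; exists k.+1 => n kn.
by rewrite seriesE (sum_single _ h) kn subrr normr0 ltcR.
Qed.

Lemma norm_sum_le_single a k : (forall n, n <> k -> a n = 0) -> norm_sum_le a `|a k|.
Proof.
move=> h N; rewrite (@sum_single _ (fun n => `|a n|) k); first by case: ifP.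
by move=> n /h ->; rewrite normr0.
Qed.

Lemma has_sum_ler a l M : has_sum a l -> norm_sum_le a M -> `|l| <= M.
Proof.
move=> ha haM; have hM N : `|\sum_(n < N) a n| <= M by apply: le_trans (haM N); apply: ler_norm_sum.
have Mr : M \is Num.real by rewrite realE (le_trans _ (hM 0%N)).
rewrite real_leNgt //; apply/negP => Ml.
have eE : (complex.Re (`|l| - M))%:C = `|l| - M by apply: RRe_real; rewrite realB ?normr_real.
have [|N /(_ N (leqnn N))] := (has_sumP _ _).1 ha (complex.Re (`|l| - M)).
  by rewrite -ltcR eE subr_gt0.
rewrite eE seriesE ltrBrDr => h.
have := le_lt_trans (ler_normD (l - \sum_(n < N) a n) (\sum_(n < N) a n)).
by rewrite subrK => /(_ _ (le_lt_trans (lerD (lexx _) (hM N)) h)); rewrite ltxx.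
Qed.

Lemma fpsM_partial (f g : fps K) N :
  \sum_(n < N) (f * g) n = \sum_(i < N) \sum_(j < N | (i + j < N)%N) f i * g j.
Proof.
transitivity (\sum_(n < N) \sum_(i < N) \sum_(j < N) (if (i + j == n)%N then f i * g j else 0)).
  apply: eq_bigr => n _; rewrite fcoefM.
  rewrite (big_ord_widen N (fun i => f i * g (n - i)%N)) ?ltn_ord // big_mkcond; apply: eq_bigr => i _.
  rewrite -big_mkcond /=; case: ltnP => h.
    have ni : (n - i < N)%N by have := ltn_ord n; lia.
    by rewrite (big_pred1 (Ordinal ni)) // => j; rewrite /= -val_eqE /=; apply/eqP/eqP; lia.
  by rewrite big1 // => j /eqP; lia.
rewrite exchange_big; apply: eq_bigr => i _; rewrite exchange_big [RHS]big_mkcond.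
apply: eq_bigr => j _; rewrite -big_mkcond /=; case: ltnP => h.
  by rewrite (big_pred1 (Ordinal h)) // => n; rewrite /= -val_eqE /= eq_sym.
by rewrite big1 // => n /eqP; have := ltn_ord n; lia.
Qed.

Definition fnorm (f : fps K) : fps K := Fps (fun n => `|f n|).

Lemma fnorm_ge0 f n : 0 <= fnorm f n. Proof. exact: normr_ge0. Qed.

Lemma fnormM_ge0 f g n : 0 <= (fnorm f * fnorm g) n.
Proof. by rewrite fcoefM sumr_ge0 // => i _; apply: mulr_ge0; apply: fnorm_ge0. Qed.

Lemma sum_square (f g : fps K) N :
  (\sum_(i < N) f i) * (\sum_(j < N) g j) = \sum_(i < N) \sum_(j < N) f i * g j.
Proof. by rewrite mulr_suml; apply: eq_bigr => i _; rewrite mulr_sumr. Qed.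

Lemma sum_square_diff (f g : fps K) N :
  (\sum_(i < N) f i) * (\sum_(j < N) g j) - \sum_(n < N) (f * g) n =
  \sum_(i < N) \sum_(j < N | (N <= i + j)%N) f i * g j.
Proof.
rewrite sum_square fpsM_partial -sumrB; apply: eq_bigr => i _.
rewrite (bigID (fun j : 'I_N => i + j < N)%N) /= addrAC subrr add0r.
by apply: eq_bigl => j; rewrite -leqNgt.
Qed.

Lemma fnormM_le (f g : fps K) n : `|(f * g) n| <= (fnorm f * fnorm g) n.
Proof.
rewrite !fcoefM; apply: le_trans (ler_norm_sum _ _ _) _.
by apply: ler_sum => i _; rewrite normrM.
Qed.

Lemma fnormM_partial (f g : fps K) N : \sum_(n < N) (fnorm f * fnorm g) n <=
  (\sum_(i < N) fnorm f i) * (\sum_(j < N) fnorm g j).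
Proof.
rewrite -subr_ge0 sum_square_diff; apply: sumr_ge0 => i _; apply: sumr_ge0 => j _.
by apply: mulr_ge0; apply: fnorm_ge0.
Qed.

Lemma fnormM_partial2 (f g : fps K) N :
  (\sum_(i < N) fnorm f i) * (\sum_(j < N) fnorm g j) <= \sum_(n < N + N) (fnorm f * fnorm g) n.
Proof.
have fg0 i j : 0 <= fnorm f i * fnorm g j by apply: mulr_ge0; apply: fnorm_ge0.
rewrite sum_square fpsM_partial big_split_ord /= ler_wpDr //.
  by apply: sumr_ge0 => i _; apply: sumr_ge0 => j _; apply: fg0.
apply: ler_sum => i _; rewrite [leRHS]big_mkcond big_split_ord /= ler_wpDr //.
  by apply: sumr_ge0 => j _; case: ifP => // _; apply: fg0.
by apply: ler_sum => j _; case: ifP => // /negP[]; rewrite -addnS leq_add // ltnW.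
Qed.

(** The discrepancy lives on the part of the square where i + j >= N, and the square lies in the
    triangle i + j < 2 N. For the Cauchy product of the absolute values this is a block of
    consecutive terms of a convergent series, hence small. *)
Lemma fpsM_diff (f g : fps K) N :
  `|(\sum_(i < N) f i) * (\sum_(j < N) g j) - \sum_(n < N) (f * g) n| <=
  \sum_(n < N + N) (fnorm f * fnorm g) n - \sum_(n < N) (fnorm f * fnorm g) n.
Proof.
rewrite sum_square_diff; apply: le_trans (lerB (fnormM_partial2 f g N) (lexx _)).
rewrite sum_square_diff; apply: le_trans (ler_norm_sum _ _ _) _; apply: ler_sum => i _.
by apply: le_trans (ler_norm_sum _ _ _) _; apply: ler_sum => j _; rewrite normrM.
Qed.

Lemma norm_sum_leM (f g : fps K) M M' :
  norm_sum_le f M -> norm_sum_le g M' -> norm_sum_le (f * g) (M * M').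
Proof.
move=> hM hM' N; apply: le_trans (_ : \sum_(n < N) (fnorm f * fnorm g) n <= _).
  by apply: ler_sum => i _; apply: fnormM_le.
apply: le_trans (fnormM_partial f g N) _.
by apply: ler_pM; [| |exact: hM|exact: hM']; apply: sumr_ge0 => i _; apply: fnorm_ge0.
Qed.

Lemma has_sumM (f g : fps K) l l' : abs_summable f -> abs_summable g ->
  has_sum f l -> has_sum g l' -> has_sum (f * g) (l * l').
Proof.
move=> sf sg hf hg.
have sfg : abs_summable (fnorm f * fnorm g).
  case: sf sg => M hM [M' hM']; exists (M * M'); apply: norm_sum_leM => N.
    by apply: le_trans (hM N); apply: ler_sum => i _; rewrite normr_id.
  by apply: le_trans (hM' N); apply: ler_sum => i _; rewrite normr_id.
have [L hL] := abs_summable_has_sum sfg.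
apply: (cvgM_near hf hg) => e e0.
have eE : (complex.Re e)%:C = e by apply: RRe_real; rewrite realE (ltW e0).
have e2 : 0 < complex.Re e / 2 by rewrite divr_gt0 // -ltcR eE.
have [N hN] := (has_sumP _ _).1 hL _ e2.
exists N => n Nn; rewrite !seriesE; apply: le_lt_trans (fpsM_diff f g n) _.
have h1 := hN n Nn; have h2 := hN (n + n)%N (leq_trans Nn (leq_addr _ _)).
apply: le_lt_trans (real_ler_norm _) _.
  by rewrite realB // realE sumr_ge0 // => i _; apply: fnormM_ge0.
rewrite -!seriesE -(subrKA L) addrC; apply: le_lt_trans (ler_normD _ _) _.
by rewrite -eE [complex.Re e]splitr rmorphD; apply: ltrD; [exact: h1|rewrite distrC].
Qed.

End AbsSummable.

(** * Values of integral series at a complex number *)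

Section Evaluation.
Variable R : realType.
Local Notation K := R[i].
Implicit Types (q v w : K) (f g : fps int).

Definition fscale q f : fps K := Fps (fun n => (f n)%:~R * q ^+ n).

Lemma fscaleD q f g : fscale q (f + g) = (fun n => fscale q f n + fscale q g n) :> (nat -> K).
Proof.
by apply/funext => n; rewrite -[LHS]/(((f + g) n)%:~R * _) fcoefD rmorphD mulrDl.
Qed.

Lemma fscaleM q f g : fscale q (f * g) = fscale q f * fscale q g.
Proof.
apply: fpsP => n; rewrite [RHS]fcoefM -[LHS]/(((f * g) n)%:~R * _) fcoefM rmorph_sum mulr_suml; apply: eq_bigr => i _.
rewrite rmorphM mulrACA -exprD subnKC // -ltnS; exact: ltn_ord.
Qed.

(** Absolute summability travels with the value because the rule for products requires it. *)
Definition fval q f v : Prop := abs_summable (fscale q f) /\ has_sum (fscale q f) v.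

Lemma fvalD q f g v w : fval q f v -> fval q g w -> fval q (f + g) (v + w).
Proof.
move=> [[M sf] hf] [[M' sg] hg]; split; last by rewrite fscaleD; apply: has_sumD.
by exists (M + M'); rewrite fscaleD; apply: norm_sum_leD.
Qed.

Lemma fvalM q f g v w : fval q f v -> fval q g w -> fval q (f * g) (v * w).
Proof.
move=> [sf hf] [sg hg]; split; last by rewrite fscaleM; apply: has_sumM.
by case: sf sg => M hM [M' hM']; exists (M * M'); rewrite fscaleM; apply: norm_sum_leM.
Qed.

Lemma fscale_monom q c k n : n <> k -> fscale q (fconst c * fXn k) n = 0.
Proof.
move=> nk; rewrite -[LHS]/(((fconst c * fXn k) n)%:~R * _) [fconst c * _]mulrC fcoefXnM.
by case: leqP => [|kn]; rewrite ?mul0r //; case E : (n - k)%N => [|j]; rewrite ?mul0r //; lia.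
Qed.

Lemma fscale_monomE q c k : fscale q (fconst c * fXn k) k = c%:~R * q ^+ k.
Proof. by rewrite -[LHS]/(((fconst c * fXn k) k)%:~R * _) [fconst c * _]mulrC fcoefXnM leqnn subnn. Qed.

Lemma fval_monom q c k : fval q (fconst c * fXn k) (c%:~R * q ^+ k).
Proof.
rewrite -fscale_monomE; have h := @fscale_monom q c k; split; last exact: has_sum_single.
by eexists; apply: norm_sum_le_single h.
Qed.

Lemma fvalB q f g v w : fval q f v -> fval q g w -> fval q (f - g) (v - w).
Proof.
move=> hf hg; apply: fvalD; first exact: hf.
rewrite -[- g]mulN1r -[- w]mulN1r; apply: fvalM; last exact: hg.
have := fval_monom q (-1) 0; rewrite fXn0 !mulr1; congr (fval q _ _).
by apply: fpsP => -[|n] /=; rewrite ?oppr0.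
Qed.

Lemma fval_Xn q k : fval q (fXn k) (q ^+ k).
Proof. by have := fval_monom q 1 k; rewrite !mul1r. Qed.

Lemma fval1 q : fval q 1 1.
Proof. by rewrite -fXn0 -[X in fval _ _ X](expr0 q); apply: fval_Xn. Qed.

Lemma fvalX q f v k : fval q f v -> fval q (f ^+ k) (v ^+ k).
Proof.
move=> hf; elim: k => [|k IH]; first exact: fval1.
by rewrite !exprS; apply: fvalM.
Qed.

Lemma fval_nat q k : fval q k.+1%:R k.+1%:R.
Proof. by elim: k => [|k IH]; [exact: fval1|rewrite -addn1 !natrD; apply: fvalD (fval1 q)]. Qed.

Lemma fval_unique q f v w : fval q f v -> fval q f w -> v = w.
Proof. by move=> [_ h] [_]; apply: has_sum_unique. Qed.

Lemma fval_exists q f M : norm_sum_le (fscale q f) M -> exists v, fval q f v.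
Proof. by move=> hM; have [|v hv] := @abs_summable_has_sum _ (fscale q f); [exists M|exists v;
  split=> //; exists M]. Qed.

Lemma fval_dil q d f v : (0 < d)%N -> fval (q ^+ d) f v -> fval q (dil d f) v.
Proof.
move=> d0 [[M hM] hv].
have dE n : fscale q (dil d f) n = if (d %| n)%N then fscale (q ^+ d) f (n %/ d)%N else 0.
  rewrite -[LHS]/((dil d f n)%:~R * _) dilE; case: ifP => dn; last by rewrite mul0r.
  by rewrite -[RHS]/((f (n %/ d)%N)%:~R * (q ^+ d) ^+ (n %/ d)) -exprM mulnC divnK.
have hM' : norm_sum_le (fscale q (dil d f)) M.
  move=> N; apply: le_trans (hM N.+1).
  rewrite -(@dil_sum _ d N (fun n => `|fscale (q ^+ d) f n|) d0).
  have Nd : (N <= (d * N).+1)%N by nia.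
  rewrite -[in leRHS](subnKC Nd) big_split_ord /= ler_wpDr //.
    by apply: sumr_ge0 => i _; case: ifP.
  by apply: ler_sum => i _; rewrite [X in `|X| <= _]dE; case: ifP => // _; rewrite normr0.
have [w hw] := fval_exists hM'; split; first by exists M.
suff -> : v = w by case: hw.
apply/(has_sum_unique hv)/(has_sum_sub hw.2) => -[|n]; first by exists 0%N; rewrite // !seriesE !big_ord0.
exists (d * n).+1; first by nia.
rewrite !seriesE -(@dil_sum _ d n (fscale (q ^+ d) f) d0).
by apply: eq_bigr => i _; rewrite [RHS]dE.
Qed.

End Evaluation.

Lemma geometric_sum_le (K : numFieldType) (r : K) N : 0 <= r -> r < 1 ->
  \sum_(n < N) r ^+ n <= (1 - r)^-1.
Proof.
move=> r0 r1; have r1' : 0 < 1 - r by rewrite subr_gt0.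
rewrite -[leRHS]mulr1 ler_pdivlMl // -opprB mulNr -subrX1 opprB lerBlDr lerDl.
exact: exprn_ge0.
Qed.

(** * Values of the theta series *)

Section ThetaValues.
Variable R : realType.
Local Notation K := R[i].
Variable q : K.
Hypothesis hq : `|q| < 1.

Lemma sparse_incr (e : nat -> nat) : (forall n, e n < e n.+1)%N -> forall m n, (m < n)%N -> (e m < e n)%N.
Proof.
move=> he m n; elim: n => // n IH; rewrite ltnS leq_eqVlt => /orP[/eqP ->//|/IH h].
exact: ltn_trans h (he n).
Qed.

(** Distinct exponents make every coefficient 0 or 1, so a geometric series dominates. The sum over
    n is the power series with its zero terms left out. *)
Lemma fval_sparse (e : nat -> nat) : (forall n, e n < e n.+1)%N ->
  exists2 v, fval q (gsum setT e (fun _ => 1)) v & has_sum (fun n => q ^+ e n) v.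
Proof.
move=> he; set F := gsum _ _ _.
have inj m n : e m = e n -> m = n.
  by move=> E; have := @sparse_incr e he m n; have := @sparse_incr e he n m; rewrite E ltnn; lia.
have Fe n : F (e n) = 1.
  rewrite gsumE (_ : [set i | _] = [set n]) ?fsbig_set1 //.
  by apply/seteqP; split=> i /=; [case=> _ /inj | move=> ->].
have F0 k : (forall n, e n <> k) -> F k = 0.
  by move=> h; rewrite gsumE fsbig1 // => i [_ /h].
have hM : norm_sum_le (fscale q F) (1 - `|q|)^-1.
  move=> N; apply: le_trans (geometric_sum_le N (normr_ge0 q) hq); apply: ler_sum => k _.
  rewrite -[fscale q F k]/((F k)%:~R * _) normrM normrX.
  have [[n <-]|h] := pselect (exists n, e n = k); first by rewrite Fe normr1 mul1r.
  by rewrite F0 ?normr0 ?mul0r ?exprn_ge0 // => n nk; apply: h; exists n.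
have [v hv] := fval_exists hM; exists v => //; apply: has_sum_sub hv.2 _ => N.
exists (e N); first by elim: N => // N IH; apply: leq_ltn_trans IH (he N).
rewrite /series /=.
elim: N => [|N IH].
  rewrite big_geq // big_nat big1 // => k /andP[_ k0].
  rewrite -[LHS]/((F k)%:~R * _) F0 ?mul0r // => n nk; case: n nk => [|n] nk; first by lia.
  by have := @sparse_incr e he 0 n.+1 isT; lia.
rewrite big_nat_recr //= IH (@big_cat_nat _ _ _ (e N) 0 (e N.+1)) //=; last exact: ltnW.
congr (_ + _); rewrite big_ltn // -[X in _ = X + _]/((F (e N))%:~R * _) Fe mul1r.
rewrite big_nat big1 ?addr0 // => k /andP[k1 k2].
rewrite -[LHS]/((F k)%:~R * _) F0 ?mul0r // => n nk.
have [h|h|h] := ltngtP n N; last by subst n; lia.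
  by have := sparse_incr he h; lia.
have [nN|nN] := eqVneq n N.+1; first by subst n; lia.
have h' : (N.+1 < n)%N by lia.
by have := sparse_incr he h'; lia.
Qed.

(** The formal series splits like the bilateral sum, at the negative integers, and on each half the
    exponents increase strictly. [d] is the integer exponent of the definition and [g] the same
    exponent as a natural number. *)
Lemma bilateral_value (f : fps int) (g : int -> nat) (d : int -> int) :
  f = gsum setT g (fun _ => 1) -> locfin setT g ->
  (forall i, d i = (g i)%:Z) ->
  (forall n : nat, g n < g n.+1)%N -> (forall n : nat, g (- n.+1%:Z) < g (- n.+2%:Z))%N ->
  fval q f (bilateral_sum (fun n : int => q ^ d n)).
Proof.
move=> -> lg dE g1 g2.
have -> : gsum setT g (fun _ => 1) = gsum setT (fun n : nat => g n) (fun _ => 1) +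
    gsum setT (fun n : nat => g (- n.+1%:Z)) (fun _ => 1) :> fps int.
  rewrite -(@gsum_reindex _ _ _ Posz setT [set i | 0 <= i] (fun n : nat => g n) g (fun _ => 1) (fun _ => 1)) //.
  rewrite -(@gsum_reindex _ _ _ (fun n : nat => - n.+1%:Z) setT [set i | i < 0]
              (fun n : nat => g (- n.+1%:Z)) g (fun _ => 1) (fun _ => 1)) //; last first.
    split=> [n _|m n _ _|i i0] /=; [lia|lia|].
    by exists (absz i).-1 => //; move: i0 => /=; lia.
  rewrite -gsumU; first last.
  - by move=> i /=; lia.
  - exact: locfin_sub lg.
  - exact: locfin_sub lg.
  - by congr (gsum _ _ _); apply/seteqP; split=> i //= _; lia.
  - split=> [n _|m n _ _|i i0] /=; [lia|lia|].
    by exists (absz i) => //; move: i0 => /=; lia.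
have [v hv hv'] := fval_sparse g1; have [w hw hw'] := fval_sparse g2.
rewrite /bilateral_sum.
have -> : (fun n : nat => q ^ d n%:Z) = (fun n : nat => q ^+ g n%:Z).
  by apply/funext => n; rewrite dE.
have -> : (fun n : nat => q ^ d (- n.+1%:Z)) = (fun n : nat => q ^+ g (- n.+1%:Z)).
  by apply/funext => n; rewrite dE.
by rewrite (has_sum_lim hv') (has_sum_lim hw'); apply: fvalD.
Qed.

Lemma fval_phi : fval q fphi (varphi q).
Proof.
apply: (@bilateral_value _ (fun i => `|i| ^ 2)%N) => // [|i|n|n].
- exact: locfin_sqr.
- by rewrite -mulnn PoszM abszE -expr2 real_normK ?num_real.
- by rewrite -!mulnn; nia.
- by rewrite -!mulnn; nia.
Qed.

Lemma fval_psi : fval q fpsi (psi q).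
Proof.
apply: (@bilateral_value _ (fun i => absz (2 * i ^+ 2 - i)%R)) => // [|i|n|n].
- by apply: (@locfin_int _ _ 0) => i; nia.
- by rewrite gez0_abs //; nia.
- by nia.
- by nia.
Qed.
End ThetaValues.

(** * Value and nonvanishing of the Euler product *)

Lemma prod_expR_le (R : realType) (r : R) N : 0 <= r -> r < 1 ->
  \prod_(1 <= k < N.+1) (1 + r ^+ k) <= expR (1 - r)^-1.
Proof.
move=> r0 r1; apply: le_trans (_ : expR (\sum_(1 <= k < N.+1) r ^+ k) <= _).
  rewrite expR_sum; apply: ler_prod => k _.
  by rewrite expR_ge1Dx addr_ge0 ?exprn_ge0.
rewrite ler_expR (le_trans _ (geometric_sum_le N.+1 r0 r1)) //.
by rewrite -(big_mkord xpredT (fun n => r ^+ n)) big_ltn // lerDr.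
Qed.

(** For t = r^k, 1 / (1 - t) = 1 + t / (1 - t) <= exp(t / (1 - t)), and 1 - t >= 1 - r makes the
    exponents summable. *)
Lemma prod_expR_ge (R : realType) (r : R) N : 0 <= r -> r < 1 ->
  expR (- (1 - r)^-1 ^+ 2) <= \prod_(1 <= k < N.+1) (1 - r ^+ k).
Proof.
move=> r0 r1; have r1' : 0 < 1 - r by rewrite subr_gt0.
apply: le_trans (_ : _ <= expR (\sum_(1 <= k < N.+1) - (r ^+ k / (1 - r)))) _.
  rewrite ler_expR sumrN lerN2 -mulr_suml expr2 ler_pM2r ?invr_gt0 //.
  apply: le_trans (geometric_sum_le N.+1 r0 r1).
  by rewrite -(big_mkord xpredT (fun n => r ^+ n)) big_ltn // lerDr.
rewrite expR_sum !big_nat; apply: ler_prod => k /andP[k1 _].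
have kr : r ^+ k <= r by rewrite -[leRHS]expr1 ler_wiXn2l // ltW.
have k0 : 0 < 1 - r ^+ k by rewrite subr_gt0 (le_lt_trans kr).
rewrite expR_ge0 expRN -[leRHS]invrK lef_pV2 ?posrE ?invr_gt0 ?expR_gt0 //=.
apply: le_trans (expR_ge1Dx _).
rewrite [leLHS](_ : _ = 1 + r ^+ k / (1 - r ^+ k)); last by field; rewrite gt_eqF.
by rewrite lerD2l ler_wpM2l ?exprn_ge0 // lef_pV2 ?posrE // lerD2l lerN2.
Qed.

Section EulerValue.
Variable R : realType.
Local Notation K := R[i].
Variable q : K.
Hypothesis hq : `|q| < 1.

Let r : R := complex.Re `|q|.
Let rE : r%:C = `|q|. Proof. by apply: RRe_real; apply: normr_real. Qed.
Let r0 : 0 <= r. Proof. by rewrite -lecR rE; exact: normr_ge0. Qed.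
Let r1 : r < 1. Proof. by rewrite -ltcR rE; exact: hq. Qed.
Let B : K := (expR (1 - r)^-1)%:C.

Lemma fppST c N : fpp c predT N.+1 = fpp c predT N * (1 + fconst c * fXn N.+1).
Proof. exact: fppS. Qed.

Lemma fval_fpp c N : fval q (fpp c predT N) (\prod_(1 <= k < N.+1) (1 + c%:~R * q ^+ k)).
Proof.
elim: N => [|N IH]; first by rewrite /fpp !big_geq //; apply: fval1.
rewrite fppST big_nat_recr; last by [].
apply: fvalM; first exact: IH.
by apply: fvalD; [exact: fval1 | exact: fval_monom].
Qed.

Lemma norm_sum_le_monom c k : `|c| <= 1 -> norm_sum_le (fscale q (fconst c * fXn k)) (`|q| ^+ k).
Proof.
move=> c1 N; apply: le_trans (norm_sum_le_single (@fscale_monom _ q c k) N) _.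
rewrite fscale_monomE normrM normrX ler_piMl ?exprn_ge0 //.
by rewrite -intr_norm -[1]/(1%:~R) ler_int.
Qed.

Lemma norm_sum_le1 : norm_sum_le (fscale q 1) 1.
Proof. by have := @norm_sum_le_monom 1 0; rewrite fXn0 mulr1 => /(_ isT). Qed.

(** The bound is uniform in N, so it passes to the infinite product, each of whose coefficients is
    one of a finite product. *)
Lemma norm_sum_le_fpp c N : `|c| <= 1 -> norm_sum_le (fscale q (fpp c predT N)) B.
Proof.
move=> c1; have h : norm_sum_le (fscale q (fpp c predT N)) (\prod_(1 <= k < N.+1) (1 + `|q| ^+ k)).
  elim: N => [|N IH]; first by rewrite /fpp !big_geq //; apply: norm_sum_le1.
  rewrite fppST big_nat_recr // fscaleM; apply: norm_sum_leM; first exact: IH.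
  by rewrite fscaleD; apply: norm_sum_leD; [exact: norm_sum_le1 | exact: norm_sum_le_monom].
move=> n; apply: le_trans (h n) _.
under eq_bigr do rewrite -rE -rmorphXn -[1]/(1%:C) -rmorphD.
by rewrite -rmorph_prod lecR prod_expR_le.
Qed.

Lemma norm_sum_le_fprod c : `|c| <= 1 -> norm_sum_le (fscale q (fprod c predT)) B.
Proof.
move=> c1 N; apply: le_trans (norm_sum_le_fpp N c1 N); apply: ler_sum => n _.
have nN : (n < N.+1)%N by apply: leqW; apply: ltn_ord.
rewrite -[fscale q (fprod _ _) n]/((fprod c predT n)%:~R * _) -(@fppP c predT N n nN).
exact: lexx.
Qed.

Lemma fval_dist : exists D, fval q fdist D.
Proof. by apply: fval_exists; apply: norm_sum_le_fprod. Qed.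

Lemma norm_sum_le_tail N j : norm_sum_le (fscale q (fpp (-1) predT (N + j) - fpp (-1) predT N))
  (B * \sum_(i < j) `|q| ^+ (N + i).+1).
Proof.
elim: j => [|j IH].
  rewrite addn0 subrr big_ord0 mulr0 => m.
  rewrite big1 // => n _.
  by rewrite -[fscale q 0 n]/(((0 : fps int) n)%:~R * _) mul0r normr0.
have -> : fpp (-1) predT (N + j.+1) - fpp (-1) predT N =
    (fpp (-1) predT (N + j) - fpp (-1) predT N) + fpp (-1) predT (N + j) * (fconst (-1) * fXn (N + j).+1).
  by rewrite addnS fppST mulrDr mulr1 addrAC.
rewrite fscaleD fscaleM big_ord_recr mulrDr; apply: norm_sum_leD; first exact: IH.
by apply: norm_sum_leM; [apply: norm_sum_le_fpp | apply: norm_sum_le_monom].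
Qed.

(** The first coefficients of the infinite product are those of a longer finite product. Consecutive
    finite products differ by a monomial times a product bounded by [B], so the distance is at most
    a geometric tail. *)
Lemma fpp_dist v N : fval q feul v ->
  `|v - \prod_(1 <= k < N.+1) (1 - q ^+ k)| <= (B * (1 - `|q|)^-1) * `|q| ^+ N.
Proof.
move=> hv.
have h1 : fval q (feul - fpp (-1) predT N) (v - \prod_(1 <= k < N.+1) (1 - q ^+ k)).
  rewrite (eq_bigr (fun k => 1 + (-1)%:~R * q ^+ k)) => [|k _]; last by rewrite mulN1r.
  by apply: fvalB; [exact: hv | exact: fval_fpp].
apply: has_sum_ler h1.2 _ => m.
apply: le_trans (_ : B * \sum_(i < m) `|q| ^+ (N + i).+1 <= _).
  apply: le_trans (norm_sum_le_tail N m m); apply: ler_sum => n _.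
  have nN : (n < (N + m).+1)%N by have := ltn_ord n; lia.
  have E1 : (feul - fpp (-1) predT N) n = (fpp (-1) predT (N + m) - fpp (-1) predT N) n.
    by rewrite !fcoefD (@fppP (-1) predT (N + m) n nN).
  rewrite -[fscale q (feul - _) n]/(((feul - fpp (-1) predT N) n)%:~R * _) E1.
  exact: lexx.
rewrite -mulrA ler_wpM2l //; first by rewrite lecR expR_ge0.
under eq_bigr do rewrite -addnS exprD.
rewrite -mulr_sumr [leRHS]mulrC ler_wpM2l ?exprn_ge0 //.
apply: le_trans (geometric_sum_le m.+1 (normr_ge0 q) hq).
by rewrite big_ord_recl lerDr exprn_ge0.
Qed.

Lemma fpp_dist_small (e : R) : 0 < e ->
  exists N, forall n, (N <= n)%N -> (B * (1 - `|q|)^-1) * `|q| ^+ n < e%:C.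
Proof.
move=> e0; have rr : `|r| < 1 by rewrite ger0_norm ?r0 ?r1.
have /cvgrPdist_lt /(_ e e0) [N _ hN] := cvg_geometric (expR (1 - r)^-1 * (1 - r)^-1) rr.
exists N => n /hN /=; rewrite sub0r normrN => h.
rewrite -rE -[1]/(1%:C) -rmorphB -fmorphV -rmorphXn -!rmorphM ltcR.
by apply: le_lt_trans (ler_norm _) h.
Qed.

Lemma fval_eul : fval q feul (E q).
Proof.
have [v hv] : exists v, fval q feul v by apply: fval_exists; apply: norm_sum_le_fprod.
suff -> : E q = v by [].
apply: limn_unique => e e0.
have eE : (complex.Re e)%:C = e by apply: RRe_real; rewrite realE (ltW e0).
have [|N hN] := @fpp_dist_small (complex.Re e); first by rewrite -ltcR eE.
by exists N => n /hN; rewrite eE; apply: le_lt_trans; apply: fpp_dist.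
Qed.

(** The finite products stay above a positive constant, whereas a zero limit would make them
    arbitrarily small by [fpp_dist]. *)
Lemma E_neq0 : E q != 0.
Proof.
apply/eqP => E0; have := fval_eul; rewrite E0 => h0.
have [N /(_ N (leqnn N))] := fpp_dist_small (expR_gt0 (- (1 - r)^-1 ^+ 2)).
have := fpp_dist N h0; rewrite sub0r normrN => h1 h2.
suff /le_lt_trans /(_ (le_lt_trans h1 h2)) : (expR (- (1
  - r)^-1 ^+ 2))%:C <= `|\prod_(1 <= k < N.+1) (1 - q ^+ k)| by rewrite ltxx.
apply: le_trans (_ : (\prod_(1 <= k < N.+1) (1 - r ^+ k))%:C <= _).
  by rewrite lecR prod_expR_ge ?r0 ?r1.
rewrite normr_prod rmorph_prod !big_nat; apply: ler_prod => k /andP[k1 _].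
have kr : r ^+ k <= 1 by rewrite exprn_ile1 ?r0 // ltW ?r1.
rewrite lecR subr_ge0 kr /= rmorphB rmorphXn /= rE -normrX.
by apply: le_trans (lerB_dist _ _); rewrite normr1.
Qed.
End EulerValue.

(** * From the formal identities to the theorem *)

(** In the variable q = x^14 the factor x^28 cancels: 42 = 28 + 14 leaves one factor q for rank 1,
    and x^28 = q^2 leaves series in q^2. *)
Lemma core_gf_formulas :
  Fps (fun n => (num_cores 7 1 n)%:R) = fXn 1 * dil 2 core1_rhs :> fps int /\
  Fps (fun n => (num_cores 7 0 n)%:R) = dil 2 core0_rhs :> fps int.
Proof.
have [h1 h0] := core_series_formulas; have X28 : fXn 28 != 0 :> fps int by apply: (@fps_neq0 _ 28).
split; apply: (@dil_inj _ 14) => //; apply: (mulfI X28).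
  rewrite -(@core_series_cores 1 2) // h1 [dil 14 (fXn 1 * _)]rmorphM.
  rewrite -[X in _ = _ * (X * _)]/(dil 14 (fXn 1)) -[X in _ = _ * (_ * X)]/(dil 14 (dil 2 core1_rhs)).
  by rewrite dilXn // dil_comp // mulrA fXnM.
by rewrite -(@core_series_cores 0 4) // h0 dil_comp.
Qed.

Section Values.
Variables (R : realType) (q : R[i]).
Hypothesis hq : `|q| < 1.

Lemma normX_lt1 d : (0 < d)%N -> `|q ^+ d| < 1.
Proof. by move=> d0; rewrite normrX exprn_ilt1 // -lt0n. Qed.

Lemma fval_dil_phi d : (0 < d)%N -> fval q (dil d fphi) (varphi (q ^+ d)).
Proof. by move=> d0; apply: fval_dil => //; apply: fval_phi; apply: normX_lt1. Qed.
Lemma fval_dil_psi d : (0 < d)%N -> fval q (dil d fpsi) (psi (q ^+ d)).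
Proof. by move=> d0; apply: fval_dil => //; apply: fval_psi; apply: normX_lt1. Qed.
Lemma fval_dil_eul d : (0 < d)%N -> fval q (dil d feul) (E (q ^+ d)).
Proof. by move=> d0; apply: fval_dil => //; apply: fval_eul; apply: normX_lt1. Qed.

Lemma fval_dist_E : fval q fdist (E (q ^+ 2) / E q).
Proof.
have [D hD] := fval_dist hq; have := fvalM hD (fval_eul hq).
rewrite fdist_eul => /fval_unique /(_ (fval_dil_eul (d := 2) isT)) <-.
by rewrite mulfK // E_neq0.
Qed.

Lemma fval_G : fval q fG (E (q ^+ 14) * E (q ^+ 7) ^+ 3 * E (q ^+ 2) / E q).
Proof.
rewrite -[X in fval _ _ X]mulrA; apply: fvalM fval_dist_E.
by apply: fvalM; [exact: fval_dil_eul | apply: fvalX; exact: fval_dil_eul].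
Qed.

Ltac fval_tac := lazymatch goal with
  | |- fval _ (@GRing.add _ _ _) _ => refine (fvalD _ _); fval_tac
  | |- fval _ (@GRing.mul _ _ _) _ => refine (fvalM _ _); fval_tac
  | |- fval _ (@GRing.exp _ _ _) _ => refine (fvalX _ _); fval_tac
  | |- fval _ (dil _ fphi) _ => exact: fval_dil_phi
  | |- fval _ (dil _ fpsi) _ => exact: fval_dil_psi
  | |- fval _ (dil _ feul) _ => exact: fval_dil_eul
  | |- fval _ fphi _ => exact: fval_phi
  | |- fval _ fpsi _ => exact: fval_psi
  | |- fval _ fG _ => exact: fval_G
  | |- fval _ (fXn _) _ => exact: fval_Xn
  | |- fval _ (@GRing.natmul _ _ _) _ => exact: fval_nat
  end.

Lemma fval_core1 : fval q core1_rhs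
  (E (q ^+ 14) * E (q ^+ 7) ^+ 3 * E (q ^+ 2) / E q *
   (varphi (q ^+ 2) * varphi (q ^+ 14) + 4 * (q ^+ 1) ^+ 4 * psi (q ^+ 4) * psi (q ^+ 28)
     + q ^+ 1 * psi q * psi (q ^+ 7))).
Proof. by rewrite /core1_rhs /fsigma; fval_tac. Qed.

Lemma fval_core0 : fval q core0_rhs
  ((psi (q ^+ 4) * varphi (q ^+ 14) + (q ^+ 1) ^+ 3 * psi (q ^+ 28) * varphi (q ^+ 2)) *
    (psi (q ^+ 2) ^+ 2 * varphi (q ^+ 7) ^+ 2 + (q ^+ 1) ^+ 3 * psi (q ^+ 14) ^+ 2 * varphi q ^+ 2
      + q ^+ 1 * (E (q ^+ 14) * E (q ^+ 7) ^+ 3 * E (q ^+ 2) / E q))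
   + q ^+ 1 * psi (q ^+ 2) * psi (q ^+ 7) ^+ 2 * varphi (q ^+ 7) ^+ 3
   + 2 * (q ^+ 1) ^+ 2 * psi q ^+ 3 * psi (q ^+ 7) ^+ 3
   + 4 * (q ^+ 1) ^+ 6 * psi (q ^+ 7) ^+ 2 * psi (q ^+ 14) ^+ 3 * varphi q).
Proof. by rewrite /core0_rhs /fomega; fval_tac. Qed.
End Values.

Lemma fval_has_sum (R : realType) (q : R[i]) (a : nat -> nat) v :
  fval q (Fps (fun n => (a n)%:R)) v -> has_sum (fun n => (a n)%:R * q ^+ n) v.
Proof.
move=> [_]; congr has_sum; apply/funext => n.
by rewrite -[LHS]/(((a n)%:R)%:~R * _) rmorph_nat.
Qed.

Ltac compute_muln := repeat match goal with
  | |- context [muln ?a ?b] => let c := eval vm_compute in (muln a b) in change (muln a b) with c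
  end.

Theorem theorem1p2 (R : realType) (q : R[i]) (hq : `|q| < 1) :
  has_sum (fun n : nat => (num_cores 7 1 n)%:R * q ^+ n)
    (q * (E (q ^+ 28) * E (q ^+ 14) ^+ 3 * E (q ^+ 4) / E (q ^+ 2)) *
       (sigma (q ^+ 4) + q ^+ 2 * psi (q ^+ 2) * psi (q ^+ 14)))
  /\
  has_sum (fun n : nat => (num_cores 7 0 n)%:R * q ^+ n)
    (omega (q ^+ 2) *
       (psi (q ^+ 4) ^+ 2 * varphi (q ^+ 14) ^+ 2
        + q ^+ 6 * psi (q ^+ 28) ^+ 2 * varphi (q ^+ 2) ^+ 2
        + q ^+ 2 *
            (E (q ^+ 28) * E (q ^+ 14) ^+ 3 * E (q ^+ 4) / E (q ^+ 2)))
     + q ^+ 2 * psi (q ^+ 4) * psi (q ^+ 14) ^+ 2 * varphi (q ^+ 14) ^+ 3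
     + 2 * q ^+ 4 * psi (q ^+ 2) ^+ 3 * psi (q ^+ 14) ^+ 3
     + 4 * q ^+ 12 * psi (q ^+ 14) ^+ 2 * psi (q ^+ 28) ^+ 3
         * varphi (q ^+ 2)).
Proof.
have hq2 : `|q ^+ 2| < 1 by apply: normX_lt1.
have [gf1 gf0] := core_gf_formulas.
split; apply: fval_has_sum; rewrite (gf1, gf0).
- have := fvalM (fval_Xn q 1) (fval_dil (isT : 0 < 2)%N (fval_core1 hq2)).
  by rewrite [X in fval _ _ X -> _]mulrA /sigma -!exprM; compute_muln => h; exact h.
- have := fval_dil (isT : 0 < 2)%N (fval_core0 hq2).
  by rewrite /omega -!exprM; compute_muln => h; exact h.
Qed.
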